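(* Let $M$ be a four-dimensional hyperkähler space obtained by the $j=2$ generalized Legendre transform construction from a function $L$ of the five variables $x_m$, $m=-2,\dots,2$, and let $q$, $\rho$, $e_2$, $\sigma_1,\sigma_2,\sigma_3$, $\mathring h_m$, $\mathring H_m$, $\mathring H'_0$, $r_3(\mathring h)$, $D^1$ be as defined in the context. From the frame $d\rho,\sigma_1,\sigma_2,\sigma_3$ define the frame $\chi_{+2},\chi_{+1},\chi_{-1},\chi_{-2}$ by $$\begin{pmatrix}\chi_{+2}\\ \chi_{+1}\\ \chi_{-1}\\ \chi_{-2}\end{pmatrix}=\begin{pmatrix}1/4&0&0&-i\rho\\ 0&3ie_2-i\rho&3e_2+\rho&0\\ 0&3ie_2-i\rho&-3e_2-\rho&0\\ 1/4&0&0&i\rho\end{pmatrix}\begin{pmatrix}d\rho\\ \sigma_1\\ \sigma_2\\ \sigma_3\end{pmatrix}$$ and then the frame $\theta_{+2},\theta_{+1},\theta_{-1},\theta_{-2}$ by $$\begin{pmatrix}\chi_{+2}\\ \chi_{+1}\\ \chi_{-1}\\ \chi_{-2}\end{pmatrix}=\begin{pmatrix}\mathring H'_0&0&0&0\\ 2\mathring H_{-1}&\mathring H'_0&\mathring H_{+2}&0\\ 0&\mathring H_{-2}&\mathring H'_0&2\mathring H_{+1}\\ 0&0&0&\mathring H'_0\end{pmatrix}\begin{pmatrix}\theta_{+2}\\ \theta_{+1}\\ \theta_{-1}\\ \theta_{-2}\end{pmatrix}.$$ Then, with $\lambda=r_3(\mathring h)\,\mathring H'_0$, the hyperkähler metric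 of $M$ is $$g=\lambda\,\big(|\theta_{+1}|^2+|\theta_{+2}|^2\big)$$ and its hyperkähler symplectic forms $\omega_m$ ($m=-1,0,+1$) are given by $$\omega^1_m=\sum_{m'=-1}^{1}D^1_{mm'}(q)\,\mathring\omega^1_{m'},$$ where $\omega^1_m=c^1_m\omega_m$, $\mathring\omega^1_m=c^1_m\mathring\omega_m$ with $c^1_m=\sqrt{(1+m)!(1-m)!/2}$, and $$\mathring\omega_{+1}=\lambda\, i\,\theta_{+2}\wedge\bar\theta_{+1},\qquad \mathring\omega_0=\lambda\, i\,(\theta_{+1}\wedge\bar\theta_{+1}-\theta_{+2}\wedge\bar\theta_{+2}),\qquad \mathring\omega_{-1}=\lambda\, i\,\bar\theta_{+2}\wedge\theta_{+1}.$$
   Context: **Generalized Legendre transform, $j=2$, quaternionic dimension one.** Let $x_m$ ($m=-2,\dots,2$) be complex variables with $\bar x_m=(-1)^mx_{-m}$. Let $L$ be a real-valued function of them given by a contour integral $L=\oint_{\mathcal C}\frac{d\zeta}{2\pi i\zeta}H(x_{NS}(\zeta),\zeta)$ with $x_{NS}(\zeta)=\sum_{m=-2}^2x_m\zeta^{-m}$ and $H$ holomorphic (possibly multivalued). Consequently $L_{x_mx_{m'}}$ depends only on $m+m'$ (subscripts denote partial derivatives). Local complex coordinates $z,u$ on $M$ are related to the $x_m$ by $z=x_{+2}$, $L_{x_{+1}}=-iu$, $L_{x_0}=0$ (and complex conjugate equations), which determine $x_m$ as functions of $z,u,\bar z,\bar u$. Put $\kappa=L+iux_{+1}-i\bar u\bar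 x_{+1}$, extremized over $x_{+1},x_0,x_{-1}$ (the extremum conditions are precisely the preceding equations). The hyperkähler structure is $\omega_{+1}=du\wedge dz$, $\omega_0=-i\,\partial\bar\partial\kappa$, $\omega_{-1}=-\overline{\omega_{+1}}$, with metric $g=\kappa_{a\bar b}\,dw^ad\bar w^b$, $w=(z,u)$. Here $\omega_{\pm1}=\pm\frac12(\omega_1\pm i\omega_2)$ and $\omega_0=\omega_3$ in terms of the standard triplet of hyperkähler forms. The metric may be pseudo-Riemannian; quantities that are inverted are assumed nonzero. **Wigner matrices.** For $q=q_0+q_1\mathbf i+q_2\mathbf j+q_3\mathbf k\in\mathbb H\setminus\{0\}$ put $v=q_3+iq_0$, $w=q_1+iq_2$ and, for $m,m'=-j,\dots,j$, $$D^j_{mm'}(q)=\frac{\sqrt{(j+m)!(j-m)!(j+m')!(j-m')!}}{(|v|^2+|w|^2)^j}\;i^{-2j}\sum_s\frac{w^s}{s!}\frac{\bar w^{\,m-m'+s}}{(m-m'+s)!}\frac{v^{\,j+m'-s}}{(j+m'-s)!}\frac{(-\bar v)^{\,j-m-s}}{(j-m-s)!},$$ summed over integers $s$ for which all factorial arguments are nonnegative. These satisfy $D^j(q)D^j(q')=D^j(qq')$. Set $c^j_m=\sqrt{(j+m)!(j-m)!/(2j)!}$. **Quaternionic parametrization.** Define $$r_2(x)=\tfrac12\big[|x_{+2}|^2+\tfrac14|x_{+1}|^2+\tfrac16x_0^2+\tfrac14|x_{-1}|^2+|x_{-2}|^2\big],\qquad r_3(x)=\det\begin{pmatrix}x_{+2}&x_{+1}/4&x_0/6\\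 x_{+1}/4&x_0/6&x_{-1}/4\\ x_0/6&x_{-1}/4&x_{-2}\end{pmatrix},$$ $g_2=4r_2(x)$, $g_3=16r_3(x)$. Let $e_1>e_2>e_3$ be the (real) roots of $X^3-g_2X-g_3$, so that $e_1+e_2+e_3=0$, and put $\rho=e_1-e_3$. Then $x_m$ is parametrized by a quaternion $q$ (defined up to scale) together with $\rho,e_2$ through $$c^2_mx_m=\sum_{m'=-2}^2D^2_{mm'}(q)\,c^2_{m'}\mathring x_{m'},\qquad (\mathring x_m)_{m=-2,\dots,2}=\tfrac14\big(e_1-e_3,\,0,\,6(e_1+e_3),\,0,\,e_1-e_3\big).$$ The constraint $L_{x_0}=0$ is used to express $e_2$ implicitly as a function of $\rho$ and the three rotation parameters of $q$, so that $\rho$ and the rotation parameters of $q$ are local coordinates on $M$. The 1-forms $\sigma_1,\sigma_2,\sigma_3$ are defined by $q^{-1}dq=\sigma_0+\sigma_1\mathbf i+\sigma_2\mathbf j+\sigma_3\mathbf k$. **The functions $h$ and $H$.** For $m=-2,\dots,2$ let $\bar h_m=L_{x_0x_m}$ (equivalently $\bar h_{m+m'}=L_{x_mx_{m'}}$) and let $h_m$ be its complex conjugate; $\bar h_m=(-1)^mh_{-m}$. Define $\mathring h_m$ by $$(c^2_m)^{-1}\mathring h_m=\sum_{m'=-2}^2D^2_{mm'}(q^{-1})\,(c^2_{m'})^{-1}h_{m'}.$$ Put $$r_2(\mathring h)=\tfrac12\big[|\mathring h_{+2}|^2+4|\mathring h_{+1}|^2+6\mathring h_0^2+4|\mathring h_{-1}|^2+|\mathring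 h_{-2}|^2\big],\qquad r_3(\mathring h)=\det\begin{pmatrix}\mathring h_{+2}&\mathring h_{+1}&\mathring h_0\\ \mathring h_{+1}&\mathring h_0&\mathring h_{-1}\\ \mathring h_0&\mathring h_{-1}&\mathring h_{-2}\end{pmatrix},$$ $$\mathring H_{+2}=\mathring h_{+2}\mathring h_0-\mathring h_{+1}^2,\quad \mathring H_{+1}=\tfrac12\mathring h_{+2}\mathring h_{-1}-\tfrac12\mathring h_{+1}\mathring h_0,\quad \mathring H_0=\tfrac16\mathring h_{+2}\mathring h_{-2}+\tfrac13\mathring h_{+1}\mathring h_{-1}-\tfrac12\mathring h_0^2,$$ $\mathring H_{-m}=(-1)^m\overline{\mathring H_m}$, and $\mathring H'_0=\mathring H_0-\frac16r_2(\mathring h)$. *)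

(* Defs.v *)
From Stdlib Require Export Reals ZArith List.
From Coquelicot Require Export Coquelicot.
Export ListNotations.
Open Scope C_scope.

Definition sum_sym (j : nat) (f : Z -> C) : C :=
  fold_right Cplus 0 (map (fun k => f (Z.of_nat k - Z.of_nat j)%Z) (seq 0 (2 * j + 1))).

Definition sum_lt (n : nat) (f : nat -> C) : C := fold_right Cplus 0 (map f (seq 0 n)).

Definition Cpowz (z : C) (k : Z) : C :=
  match k with
  | Z0 => 1
  | Zpos n => z ^ Pos.to_nat n
  | Zneg n => / z ^ Pos.to_nat n
  end.

Definition mx (rows : list (list C)) (i j : nat) : C := nth j (nth i rows []) 0.

Definition mulmv (n : nat) (A : nat -> nat -> C) (v : nat -> C) (i : nat) : C :=
  sum_lt n (fun j => A i j * v j).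

Fixpoint det (n : nat) (A : nat -> nat -> C) : C :=
  match n with
  | O => 1
  | S k => sum_lt (S k) (fun j =>
      (- (1)) ^ j * A O j * det k (fun r s => A (S r) (if Nat.ltb s j then s else S s)))
  end.

Definition Cmod2 (z : C) : C := RtoC (Cmod z ^ 2).

(* Real vector spaces are Coquelicot normed modules over R, and [C] is used with
   its real structure.  Directional derivatives are total functions; they are the
   values of the differential wherever the function is differentiable. *)

Definition dirR {X : NormedModule R_AbsRing} (f : X -> R) (p v : X) : R :=
  Derive (fun t : R => f (plus p (scal t v))) 0.

Definition dir {X : NormedModule R_AbsRing} (f : X -> C) (p v : X) : C :=
  (dirR (fun y => Re (f y)) p v, dirR (fun y => Im (f y)) p v).

(* A point ((x_2, x_1), x_0) of C * C * R stands for (x_m), -2 <= m <= 2, with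
   conj x_m = (-1)^m x_(-m). *)

Definition C2 : NormedModule R_AbsRing :=
  prod_NormedModule R_AbsRing C_R_NormedModule C_R_NormedModule.

Definition X5 : NormedModule R_AbsRing := prod_NormedModule R_AbsRing C2 R_NormedModule.

Definition mkX (x2 x1 : C) (x0 : R) : X5 := ((x2, x1), x0).

Definition xcoord (y : X5) (m : Z) : C :=
  match m with
  | 2%Z => fst (fst y)
  | 1%Z => snd (fst y)
  | 0%Z => RtoC (snd y)
  | (-1)%Z => - Cconj (snd (fst y))
  | (-2)%Z => Cconj (fst (fst y))
  | _ => 0
  end.

(* F_{x_m}: the coefficients in dF = sum_m F_{x_m} dx_m, i.e. Wirtinger
   derivatives in x_2 and x_1, where x_(-1) = - conj x_1 and x_(-2) = conj x_2. *)
Definition partialx (m : Z) (F : X5 -> C) (y : X5) : C :=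
  match m with
  | 2%Z => (dir F y (mkX 1 0 0) - Ci * dir F y (mkX Ci 0 0)) / 2
  | 1%Z => (dir F y (mkX 0 1 0) - Ci * dir F y (mkX 0 Ci 0)) / 2
  | 0%Z => dir F y (mkX 0 0 1)
  | (-1)%Z => - ((dir F y (mkX 0 1 0) + Ci * dir F y (mkX 0 Ci 0)) / 2)
  | (-2)%Z => (dir F y (mkX 1 0 0) + Ci * dir F y (mkX Ci 0 0)) / 2
  | _ => 0
  end.

Definition x_NS (y : X5) (zeta : C) : C :=
  sum_sym 2 (fun m => xcoord y m * Cpowz zeta (- m)).

Definition CC2 : NormedModule C_AbsRing :=
  prod_NormedModule C_AbsRing C_NormedModule C_NormedModule.

(* Continuously complex differentiable on an open set. *)
Definition holomorphic2 (U : CC2 -> Prop) (F : CC2 -> C) : Prop :=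
  open U /\
  exists F1 F2 : CC2 -> C, forall p : CC2, U p ->
    continuous F1 p /\ continuous F2 p /\
    @filterdiff C_AbsRing CC2 C_NormedModule F (locally p)
      (fun v => F1 p * fst v + F2 p * snd v).

(* A piece of the contour, parametrized by [0,1], with the branch of the
   integrand used along it. *)
Record arc := mkArc {
  path : R -> C;
  velocity : R -> C;
  branch : CC2 -> C;
  branch_dom : CC2 -> Prop
}.

Definition arc_ok (Omega : X5 -> Prop) (a : arc) : Prop :=
  (forall t : R, @is_derive R_AbsRing C_R_NormedModule (path a) t (velocity a t)) /\
  (forall t : R, continuous (velocity a) t) /\
  holomorphic2 (branch_dom a) (branch a) /\
  (forall t : R, (0 <= t <= 1)%R -> path a t <> 0) /\
  (forall (y : X5) (t : R), Omega y -> (0 <= t <= 1)%R ->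
    branch_dom a (x_NS y (path a t), path a t)).

(* [b] starts where [a] ends and carries the continuation of its branch. *)
Definition joined (Omega : X5 -> Prop) (a b : arc) : Prop :=
  path a 1 = path b 0 /\
  forall y : X5, Omega y ->
    locally ((x_NS y (path a 1), path a 1) : CC2) (fun p => branch a p = branch b p).

Definition closed_loop (Omega : X5 -> Prop) (l : list arc) : Prop :=
  forall (i : nat) (a b : arc),
    nth_error l i = Some a -> nth_error l (S i mod length l) = Some b ->
    arc_ok Omega a /\ joined Omega a b.

Definition arc_integral (a : arc) (y : X5) : C :=
  @RInt C_R_CompleteNormedModule
    (fun t => branch a (x_NS y (path a t), path a t)
              * velocity a t / (2 * RtoC PI * Ci * path a t)) 0%R 1%R.

Definition contour_integral (loops : list (list arc)) (y : X5) : C :=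
  fold_right Cplus 0 (map (fun a => arc_integral a y) (concat loops)).

(* L = \oint dzeta / (2 pi i zeta) H (x_NS (zeta), zeta), real valued. *)
Definition contour_potential (Omega : X5 -> Prop) (L : X5 -> R) : Prop :=
  exists loops : list (list arc),
    List.Forall (closed_loop Omega) loops /\
    forall y : X5, Omega y -> RtoC (L y) = contour_integral loops y.

(* A point of C2 is (z, u).  The conjugate equations L_{x_(-1)} = - i conj u hold
   automatically since L is real; the equations for x_1, x_0, x_(-1) are the
   extremum conditions of kappa. *)

Definition Lc (L : X5 -> R) : X5 -> C := fun y => RtoC (L y).

Definition legendre_solution (Omega : X5 -> Prop) (L : X5 -> R)
    (V : C2 -> Prop) (x : C2 -> X5) : Prop :=
  forall p : C2, V p ->
    Omega (x p) /\
    ex_filterdiff x (locally p) /\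
    xcoord (x p) 2 = fst p /\
    partialx 1 (Lc L) (x p) = - Ci * snd p /\
    partialx 0 (Lc L) (x p) = 0.

Definition kappa (L : X5 -> R) (x : C2 -> X5) (p : C2) : C :=
  Lc L (x p) + Ci * snd p * xcoord (x p) 1
  - Ci * Cconj (snd p) * Cconj (xcoord (x p) 1).

(* w^0 = z, w^1 = u. *)
Definition unitw (a : nat) (c : C) : C2 :=
  match a with O => (c, RtoC 0) | _ => (RtoC 0, c) end.

Definition d_w (a : nat) (F : C2 -> C) (p : C2) : C :=
  (dir F p (unitw a 1) - Ci * dir F p (unitw a Ci)) / 2.

Definition d_wbar (a : nat) (F : C2 -> C) (p : C2) : C :=
  (dir F p (unitw a 1) + Ci * dir F p (unitw a Ci)) / 2.

Definition covector := C2 -> C.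
Definition bilin := C2 -> C2 -> C.

Definition dw (a : nat) : covector :=
  fun xi => match a with O => fst xi | _ => snd xi end.

Definition bar (alpha : covector) : covector := fun xi => Cconj (alpha xi).

Definition wedge (alpha beta : covector) : bilin :=
  fun xi eta => alpha xi * beta eta - alpha eta * beta xi.

Definition symprod (alpha beta : covector) : bilin :=
  fun xi eta => (alpha xi * beta eta + alpha eta * beta xi) / 2.

Definition abs2 (theta : covector) : bilin := symprod theta (bar theta).

Definition kappa_hess (L : X5 -> R) (x : C2 -> X5) (p : C2) (a b : nat) : C :=
  d_w a (d_wbar b (kappa L x)) p.

Definition metric (L : X5 -> R) (x : C2 -> X5) (p : C2) : bilin :=
  fun xi eta => sum_lt 2 (fun a => sum_lt 2 (fun b =>
    kappa_hess L x p a b * symprod (dw a) (bar (dw b)) xi eta)).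

Definition omega (L : X5 -> R) (x : C2 -> X5) (p : C2) (m : Z) : bilin :=
  fun xi eta =>
  match m with
  | 1%Z => wedge (dw 1) (dw 0) xi eta
  | 0%Z => - Ci * sum_lt 2 (fun a => sum_lt 2 (fun b =>
             kappa_hess L x p a b * wedge (dw a) (bar (dw b)) xi eta))
  | (-1)%Z => - Cconj (wedge (dw 1) (dw 0) xi eta)
  | _ => 0
  end.

Record quat := mkQuat { q0 : R; q1 : R; q2 : R; q3 : R }.

Definition quat0 : quat := mkQuat 0 0 0 0.

Definition qmul (a b : quat) : quat :=
  mkQuat (q0 a * q0 b - q1 a * q1 b - q2 a * q2 b - q3 a * q3 b)
         (q0 a * q1 b + q1 a * q0 b + q2 a * q3 b - q3 a * q2 b)
         (q0 a * q2 b - q1 a * q3 b + q2 a * q0 b + q3 a * q1 b)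
         (q0 a * q3 b + q1 a * q2 b - q2 a * q1 b + q3 a * q0 b).

Definition qnorm2 (a : quat) : R := (q0 a ^ 2 + q1 a ^ 2 + q2 a ^ 2 + q3 a ^ 2)%R.

Definition qinv (a : quat) : quat :=
  mkQuat (q0 a / qnorm2 a) (- q1 a / qnorm2 a) (- q2 a / qnorm2 a) (- q3 a / qnorm2 a).

Definition factZ (k : Z) : R := INR (fact (Z.to_nat k)).

(* Integral spin only; -j <= m, m' <= j. *)
Definition wigner (j : nat) (m m' : Z) (q : quat) : C :=
  let v : C := (q3 q, q0 q) in
  let w : C := (q1 q, q2 q) in
  let J := Z.of_nat j in
  RtoC (sqrt (factZ (J + m) * factZ (J - m) * factZ (J + m') * factZ (J - m'))
        / (Cmod v ^ 2 + Cmod w ^ 2) ^ j)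
  * / Ci ^ (2 * j)
  * sum_lt (2 * j + 1) (fun s =>
      let k := Z.of_nat s in
      if ((0 <=? m - m' + k) && (0 <=? J + m' - k) && (0 <=? J - m - k))%Z%bool then
        w ^ s / RtoC (factZ k)
        * (Cconj w ^ Z.to_nat (m - m' + k) / RtoC (factZ (m - m' + k)))
        * (v ^ Z.to_nat (J + m' - k) / RtoC (factZ (J + m' - k)))
        * ((- Cconj v) ^ Z.to_nat (J - m - k) / RtoC (factZ (J - m - k)))
      else 0).

Definition cc (j : nat) (m : Z) : C :=
  RtoC (sqrt (factZ (Z.of_nat j + m) * factZ (Z.of_nat j - m) / factZ (2 * Z.of_nat j))).

Definition r2x (y : X5) : C :=
  / 2 * (Cmod2 (xcoord y 2) + / 4 * Cmod2 (xcoord y 1) + / 6 * xcoord y 0 ^ 2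
         + / 4 * Cmod2 (xcoord y (-1)) + Cmod2 (xcoord y (-2))).

Definition r3x (y : X5) : C :=
  det 3 (mx [[xcoord y 2;     xcoord y 1 / 4;    xcoord y 0 / 6];
             [xcoord y 1 / 4; xcoord y 0 / 6;    xcoord y (-1) / 4];
             [xcoord y 0 / 6; xcoord y (-1) / 4; xcoord y (-2)]]).

Definition cubic (y : X5) (X : C) : C := X ^ 3 - 4 * r2x y * X - 16 * r3x y.

Definition xring (e1 e2 e3 : R) (m : Z) : C :=
  match m with
  | 2%Z | (-2)%Z => / 4 * (RtoC e1 - RtoC e3)
  | 0%Z => / 4 * (6 * (RtoC e1 + RtoC e3))
  | _ => 0
  end.

Definition rho (e1 e3 : C2 -> R) (p : C2) : R := (e1 p - e3 p)%R.

Definition differentiableR (f : C2 -> R) (p : C2) : Prop :=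
  @ex_filterdiff R_AbsRing C2 R_NormedModule f (locally p).

Definition quaternionic_param (V : C2 -> Prop) (x : C2 -> X5)
    (q : C2 -> quat) (e1 e2 e3 : C2 -> R) : Prop :=
  forall p : C2, V p ->
    q p <> quat0 /\
    (differentiableR (fun p' => q0 (q p')) p /\ differentiableR (fun p' => q1 (q p')) p /\
     differentiableR (fun p' => q2 (q p')) p /\ differentiableR (fun p' => q3 (q p')) p) /\
    (differentiableR e1 p /\ differentiableR e2 p /\ differentiableR e3 p) /\
    (e3 p < e2 p < e1 p)%R /\
    (forall X : C, cubic (x p) X = 0 <->
       X = RtoC (e1 p) \/ X = RtoC (e2 p) \/ X = RtoC (e3 p)) /\
    (forall m : Z, (-2 <= m <= 2)%Z ->
       cc 2 m * xcoord (x p) m =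
       sum_sym 2 (fun m' => wigner 2 m m' (q p) * (cc 2 m' * xring (e1 p) (e2 p) (e3 p) m'))).

Definition dquat (q : C2 -> quat) (p xi : C2) : quat :=
  mkQuat (dirR (fun p' => q0 (q p')) p xi) (dirR (fun p' => q1 (q p')) p xi)
         (dirR (fun p' => q2 (q p')) p xi) (dirR (fun p' => q3 (q p')) p xi).

(* sigma_0 + sigma_1 i + sigma_2 j + sigma_3 k = q^(-1) dq. *)
Definition sigma (q : C2 -> quat) (p xi : C2) : quat := qmul (qinv (q p)) (dquat q p xi).

Definition rho_sigma_frame (V : C2 -> Prop) (q : C2 -> quat) (e1 e3 : C2 -> R) : Prop :=
  forall p xi : C2, V p ->
    dirR (rho e1 e3) p xi = 0%R ->
    q1 (sigma q p xi) = 0%R -> q2 (sigma q p xi) = 0%R -> q3 (sigma q p xi) = 0%R ->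
    xi = zero.

Definition h (L : X5 -> R) (y : X5) (m : Z) : C :=
  Cconj (partialx m (partialx 0 (Lc L)) y).

Definition hring (L : X5 -> R) (y : X5) (q : quat) (m : Z) : C :=
  cc 2 m * sum_sym 2 (fun m' => wigner 2 m m' (qinv q) * (/ cc 2 m' * h L y m')).

Definition r2h (k : Z -> C) : C :=
  / 2 * (Cmod2 (k 2%Z) + 4 * Cmod2 (k 1%Z) + 6 * k 0%Z ^ 2
         + 4 * Cmod2 (k (-1)%Z) + Cmod2 (k (-2)%Z)).

Definition r3h (k : Z -> C) : C :=
  det 3 (mx [[k 2%Z; k 1%Z;    k 0%Z];
             [k 1%Z; k 0%Z;    k (-1)%Z];
             [k 0%Z; k (-1)%Z; k (-2)%Z]]).

Definition Hplus2 (k : Z -> C) : C := k 2%Z * k 0%Z - k 1%Z ^ 2.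
Definition Hplus1 (k : Z -> C) : C := / 2 * k 2%Z * k (-1)%Z - / 2 * k 1%Z * k 0%Z.

Definition Hring (k : Z -> C) (m : Z) : C :=
  match m with
  | 2%Z => Hplus2 k
  | 1%Z => Hplus1 k
  | 0%Z => / 6 * k 2%Z * k (-2)%Z + / 3 * k 1%Z * k (-1)%Z - / 2 * k 0%Z ^ 2
  | (-1)%Z => - Cconj (Hplus1 k)
  | (-2)%Z => Cconj (Hplus2 k)
  | _ => 0
  end.

Definition H0' (k : Z -> C) : C := Hring k 0 - / 6 * r2h k.

(* Columns of four components are ordered +2, +1, -1, -2; frame0 is
   (d rho, sigma_1, sigma_2, sigma_3). *)
Definition frame0 (q : C2 -> quat) (e1 e3 : C2 -> R) (p xi : C2) (i : nat) : C :=
  nth i [RtoC (dirR (rho e1 e3) p xi); RtoC (q1 (sigma q p xi));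
         RtoC (q2 (sigma q p xi)); RtoC (q3 (sigma q p xi))] 0.

Definition chi_mx (r e2 : R) : nat -> nat -> C :=
  let r := RtoC r in
  let e2 := RtoC e2 in
  let o := RtoC 0 in
  mx [[/ 4; o;                    o;              - Ci * r];
      [o;   3 * Ci * e2 - Ci * r; 3 * e2 + r;     o];
      [o;   3 * Ci * e2 - Ci * r; - (3 * e2) - r; o];
      [/ 4; o;                    o;              Ci * r]].

Definition chi (q : C2 -> quat) (e1 e2 e3 : C2 -> R) (p xi : C2) : nat -> C :=
  mulmv 4 (chi_mx (rho e1 e3 p) (e2 p)) (frame0 q e1 e3 p xi).

Definition theta_mx (k : Z -> C) : nat -> nat -> C :=
  let o := RtoC 0 in
  mx [[H0' k;            o;            o;         o];
      [2 * Hring k (-1); H0' k;        Hring k 2; o];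
      [o;                Hring k (-2); H0' k;     2 * Hring k 1];
      [o;                o;            o;         H0' k]].

Definition theta_col (theta : Z -> covector) (xi : C2) (i : nat) : C :=
  nth i [theta 2%Z xi; theta 1%Z xi; theta (-1)%Z xi; theta (-2)%Z xi] 0.

Definition lambda (k : Z -> C) : C := r3h k * H0' k.

Definition omega_ring (lam : C) (theta : Z -> covector) (m : Z) : bilin :=
  fun xi eta =>
  match m with
  | 1%Z => lam * Ci * wedge (theta 2%Z) (bar (theta 1%Z)) xi eta
  | 0%Z => lam * Ci * (wedge (theta 1%Z) (bar (theta 1%Z)) xi eta
                       - wedge (theta 2%Z) (bar (theta 2%Z)) xi eta)
  | (-1)%Z => lam * Ci * wedge (bar (theta 2%Z)) (theta 1%Z) xi eta
  | _ => 0
  end.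

(* Main.v *)
Require Import Defs.
From Stdlib Require Import Lra Lia ClassicalEpsilon Classical.

(** The one-forms dx_m, subject to sum_m L_{x_0 x_m} dx_m = 0, determine the symplectic forms:
    differentiating the Legendre relations gives omega_m = (i/4) C_m(dx, dx), where C is a
    covariant of spin 1, linear in the spin 2 object L_{x_0 x_m} and alternating bilinear in dx.
    Rotating by q reduces C to the principal-axes frame; there the spin 2 vector dx becomes
    (chi, -3/2 d e_2), the constraint eliminates d e_2, and chi = M theta turns C into
    4 lambda theta /\ theta.  For the metric, omega_{+1} = -(i lambda / |q|^2) A /\ B with A, B
    combinations of theta and its conjugate, so A and B are of type (1,0); since the differential
    of (d kappa)^{0,1} is (lambda / |q|^2) (A /\ conj A + B /\ conj B), the form omega_0 is of
    type (1,1) and the metric is (lambda / |q|^2) (|A|^2 + |B|^2).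

    The Hankel structure of the Hessian of L comes from differentiating twice under the contour
    integral; that the integrand is twice differentiable in x_NS follows from the mean value
    property on circles, F_x(x) = (1 / 2 pi r) int F(x + r e^{is}) e^{-is} ds. *)

(** * Arithmetic in C *)

(** Two derivatives of the contour integrand bring down zeta^(-m-m'), so the Hessian of L consists
    of five numbers, a spin 2 object dual to dx; this is what makes a spin 1 covariant of H, dx, dx
    available. The entries of the theta matrix are 2 x 2 minors of the Hankel matrix of these
    numbers, whose determinant is r_3. After chi = M theta the covariant has degree 1 + 2 + 2 = 5 in
    them, and lambda is r_3 times one more minor. Eliminating d e_2 divides by h_0. That h_0 does
    not vanish has to be extracted from the independence of d rho, sigma_1, sigma_2, sigma_3. The
    complex structure is given by z and u, whereas the theta come from d rho and the sigma_i, so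
    their types cannot be read off. A nonzero decomposable 2-form determines the plane spanned by
    its factors; factoring omega_{+1} = du /\ dz therefore exhibits two combinations A, B of the
    theta and their conjugates that lie in the span of dz and du. *)

Lemma C_morph : ring_morph (RtoC 0) (RtoC 1) Cplus Cmult Cminus Copp eq
  0%Z 1%Z Z.add Z.mul Z.sub Z.opp Z.eqb (fun z => RtoC (IZR z)).
Proof.
  split; intros;
    rewrite ?plus_IZR, ?minus_IZR, ?mult_IZR, ?opp_IZR, ?RtoC_plus, ?RtoC_minus, ?RtoC_mult,
        ?RtoC_opp; auto.
  now apply Z.eqb_eq in H; subst.
Qed.

Lemma C_power : power_theory (RtoC 1) Cmult eq N.to_nat Cpow.
Proof.
  constructor. intros r n. destruct n as [|n]; auto.
  simpl. induction n using Pos.peano_ind.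
  - simpl. ring.
  - rewrite Pos2Nat.inj_succ. rewrite Cpow_S, IHn. rewrite pow_pos_succ; auto.
    + apply Eqsth.
    + intros ? ? -> ? ? ->; auto.
    + intros; ring.
Qed.

Ltac C_cst t :=
  match t with
  | RtoC (IZR ?z) => match isZcst z with true => z | _ => constr:(InitialRing.NotConstant) end
  | _ => constr:(InitialRing.NotConstant)
  end.
Ltac C_pow_tac t := match isnatcst t with true => constr:(N.of_nat t) | _ =>
    constr:(InitialRing.NotConstant) end.

Add Field C_num : C_field_theory (morphism C_morph, constants [C_cst], power_tac C_power
    [C_pow_tac]).

Lemma Ci_sqr : Ci * Ci = RtoC (-1).
Proof. unfold Ci, Cmult, RtoC; simpl; f_equal; ring. Qed.

Lemma Ci_conj : Cconj Ci = - Ci.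
Proof. unfold Ci, Cconj, Copp; simpl; f_equal; ring. Qed.

Lemma RtoC_neq (a b : R) : a <> b -> RtoC a <> RtoC b.
Proof. intros H E. apply H. now injection E. Qed.

Lemma two_pi_i_neq0 : 2 * RtoC PI * Ci <> 0.
Proof.
  repeat apply Cmult_neq_0.
  - apply RtoC_neq; lra.
  - apply RtoC_neq, PI_neq0.
  - intros E. pose proof Ci_sqr as E2. rewrite E in E2. apply (RtoC_neq (-1) 0); [lra|]. rewrite <-
      E2. ring.
Qed.

(** * Rotations of spin 2 and spin 1 *)

(* The entries of N^j (c^j_m)^-1 D^j_{m m'} c^j_{m'}, N = |q|^2, for j = 2 and j = 1; conj v and
   conj w become independent variables [vb] and [wb], which makes covariance a polynomial
   identity. *)
Definition rot2 (v w vb wb : C) (m m' : Z) : C :=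
  mx [[vb ^ 4;
       - (vb ^ 3 * w);
       vb ^ 2 * w ^ 2;
       - (vb * w ^ 3);
       w ^ 4];
      [- (4 * vb ^ 3 * wb);
       - v * vb ^ 3 + 3 * vb ^ 2 * w * wb;
       2 * v * vb ^ 2 * w - 2 * vb * w ^ 2 * wb;
       - 3 * v * vb * w ^ 2 + w ^ 3 * wb;
       4 * v * w ^ 3];
      [6 * vb ^ 2 * wb ^ 2;
       3 * v * vb ^ 2 * wb - 3 * vb * w * wb ^ 2;
       v ^ 2 * vb ^ 2 - 4 * v * vb * w * wb + w ^ 2 * wb ^ 2;
       - 3 * v ^ 2 * vb * w + 3 * v * w ^ 2 * wb;
       6 * v ^ 2 * w ^ 2];
      [- (4 * vb * wb ^ 3);
       - 3 * v * vb * wb ^ 2 + w * wb ^ 3;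
       - 2 * v ^ 2 * vb * wb + 2 * v * w * wb ^ 2;
       - v ^ 3 * vb + 3 * v ^ 2 * w * wb;
       4 * v ^ 3 * w];
      [wb ^ 4;
       v * wb ^ 3;
       v ^ 2 * wb ^ 2;
       v ^ 3 * wb;
       v ^ 4]]
    (Z.to_nat (m + 2)) (Z.to_nat (m' + 2)).
Definition rot1 (v w vb wb : C) (m m' : Z) : C :=
  mx [[- (vb ^ 2);
       vb * w;
       - (w ^ 2)];
      [2 * vb * wb;
       v * vb - w * wb;
       - (2 * v * w)];
      [- (wb ^ 2);
       - (v * wb);
       - (v ^ 2)]]
    (Z.to_nat (m + 1)) (Z.to_nat (m' + 1)).

Definition rotate2 (v w vb wb : C) (X : Z -> C) (m : Z) : C :=
  sum_sym 2 (fun k => rot2 v w vb wb m k * X k).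

(** When [H (m + m')] is the Hessian of L and X = dx, this is the differential of L_{x_i}. *)
Definition contract (H : Z -> C) (i : Z) (X : Z -> C) : C :=
  sum_sym 2 (fun m => H (i + m)%Z * X m).

Definition alt (F G : (Z -> C) -> C) (X Y : Z -> C) : C := F X * G Y - F Y * G X.

(* Chosen so that covariance holds for all [X], [Y]; on the constraint [contract H 0 X = 0] only
   the terms with coefficient 4 remain. The entries [H k] with |k| > 2 cancel. *)
Definition cov (H : Z -> C) (X Y : Z -> C) (m : Z) : C :=
  let F i := contract H i in
  let x i := fun X : Z -> C => X i in
  match m with
  | 1%Z => 4 * alt (F 1%Z) (x 2%Z) X Y + alt (F 0%Z) (x 1%Z) X Y
  | 0%Z => - (4 * alt (F (-2)%Z) (x (-2)%Z) X Y + 4 * alt (F (-1)%Z) (x (-1)%Z) X Y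
              + 2 * alt (F 0%Z) (x 0%Z) X Y)
  | (-1)%Z => - (4 * alt (F (-1)%Z) (x (-2)%Z) X Y + alt (F 0%Z) (x (-1)%Z) X Y)
  | _ => 0
  end.

Lemma sum_sym2 (f : Z -> C) :
  sum_sym 2 f = f (-2)%Z + (f (-1)%Z + (f 0%Z + (f 1%Z + (f 2%Z + 0)))).
Proof. reflexivity. Qed.

Lemma sum_sym1 (f : Z -> C) : sum_sym 1 f = f (-1)%Z + (f 0%Z + (f 1%Z + 0)).
Proof. reflexivity. Qed.

Ltac spin2 m := assert (m = -2 \/ m = -1 \/ m = 0 \/ m = 1 \/ m = 2)%Z as [-> | [-> | [-> | [-> |
    ->]]]] by lia.
Ltac spin1 m := assert (m = -1 \/ m = 0 \/ m = 1)%Z as [-> | [-> | ->]] by lia.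

Ltac expand :=
  cbv beta iota zeta delta [cov rotate2 contract alt rot1 rot2 mx nth Z.add Z.opp Z.sub Z.pos_sub
    Z.to_nat Pos.to_nat Pos.iter_op Pos.add Pos.succ Pos.pred_double Nat.add Z.double
    Z.succ_double Z.pred_double];
  rewrite ?sum_sym2, ?sum_sym1;
  cbv beta iota zeta delta [mx nth Z.add Z.opp Z.sub Z.pos_sub
    Z.to_nat Pos.to_nat Pos.iter_op Pos.add Pos.succ Pos.pred_double Nat.add Z.double
    Z.succ_double Z.pred_double].

(** A polynomial identity, of degree 8 in v, w, vb, wb on both sides: X and Y are rotated by the
    columns of [rot2], H by its rows, and the remaining factor is N = v vb + w wb. *)
Lemma cov_rotate (v w vb wb : C) (H H' X Y : Z -> C) (m : Z) :
  (-1 <= m <= 1)%Z ->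
  (forall k, (-2 <= k <= 2)%Z -> H' k = sum_sym 2 (fun m => H m * rot2 v w vb wb m k)) ->
  cov H (rotate2 v w vb wb X) (rotate2 v w vb wb Y) m =
  (v * vb + w * wb) * sum_sym 1 (fun k => rot1 v w vb wb m k * cov H' X Y k).
Proof.
  intros Hm HH.
  pose proof (HH (-2)%Z ltac:(lia)) as A1; pose proof (HH (-1)%Z ltac:(lia)) as A2;
  pose proof (HH (0)%Z ltac:(lia)) as A3; pose proof (HH (1)%Z ltac:(lia)) as A4;
  pose proof (HH (2)%Z ltac:(lia)) as A5. clear HH. revert A1 A2 A3 A4 A5.
  spin1 m; expand; intros A1 A2 A3 A4 A5; rewrite A1, A2, A3, A4, A5; ring.
Qed.

(** * Wigner matrices as polynomials in v and w *)

Definition qv (q : quat) : C := (q3 q, q0 q).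
Definition qw (q : quat) : C := (q1 q, q2 q).

Lemma factZ_pos (k : Z) : (0 < factZ k)%R.
Proof. apply INR_fact_lt_0. Qed.

Lemma qnorm2_Cmod (q : quat) : (Cmod (qv q) ^ 2 + Cmod (qw q) ^ 2)%R = qnorm2 q.
Proof.
  unfold Cmod. rewrite !pow2_sqrt; unfold qnorm2, qv, qw; simpl; nra.
Qed.

Lemma qnorm2_mult (q : quat) :
  RtoC (qnorm2 q) = qv q * Cconj (qv q) + qw q * Cconj (qw q).
Proof. unfold qnorm2, qv, qw, RtoC, Cconj, Cmult, Cplus; simpl; f_equal; ring. Qed.

Lemma qnorm2_pos (q : quat) : q <> quat0 -> (0 < qnorm2 q)%R.
Proof.
  intros Hq. destruct (Rle_lt_dec (qnorm2 q) 0) as [H|H]; [exfalso|easy].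
  apply Hq. destruct q as [a b c d]. unfold qnorm2 in H; simpl in H.
  unfold quat0; f_equal; nra.
Qed.

Lemma cc_sqr (j : nat) (m : Z) :
  cc j m * cc j m = RtoC (factZ (Z.of_nat j + m) * factZ (Z.of_nat j - m) / factZ (2 * Z.of_nat j)).
Proof.
  unfold cc. rewrite <- RtoC_mult, sqrt_sqrt; auto.
  apply Rlt_le. pose proof factZ_pos.
  apply Rdiv_lt_0_compat; auto. apply Rmult_lt_0_compat; auto.
Qed.

Lemma cc_neq0 (j : nat) (m : Z) : cc j m <> 0.
Proof.
  apply RtoC_neq, Rgt_not_eq, sqrt_lt_R0. pose proof factZ_pos.
  apply Rdiv_lt_0_compat; auto. apply Rmult_lt_0_compat; auto.
Qed.

Lemma sqrt_cc (j : nat) (m m' : Z) :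
  RtoC (sqrt (factZ (Z.of_nat j + m) * factZ (Z.of_nat j - m) * factZ (Z.of_nat j + m') * factZ
      (Z.of_nat j - m')))
  = RtoC (factZ (2 * Z.of_nat j)) * cc j m * cc j m'.
Proof.
  unfold cc. rewrite <- !RtoC_mult. f_equal.
  assert (A := fun k => factZ_pos k).
  assert (0 <= factZ (2 * Z.of_nat j))%R by (apply Rlt_le; auto).
  assert (P : forall m, (0 <= factZ (Z.of_nat j + m) * factZ (Z.of_nat j - m) / factZ (2 * Z.of_nat
      j))%R).
  { intros k. apply Rlt_le, Rdiv_lt_0_compat; auto. apply Rmult_lt_0_compat; auto. }
  set (f := factZ (2 * Z.of_nat j)) in *.
  rewrite (Rmult_assoc f), <- sqrt_mult by auto.
  rewrite <- (sqrt_square f) at 1 by auto.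
  rewrite <- sqrt_mult by (apply Rmult_le_pos; auto).
  f_equal. field. apply Rgt_not_eq, A.
Qed.

Definition wsum (j : nat) (m m' : Z) (v w : C) : C :=
  let J := Z.of_nat j in
  sum_lt (2 * j + 1) (fun s =>
      let k := Z.of_nat s in
      if ((0 <=? m - m' + k) && (0 <=? J + m' - k) && (0 <=? J - m - k))%Z%bool then
        w ^ s / RtoC (factZ k)
        * (Cconj w ^ Z.to_nat (m - m' + k) / RtoC (factZ (m - m' + k)))
        * (v ^ Z.to_nat (J + m' - k) / RtoC (factZ (J + m' - k)))
        * ((- Cconj v) ^ Z.to_nat (J - m - k) / RtoC (factZ (J - m - k)))
      else 0).

(** The square root in D^j factors as (2j)! c_m c_m'. Conjugating with c therefore removes all roots
    and leaves a polynomial in v, w and their conjugates, divided by N^j. *)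
Lemma wigner_wsum (j : nat) (m m' : Z) (q : quat) : q <> quat0 ->
  wigner j m m' q = cc j m * / cc j m' *
    (RtoC (factZ (Z.of_nat j + m') * factZ (Z.of_nat j - m')) * / Ci ^ (2 * j) * wsum j m m' (qv q)
        (qw q))
    / RtoC (qnorm2 q) ^ j.
Proof.
  intros Hq. unfold wigner. fold (qv q) (qw q). fold (wsum j m m' (qv q) (qw q)).
  rewrite qnorm2_Cmod.
  set (S := wsum j m m' (qv q) (qw q)). set (I := / Ci ^ (2 * j)).
  assert (N : RtoC (qnorm2 q) <> 0) by (apply RtoC_neq, Rgt_not_eq, qnorm2_pos, Hq).
  rewrite RtoC_div, sqrt_cc, RtoC_pow by (apply pow_nonzero, Rgt_not_eq, qnorm2_pos, Hq).
  assert (E : RtoC (factZ (Z.of_nat j + m') * factZ (Z.of_nat j - m'))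
     = RtoC (factZ (2 * Z.of_nat j)) * (cc j m' * cc j m')).
  { rewrite cc_sqr, <- RtoC_mult. f_equal. field. apply Rgt_not_eq, factZ_pos. }
  rewrite E. field. split; [apply cc_neq0|]. now apply Cpow_nz.
Qed.

Lemma factZ_values : factZ 0 = 1%R /\ factZ 1 = 1%R /\ factZ 2 = 2%R /\ factZ 3 = 6%R /\ factZ 4 =
    24%R.
Proof. unfold factZ; simpl; repeat split; lra. Qed.

Ltac eval_wsum :=
  let F0 := fresh in let F1 := fresh in let F2 := fresh in let F3 := fresh in let F4 := fresh in
  destruct factZ_values as (F0 & F1 & F2 & F3 & F4);
  unfold wsum, sum_lt; expand; simpl map; simpl seq; simpl Z.of_nat; simpl Nat.mul; cbv beta iota
      zeta;
  simpl Z.add; simpl Z.sub; simpl Z.leb; cbv beta iota delta [andb]; simpl Z.to_nat; simpl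
      fold_right;
  rewrite ?F0, ?F1, ?F2, ?F3, ?F4.

Lemma Ci_pow4 : Ci ^ (2 * 2) = 1.
Proof. simpl. ring [Ci_sqr]. Qed.
Lemma Ci_pow2 : Ci ^ (2 * 1) = RtoC (-1).
Proof. simpl. ring [Ci_sqr]. Qed.

Lemma wigner2 (m m' : Z) (q : quat) : q <> quat0 -> (-2 <= m <= 2)%Z -> (-2 <= m' <= 2)%Z ->
  wigner 2 m m' q = cc 2 m * / cc 2 m' * rot2 (qv q) (qw q) (Cconj (qv q)) (Cconj (qw q)) m m'
                     / RtoC (qnorm2 q) ^ 2.
Proof.
  intros Hq Hm Hm'. rewrite wigner_wsum by easy. rewrite Ci_pow4.
  f_equal. f_equal.
  spin2 m; spin2 m'; eval_wsum; rewrite ?RtoC_mult; field; repeat split; apply RtoC_neq; lra.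
Qed.

Lemma wigner1 (m m' : Z) (q : quat) : q <> quat0 -> (-1 <= m <= 1)%Z -> (-1 <= m' <= 1)%Z ->
  wigner 1 m m' q = cc 1 m * / cc 1 m' * rot1 (qv q) (qw q) (Cconj (qv q)) (Cconj (qw q)) m m'
                     / RtoC (qnorm2 q).
Proof.
  intros Hq Hm Hm'. rewrite wigner_wsum by easy. rewrite Ci_pow2.
  simpl Cpow. rewrite Cmult_1_r.
  f_equal. f_equal.
  spin1 m; spin1 m'; eval_wsum; rewrite ?RtoC_mult; field; repeat split; apply RtoC_neq; lra.
Qed.

Lemma qv_inv (q : quat) : q <> quat0 -> qv (qinv q) = - Cconj (qv q) / RtoC (qnorm2 q).
Proof.
  intros Hq. apply qnorm2_pos in Hq. unfold Cdiv. rewrite <- RtoC_inv by lra.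
  unfold qv, qinv, Cconj, Copp, RtoC, Cmult; simpl; f_equal; field; lra.
Qed.

Lemma qw_inv (q : quat) : q <> quat0 -> qw (qinv q) = - qw q / RtoC (qnorm2 q).
Proof.
  intros Hq. apply qnorm2_pos in Hq. unfold Cdiv. rewrite <- RtoC_inv by lra.
  unfold qw, qinv, Cconj, Copp, RtoC, Cmult; simpl; f_equal; field; lra.
Qed.

Lemma qnorm2_inv (q : quat) : q <> quat0 -> qnorm2 (qinv q) = (/ qnorm2 q)%R.
Proof.
  intros Hq. apply qnorm2_pos in Hq.
  destruct q as [a b c d]. unfold qinv, qnorm2 in *; simpl in *. field. lra.
Qed.

Lemma Cinv_neq0 (z : C) : z <> 0 -> / z <> 0.
Proof.
  intros Hz E. apply (RtoC_neq 1 0 R1_neq_R0). rewrite <- (Cinv_r z Hz), E. ring.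
Qed.

Ltac cfield := field; repeat split; auto; cbv beta; apply RtoC_neq; lra.

Lemma cc2_sqr (m : Z) : (-2 <= m <= 2)%Z ->
  cc 2 m * cc 2 m = match m with 0%Z => / 6 | 1%Z | (-1)%Z => / 4 | _ => 1 end.
Proof.
  intros Hm. rewrite cc_sqr. destruct factZ_values as (F0 & F1 & F2 & F3 & F4).
  spin2 m; simpl Z.of_nat; simpl Z.add; simpl Z.sub; simpl Z.mul;
   rewrite ?F0, ?F1, ?F2, ?F3, ?F4; try rewrite <- RtoC_inv by lra; apply f_equal; field.
Qed.

Lemma RtoC_conj (r : R) : Cconj (RtoC r) = RtoC r.
Proof. unfold Cconj, RtoC; simpl; f_equal; ring. Qed.

Lemma Cconj_0 : Cconj 0 = 0.
Proof. apply RtoC_conj. Qed.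

Lemma cc_conj (j : nat) (m : Z) : Cconj (cc j m) = cc j m.
Proof. apply RtoC_conj. Qed.

Ltac push_conj := repeat first
  [rewrite Cplus_conj | rewrite Cminus_conj | rewrite Copp_conj | rewrite Cmult_conj
  |rewrite Cpow_conj | rewrite Cconj_conj | rewrite RtoC_conj].

(** Unitarity, D(q^-1) equals the adjoint of D(q), for the entries stripped of c and N. The power
    N^4 appears because q^-1 is the conjugate quaternion divided by N and [rot2] is homogeneous of
    degree 4. *)
Lemma rot2_inv (q : quat) (m m' : Z) : q <> quat0 -> (-2 <= m <= 2)%Z -> (-2 <= m' <= 2)%Z ->
  cc 2 m' ^ 2 * Cconj (rot2 (qv (qinv q)) (qw (qinv q)) (Cconj (qv (qinv q))) (Cconj (qw (qinv q)))
      m' m)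
  = cc 2 m ^ 2 * rot2 (qv q) (qw q) (Cconj (qv q)) (Cconj (qw q)) m m' / RtoC (qnorm2 q) ^ 4.
Proof.
  intros Hq Hm Hm'.
  assert (N : RtoC (qnorm2 q) <> 0) by (apply RtoC_neq, Rgt_not_eq, qnorm2_pos, Hq).
  simpl (_ ^ 2). rewrite !Cmult_1_r, !cc2_sqr by easy.
  rewrite qv_inv, qw_inv, !Cdiv_conj, !Copp_conj, Cconj_conj, RtoC_conj by easy.
  set (n := RtoC (qnorm2 q)) in *. set (v := qv q). set (w := qw q).
  assert (Hn : Cconj n = n) by apply RtoC_conj.
  pose proof (Cinv_conj n N) as Hi. rewrite Hn in Hi.
  spin2 m; spin2 m'; expand; unfold Cdiv; push_conj; rewrite ?Hi, ?Hn; field; repeat split; auto;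
      apply RtoC_neq; lra.
Qed.

(** By unitarity the action of D(q^-1) on h becomes, after conjugation, the row action of D(q) on
    conj h_m = L_{x_0 x_m}. This is the transformation of H that [cov_rotate] requires. *)
Lemma hring_rotate (L : X5 -> R) (y : X5) (q : quat) (m' : Z) : q <> quat0 -> (-2 <= m' <= 2)%Z ->
  Cconj (hring L y q m') =
  sum_sym 2 (fun m => Cconj (h L y m) * rot2 (qv q) (qw q) (Cconj (qv q)) (Cconj (qw q)) m m')
   / RtoC (qnorm2 q) ^ 2.
Proof.
  intros Hq Hm.
  assert (N : RtoC (qnorm2 q) <> 0) by (apply RtoC_neq, Rgt_not_eq, qnorm2_pos, Hq).
  assert (Hi : qinv q <> quat0).
  { intros E. pose proof (qnorm2_inv q Hq) as F. rewrite E in F. unfold qnorm2 at 1 in F; simpl in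
      F.
    pose proof (Rinv_0_lt_compat _ (qnorm2_pos q Hq)). lra. }
  assert (T : forall m, (-2 <= m <= 2)%Z ->
     Cconj (cc 2 m' * (wigner 2 m' m (qinv q) * (/ cc 2 m * h L y m))) =
      Cconj (h L y m) * rot2 (qv q) (qw q) (Cconj (qv q)) (Cconj (qw q)) m m' / RtoC (qnorm2 q) ^
          2).
  { intros m Hm1. rewrite wigner2, qnorm2_inv by easy.
    rewrite RtoC_inv by (apply Rgt_not_eq, qnorm2_pos, Hq).
    pose proof (rot2_inv q m m' Hq Hm1 Hm) as E.
    set (A := rot2 (qv (qinv q)) _ _ _ _ _) in *.
    clearbody A.
    set (n := RtoC (qnorm2 q)) in *.
    assert (Hn : Cconj n = n) by apply RtoC_conj.
    unfold Cdiv. pose proof (cc_neq0 2 m) as Z0.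
    rewrite !Cmult_conj, !Cinv_conj, !Cpow_conj, !Cinv_conj, Hn, !cc_conj; auto;
      [|now apply Cpow_nz, Cinv_neq0].
    transitivity ((cc 2 m' ^ 2 * Cconj A) * Cconj (h L y m) * n ^ 2 / (cc 2 m)^2); [cfield|].
    rewrite E. cfield. }
  unfold hring. rewrite !sum_sym2, !Cmult_plus_distr_l.
  rewrite !Cplus_conj, !T by lia. rewrite Cmult_0_r, Cconj_0. cfield.
Qed.

(** * The principal-axes frame *)

Definition real_spin (X : Z -> C) : Prop :=
  X (-2)%Z = Cconj (X 2%Z) /\ X (-1)%Z = - Cconj (X 1%Z) /\ X 0%Z = Cconj (X 0%Z).

Lemma Cmod2_mult (z : C) : Cmod2 z = z * Cconj z.
Proof. apply Cmod2_conj. Qed.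

Lemma real_spin_conj (X : Z -> C) : real_spin X ->
  Cconj (X 2%Z) = X (-2)%Z /\ Cconj (X 1%Z) = - X (-1)%Z /\ Cconj (X 0%Z) = X 0%Z /\
  Cconj (X (-1)%Z) = - X 1%Z /\ Cconj (X (-2)%Z) = X 2%Z.
Proof.
  intros (H2 & H1 & H0). rewrite H2, H1, Copp_conj, !Cconj_conj. rewrite <- H0. repeat split; auto;
      ring.
Qed.

(** Under the reality condition this entry of [theta_mx], like those in [Hring_eq], is a 2 x 2 minor
    of the 3 x 3 Hankel matrix whose determinant is [r3h]; the term r_2/6 subtracted in H_0' serves
    to produce the minor. *)
Lemma H0'_eq (k : Z -> C) : real_spin k -> H0' k = k 1%Z * k (-1)%Z - k 0%Z ^ 2.
Proof.
  intros Hk. destruct (real_spin_conj k Hk) as (A2 & A1 & A0 & B1 & B2).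
  unfold H0', r2h, Hring. rewrite !Cmod2_mult, A2, A1, B1, B2. cfield.
Qed.

Lemma Hring_eq (k : Z -> C) : real_spin k ->
  Hring k 2 = k 2%Z * k 0%Z - k 1%Z ^ 2 /\
  2 * Hring k 1 = k 2%Z * k (-1)%Z - k 1%Z * k 0%Z /\
  2 * Hring k (-1) = k (-2)%Z * k 1%Z - k (-1)%Z * k 0%Z /\
  Hring k (-2) = k (-2)%Z * k 0%Z - k (-1)%Z ^ 2.
Proof.
  intros Hk. destruct (real_spin_conj k Hk) as (A2 & A1 & A0 & B1 & B2).
  unfold Hring, Hplus2, Hplus1.
  rewrite !Cminus_conj, !Cmult_conj, !Cpow_conj, !Cinv_conj, RtoC_conj, A2, A1, A0, B1 by (apply
      RtoC_neq; lra).
  repeat split; cfield.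
Qed.

Lemma r3h_eq (k : Z -> C) : r3h k =
  k 2%Z * (k 0%Z * k (-2)%Z - k (-1)%Z ^ 2) - k 1%Z * (k 1%Z * k (-2)%Z - k (-1)%Z * k 0%Z)
  + k 0%Z * (k 1%Z * k (-1)%Z - k 0%Z ^ 2).
Proof. unfold r3h. cbn. ring. Qed.

Lemma theta_mx_mulmv (k : Z -> C) (t : Z -> C) : let u := fun i => nth i [t 2%Z; t 1%Z; t (-1)%Z; t
    (-2)%Z] 0 in
  mulmv 4 (theta_mx k) u 0 = H0' k * t 2%Z /\
  mulmv 4 (theta_mx k) u 1 = 2 * Hring k (-1) * t 2%Z + H0' k * t 1%Z + Hring k 2 * t (-1)%Z /\
  mulmv 4 (theta_mx k) u 2 = Hring k (-2) * t 1%Z + H0' k * t (-1)%Z + 2 * Hring k 1 * t (-2)%Z /\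
  mulmv 4 (theta_mx k) u 3 = H0' k * t (-2)%Z.
Proof.
  intros u; unfold u, mulmv, sum_lt, theta_mx, mx.
  cbn -[H0' Hring]. repeat split; ring.
Qed.

(** The two factors are the divisors needed to solve chi = M theta: the outer rows are diagonal, and
    the inner 2 x 2 block has determinant H_0'^2 - H_{+2} H_{-2}. *)
Lemma theta_mx_det (k : Z -> C) :
  det 4 (theta_mx k) = H0' k ^ 2 * (H0' k ^ 2 - Hring k 2 * Hring k (-2)).
Proof. unfold theta_mx, mx. cbn -[H0' Hring]. ring. Qed.

Definition theta_eqs (k : Z -> C) (X t : Z -> C) : Prop :=
  X 2%Z = H0' k * t 2%Z /\
  X 1%Z = 2 * Hring k (-1) * t 2%Z + H0' k * t 1%Z + Hring k 2 * t (-1)%Z /\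
  X (-1)%Z = Hring k (-2) * t 1%Z + H0' k * t (-1)%Z + 2 * Hring k 1 * t (-2)%Z /\
  X (-2)%Z = H0' k * t (-2)%Z.

(** Since k and X are real, conjugation followed by m -> -m with sign (-1)^m maps the linear system
    to itself. Its solution is unique, hence real as well. *)
Lemma theta_eqs_real (k X t : Z -> C) : real_spin k -> real_spin X -> det 4 (theta_mx k) <> 0 ->
  theta_eqs k X t -> t (-2)%Z = Cconj (t 2%Z) /\ t (-1)%Z = - Cconj (t 1%Z).
Proof.
  intros Hk HX Hd (E2 & E1 & F1 & F2).
  rewrite theta_mx_det in Hd.
  assert (N0 : H0' k <> 0) by (intros E; apply Hd; rewrite E; ring).
  assert (N1 : H0' k ^ 2 - Hring k 2 * Hring k (-2) <> 0) by (intros E; apply Hd; rewrite E; ring).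
  destruct (real_spin_conj k Hk) as (A2 & A1 & A0 & B1 & B2).
  destruct (real_spin_conj X HX) as (X2 & X1 & X0 & Y1 & Y2).
  destruct (Hring_eq k Hk) as (G2 & G1 & K1 & K2).
  assert (C0 : Cconj (H0' k) = H0' k).
  { rewrite H0'_eq by easy. push_conj. rewrite A1, B1, A0. ring. }
  assert (C2 : Cconj (Hring k 2) = Hring k (-2)).
  { rewrite G2, K2. push_conj. rewrite A1, A2, A0. ring. }
  assert (C1 : Cconj (2 * Hring k (-1)) = - (2 * Hring k 1)).
  { rewrite G1, K1. push_conj. rewrite A1, B2, B1, A0. ring. }
  apply (f_equal Cconj) in E2, E1.
  rewrite X2, Cmult_conj, C0, F2 in E2.
  rewrite X1, !Cplus_conj, (Cmult_conj (2 * _)), (Cmult_conj (H0' k)), (Cmult_conj (Hring k 2)),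
      C0, C1, C2, F1 in E1.
  assert (T2 : t (-2)%Z = Cconj (t 2%Z)).
  { transitivity (H0' k * t (-2)%Z / H0' k); [cfield|]. rewrite E2. cfield. }
  split; [easy|]. rewrite T2 in *.
  assert (D1 : Hring k (-2) * (t 1%Z + Cconj (t (-1)%Z)) + H0' k * (t (-1)%Z + Cconj (t 1%Z)) = 0).
  { match type of E1 with ?a = ?b => transitivity (b - a) end; [ring|]. rewrite E1. ring. }
  pose proof (f_equal Cconj D1) as D2.
  rewrite Cplus_conj, !Cmult_conj, !Cplus_conj, !Cconj_conj, C0, <- C2, Cconj_conj, RtoC_conj in D2.
  rewrite <- C2 in N1, D1.
  set (a := t 1%Z + _) in *. set (b := t (-1)%Z + _) in *.
  (* [D1] and its conjugate [D2] are a homogeneous system for the two reality defects a and b, with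
     nonzero determinant [N1]; eliminating a leaves b. *)
  assert (Eb : (H0' k ^ 2 - Hring k 2 * Cconj (Hring k 2)) * b = 0).
  { transitivity (H0' k * (Cconj (Hring k 2) * a + H0' k * b) - Cconj (Hring k 2) * (Hring k 2 * b
      + H0' k * a)); [ring|].
    replace (Cconj (t (-1)%Z) + t 1%Z) with a in D2 by (unfold a; ring).
    replace (Cconj (t 1%Z) + t (-1)%Z) with b in D2 by (unfold b; ring).
    rewrite D1. replace (Hring k 2 * b + H0' k * a) with (RtoC 0) by (rewrite <- D2; unfold a, b;
        ring). ring. }
  destruct (Ceq_dec b 0) as [Z|Z].
  - unfold b in Z. transitivity (t (-1)%Z + Cconj (t 1%Z) - Cconj (t 1%Z)); [ring|]. rewrite Z.
      ring.
  - exfalso. revert Eb. apply Cmult_neq_0; auto.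
Qed.

(** The constraint expresses X_0 and Y_0 through the other four components, which is where k_0 is
    inverted; substituting X = M t and Y = M s then leaves a rational identity in k, t, s. The
    entries of H are (-1)^m k_{-m} by reality. The brackets become the wedges of theta with its
    conjugates once t and s are known to be real. *)
Lemma cov_theta (k H X Y t s : Z -> C) (m : Z) :
  real_spin k -> k 0%Z <> 0 ->
  (forall m, (-2 <= m <= 2)%Z -> H m = Cconj (k m)) ->
  contract H 0 X = 0 -> contract H 0 Y = 0 ->
  theta_eqs k X t -> theta_eqs k Y s ->
  cov H X Y m = 4 * lambda k *
    match m with
    | 1%Z => - (t 2%Z * s (-1)%Z - s 2%Z * t (-1)%Z)
    | 0%Z => - (t 1%Z * s (-1)%Z - s 1%Z * t (-1)%Z) - (t 2%Z * s (-2)%Z - s 2%Z * t (-2)%Z)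
    | (-1)%Z => t (-2)%Z * s 1%Z - s (-2)%Z * t 1%Z
    | _ => 0
    end.
Proof.
  intros Hk Hk0 HH HX HY (X2 & X1 & X1' & X2') (Y2 & Y1 & Y1' & Y2').
  destruct (real_spin_conj k Hk) as (A2 & A1 & A0 & B1 & B2).
  destruct (Hring_eq k Hk) as (G2 & G1 & K1 & K2).
  pose proof (H0'_eq k Hk) as G0. rewrite G0, ?G1, ?G2, ?K1, ?K2 in *.
  unfold lambda. rewrite r3h_eq, G0.
  assert (E2 : H 2%Z = k (-2)%Z) by (rewrite HH; [easy|lia]).
  assert (E1 : H 1%Z = - k (-1)%Z) by (rewrite HH; [easy|lia]).
  assert (E0 : H 0%Z = k 0%Z) by (rewrite HH; [easy|lia]).
  assert (F1 : H (-1)%Z = - k 1%Z) by (rewrite HH; [easy|lia]).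
  assert (F2 : H (-2)%Z = k 2%Z) by (rewrite HH; [easy|lia]).
  revert HX HY. expand. rewrite E2, E1, E0, F1, F2. intros HX HY.
  assert (X0 : X 0%Z = - (k 2%Z * X (-2)%Z - k 1%Z * X (-1)%Z - k (-1)%Z * X 1%Z + k (-2)%Z * X
      2%Z) / k 0%Z).
  { match type of HX with ?a = _ => transitivity (a / k 0%Z -  (k 2%Z * X (-2)%Z - k 1%Z * X (-1)%Z
      - k (-1)%Z * X 1%Z + k (-2)%Z * X 2%Z) / k 0%Z) end; [cfield|].
    rewrite HX. cfield. }
  assert (Y0 : Y 0%Z = - (k 2%Z * Y (-2)%Z - k 1%Z * Y (-1)%Z - k (-1)%Z * Y 1%Z + k (-2)%Z * Y
      2%Z) / k 0%Z).
  { match type of HY with ?a = _ => transitivity (a / k 0%Z -  (k 2%Z * Y (-2)%Z - k 1%Z * Y (-1)%Z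
      - k (-1)%Z * Y 1%Z + k (-2)%Z * Y 2%Z) / k 0%Z) end; [cfield|].
    rewrite HY. cfield. }
  assert (Hm : m = 1%Z \/ m = 0%Z \/ m = (-1)%Z \/ (m <> 1 /\ m <> 0 /\ m <> -1)%Z) by lia.
  destruct Hm as [->|[->|[->|Hm]]]; expand; rewrite ?E2, ?E1, ?E0, ?F1, ?F2, ?X0, ?Y0, ?X2, ?X1,
      ?X1', ?X2', ?Y2, ?Y1, ?Y1', ?Y2'.
  1-3: cfield.
  destruct m as [|[|[]|]|[| |]]; try lia; ring.
Qed.

(** * Derivatives along lines *)

(** The value is carried along with the derivative, so that the product and power rules can be
    applied by unification alone. *)
Definition jet (f : R -> C) (a l : C) : Prop :=
  f 0%R = a /\ @is_derive R_AbsRing C_R_NormedModule f 0%R l.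

Lemma is_derive_C (f : R -> C) (t : R) (l : C) :
  @is_derive R_AbsRing C_R_NormedModule f t l <->
  is_derive (fun s => Re (f s)) t (Re l) /\ is_derive (fun s => Im (f s)) t (Im l).
Proof.
  split.
  - intros H. split.
    + apply (filterdiff_comp' (V := C_R_NormedModule) f fst t (fun y : R => scal y l) fst); [exact
        H|].
      apply filterdiff_linear, is_linear_fst.
    + apply (filterdiff_comp' (V := C_R_NormedModule) f snd t (fun y : R => scal y l) snd); [exact
        H|].
      apply filterdiff_linear, is_linear_snd.
  - intros [H1 H2].
    apply (filterdiff_ext (fun s : R => (Re (f s), Im (f s)))).
    { intros s. now destruct (f s). }
    apply (filterdiff_comp'_2 (U := R_NormedModule) (V := R_NormedModule) (W := C_R_NormedModule)
      (fun s => Re (f s)) (fun s => Im (f s)) (fun a b => (a, b)) t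
      (fun y : R => scal y (Re l)) (fun y : R => scal y (Im l)) (fun a b => (a, b)));
      [exact H1|exact H2|].
    apply (filterdiff_ext (fun u : R * R => u)); [now intros []|].
    apply (filterdiff_ext_lin _ (fun u : R * R => u)); [|now intros []].
    apply filterdiff_id.
Qed.

Lemma dir_jet {X : NormedModule R_AbsRing} (f : X -> C) (p v : X) (a l : C) :
  jet (fun t : R => f (plus p (scal t v))) a l -> dir f p v = l.
Proof.
  intros [_ H]. apply is_derive_C in H as [H1 H2].
  apply injective_projections; [exact (is_derive_unique _ _ _ H1)|exact (is_derive_unique _ _ _
      H2)].
Qed.

Lemma jet_ext (f g : R -> C) (a l : C) : (forall t, f t = g t) -> jet f a l -> jet g a l.
Proof. intros E [H1 H2]. split; [now rewrite <- E|]. now apply (is_derive_ext f). Qed.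

Lemma jet_const (c : C) : jet (fun _ => c) c 0.
Proof. split; auto. apply (is_derive_const (V := C_R_NormedModule) c). Qed.

Lemma jet_real (f : R -> R) (l : R) : is_derive f 0%R l -> jet (fun t => RtoC (f t)) (RtoC (f 0%R))
    (RtoC l).
Proof.
  intros H. split; auto. apply is_derive_C. split; simpl; auto.
  apply (is_derive_const (V := R_NormedModule) 0%R).
Qed.

Lemma jet_complex (f g : R -> R) (l m : R) : is_derive f 0%R l -> is_derive g 0%R m ->
  jet (fun t => (f t, g t)) (f 0%R, g 0%R) (l, m).
Proof. intros H1 H2. split; auto. apply is_derive_C. now split. Qed.

Lemma jet_plus (f g : R -> C) (a l b m : C) : jet f a l -> jet g b m ->
  jet (fun t => f t + g t) (a + b) (l + m).
Proof.
  intros [<- Hf] [<- Hg]. split; auto. now apply (is_derive_plus (V := C_R_NormedModule)).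
Qed.

Lemma jet_opp (f : R -> C) (a l : C) : jet f a l -> jet (fun t => - f t) (- a) (- l).
Proof.
  intros [<- Hf]. split; auto. now apply (is_derive_opp (V := C_R_NormedModule)).
Qed.

Lemma jet_minus (f g : R -> C) (a l b m : C) : jet f a l -> jet g b m ->
  jet (fun t => f t - g t) (a - b) (l - m).
Proof. intros Hf Hg. apply jet_plus; auto. now apply jet_opp. Qed.

Lemma is_derive_Cconj (f : R -> C) (t : R) (l : C) :
  @is_derive R_AbsRing C_R_NormedModule f t l ->
  @is_derive R_AbsRing C_R_NormedModule (fun t => Cconj (f t)) t (Cconj l).
Proof.
  intros Hf. apply is_derive_C in Hf as [H1 H2]. apply is_derive_C. split; simpl; auto.
  now apply (is_derive_opp (V := R_NormedModule)).
Qed.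

Lemma jet_conj (f : R -> C) (a l : C) : jet f a l -> jet (fun t => Cconj (f t)) (Cconj a) (Cconj l).
Proof. intros [<- Hf]. split; auto. now apply is_derive_Cconj. Qed.

Lemma is_derive_Cmult (f g : R -> C) (t : R) (l m : C) :
  @is_derive R_AbsRing C_R_NormedModule f t l -> @is_derive R_AbsRing C_R_NormedModule g t m ->
  @is_derive R_AbsRing C_R_NormedModule (fun t => f t * g t) t (l * g t + f t * m).
Proof.
  intros Hf Hg.
  apply is_derive_C in Hf as [F1 F2]. apply is_derive_C in Hg as [G1 G2].
  pose proof (fun u v du dv A B => is_derive_mult (K := R_AbsRing) u v t du dv A B Rmult_comm) as M.
  apply is_derive_C. split.
  - pose proof (is_derive_minus (V := R_NormedModule) _ _ _ _ _ (M _ _ _ _ F1 G1) (M _ _ _ _ F2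
      G2)) as D.
    match type of D with is_derive _ _ ?d => replace (Re (l * g t + f t * m)) with d; [exact D|]
        end.
    unfold minus, plus, opp, mult; simpl. unfold Re, Im; ring.
  - pose proof (is_derive_plus (V := R_NormedModule) _ _ _ _ _ (M _ _ _ _ F1 G2) (M _ _ _ _ F2 G1))
      as D.
    match type of D with is_derive _ _ ?d => replace (Im (l * g t + f t * m)) with d; [exact D|]
        end.
    unfold plus, mult; simpl. unfold Re, Im; ring.
Qed.

Lemma jet_mult (f g : R -> C) (a l b m : C) : jet f a l -> jet g b m ->
  jet (fun t => f t * g t) (a * b) (l * b + a * m).
Proof. intros [<- Hf] [<- Hg]. split; auto. now apply is_derive_Cmult. Qed.

Lemma jet_pow (f : R -> C) (a l : C) (n : nat) : jet f a l ->
  jet (fun t => f t ^ S n) (a ^ S n) (RtoC (INR (S n)) * a ^ n * l).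
Proof.
  intros H. induction n as [|n IH].
  - simpl. replace (1 * 1 * l) with (l * 1 + a * 0) by ring. apply jet_mult; auto. apply jet_const.
  - replace (RtoC (INR (S (S n))) * a ^ S n * l) with (l * a ^ S n + a * (RtoC (INR (S n)) * a ^ n
      * l)).
    + apply (jet_mult f (fun t => f t ^ S n)); auto.
    + rewrite (S_INR (S n)), RtoC_plus. simpl Cpow. ring.
Qed.

Lemma jet_unique (f : R -> C) (a b l m : C) : jet f a l -> jet f b m -> l = m.
Proof.
  intros [_ H1] [_ H2]. apply is_derive_C in H1 as [A1 A2], H2 as [B1 B2].
  apply is_derive_unique in A1, A2, B1, B2.
  apply injective_projections; [change (Re l = Re m)|change (Im l = Im m)]; congruence.
Qed.

Lemma jet_eq (f : R -> C) (a b l m : C) : jet f a l -> a = b -> l = m -> jet f b m.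
Proof. now intros H <- <-. Qed.

Ltac jet :=
  lazymatch goal with
  | |- jet (fun _ => ?c) _ _ => apply (jet_const c)
  | |- jet (fun t => _ + _) _ _ => apply jet_plus; jet
  | |- jet (fun t => _ - _) _ _ => apply jet_minus; jet
  | |- jet (fun t => - _) _ _ => apply jet_opp; jet
  | |- jet (fun t => _ * _) _ _ => apply jet_mult; jet
  | |- jet (fun t => _ ^ _) _ _ => apply jet_pow; jet
  | |- jet (fun t => Cconj _) _ _ => apply jet_conj; jet
  | |- _ => eassumption
  end.

(** * The differential of the quaternionic parametrization *)

(** Applied to s = q^-1 dq, this and [qw_qmul] give dv and dw in terms of v, w and the components of
    sigma. *)
Lemma qv_qmul (q s : quat) : qv (qmul q s) =
  qv q * (RtoC (q0 s) - Ci * RtoC (q3 s)) + Cconj (qw q) * (RtoC (q2 s) - Ci * RtoC (q1 s)).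
Proof.
  unfold qv, qw, qmul, Ci, RtoC, Cconj, Cmult, Cminus, Cplus, Copp; simpl; f_equal; ring.
Qed.

Lemma qw_qmul (q s : quat) : qw (qmul q s) =
  qw q * (RtoC (q0 s) - Ci * RtoC (q3 s)) + Cconj (qv q) * (Ci * RtoC (q1 s) - RtoC (q2 s)).
Proof.
  unfold qv, qw, qmul, Ci, RtoC, Cconj, Cmult, Cminus, Cplus, Copp; simpl; f_equal; ring.
Qed.

Lemma qmul_qinv (q d : quat) : q <> quat0 -> qmul q (qmul (qinv q) d) = d.
Proof.
  intros Hq. apply qnorm2_pos in Hq. destruct q as [a b c e], d as [d0 d1 d2 d3].
  unfold qmul, qinv, qnorm2 in *; simpl in *. f_equal; field; lra.
Qed.

(* dx = D(q) [dxring]: the differential of [xring] plus the infinitesimal rotation q^-1 dq applied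
   to it. Off row 0 these are the forms chi. *)
Definition dxring (e2 r de2 dr : R) (s : quat) (m : Z) : C :=
  match m with
  | 2%Z => / 4 * RtoC dr - Ci * RtoC r * RtoC (q3 s)
  | 1%Z => (3 * Ci * RtoC e2 - Ci * RtoC r) * RtoC (q1 s) + (3 * RtoC e2 + RtoC r) * RtoC (q2 s)
  | 0%Z => - (3 / 2 * RtoC de2)
  | (-1)%Z => (3 * Ci * RtoC e2 - Ci * RtoC r) * RtoC (q1 s) - (3 * RtoC e2 + RtoC r) * RtoC (q2 s)
  | (-2)%Z => / 4 * RtoC dr + Ci * RtoC r * RtoC (q3 s)
  | _ => 0
  end.

(** The component sigma_0 only rescales q and contributes 4 sigma_0 times the value, because [rot2]
    has degree 4. The components sigma_1, sigma_2, sigma_3 act as an infinitesimal rotation on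
    [xring], in the frame moving with q. *)
Lemma rotate_xring_jet (v w e1 e3 : R -> C) (v0 w0 : C) (e1' e2' e3' d1 d2 d3 : R) (s : quat) (m :
    Z) :
  (-2 <= m <= 2)%Z -> (e1' + e2' + e3' = 0)%R -> (d1 + d2 + d3 = 0)%R ->
  jet v v0 (v0 * (RtoC (q0 s) - Ci * RtoC (q3 s)) + Cconj w0 * (RtoC (q2 s) - Ci * RtoC (q1 s))) ->
  jet w w0 (w0 * (RtoC (q0 s) - Ci * RtoC (q3 s)) + Cconj v0 * (Ci * RtoC (q1 s) - RtoC (q2 s))) ->
  jet e1 (RtoC e1') (RtoC d1) -> jet e3 (RtoC e3') (RtoC d3) ->
  let P0 := rotate2 v0 w0 (Cconj v0) (Cconj w0) (xring e1' e2' e3') m in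
  jet (fun t => rot2 (v t) (w t) (Cconj (v t)) (Cconj (w t)) m (-2) * (/ 4 * (e1 t - e3 t)) +
                rot2 (v t) (w t) (Cconj (v t)) (Cconj (w t)) m 0 * (/ 4 * (6 * (e1 t + e3 t))) +
                rot2 (v t) (w t) (Cconj (v t)) (Cconj (w t)) m 2 * (/ 4 * (e1 t - e3 t)))
    P0 (4 * RtoC (q0 s) * P0 +
        rotate2 v0 w0 (Cconj v0) (Cconj w0) (dxring e2' (e1' - e3') d2 (d1 - d3) s) m).
Proof.
  intros Hm He Hd Hv Hw H1 H3 P0; unfold P0; clear P0.
  pose proof Ci_conj as Hi.
  (* [xring] contains only e_1 and e_3; the vanishing sum of the roots turns the differential of 3/2
     (e_1 + e_3) into the entry -3/2 d e_2 of [dxring]. *)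
  replace e2' with (- e1' - e3')%R by lra. replace d2 with (- d1 - d3)%R by lra.
  spin2 m; expand; unfold xring, dxring; (eapply jet_eq; [jet|..]).
  all: push_conj; rewrite ?Hi, ?RtoC_minus, ?RtoC_opp; simpl INR; rewrite ?RtoC_plus.
  all: field [Ci_sqr]; repeat split; cbv beta; apply RtoC_neq; lra.
Qed.

Lemma line_continuous {X : NormedModule R_AbsRing} (p v : X) (t : R) :
  continuous (fun t : R => plus p (scal t v)) t.
Proof.
  apply (continuous_plus (V := X)); [apply continuous_const|].
  apply (continuous_scal_l (V := X)), continuous_id.
Qed.

Lemma line_0 {X : NormedModule R_AbsRing} (p v : X) : plus p (scal 0%R v) = p.
Proof. now rewrite (scal_zero_l (V := X)), plus_zero_r. Qed.

Lemma line_locally {X : NormedModule R_AbsRing} (p v : X) (Q : X -> Prop) :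
  locally p Q -> locally 0%R (fun t : R => Q (plus p (scal t v))).
Proof.
  intros H. apply (line_continuous p v 0%R). now rewrite line_0.
Qed.

Lemma line_filterdiff {X : NormedModule R_AbsRing} (p v : X) (t : R) :
  filterdiff (fun t : R => plus p (scal t v)) (locally t) (fun s : R => scal s v).
Proof.
  pose proof (is_derive_plus (V := X) _ _ t _ _ (is_derive_const (V := X) p t)
    (is_derive_scal_l (V := X) (fun t : R => t) t one v (is_derive_id (K := R_AbsRing) t))) as D.
  apply (filterdiff_ext_lin _ _ _ D). intros s. now rewrite plus_zero_l, (scal_one (V := X)).
Qed.

Lemma filterdiff_line {X Y : NormedModule R_AbsRing} (f : X -> Y) (p v : X) (lf : X -> Y) :
  filterdiff f (locally p) lf ->
  is_derive (fun t : R => f (plus p (scal t v))) 0%R (lf v).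
Proof.
  intros H.
  assert (H' : filterdiff f (locally (plus p (scal 0%R v))) lf) by now rewrite line_0.
  pose proof (filterdiff_comp' _ f 0%R _ lf (line_filterdiff p v 0%R) H') as D.
  apply (filterdiff_ext_lin _ _ _ D). intros s.
  destruct H as [Hl _]. now rewrite (linear_scal _ Hl).
Qed.

Lemma jet_filterdiff {X : NormedModule R_AbsRing} (f : X -> C) (p v : X) (lf : X -> C) :
  @filterdiff _ X C_R_NormedModule f (locally p) lf ->
  jet (fun t : R => f (plus p (scal t v))) (f p) (lf v).
Proof.
  intros H. split; [now rewrite line_0|]. now apply (filterdiff_line (Y := C_R_NormedModule)).
Qed.

Lemma dir_filterdiff {X : NormedModule R_AbsRing} (f : X -> C) (p v : X) (lf : X -> C) :
  @filterdiff _ X C_R_NormedModule f (locally p) lf -> dir f p v = lf v.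
Proof. intros H. exact (dir_jet _ _ _ _ _ (jet_filterdiff _ _ v _ H)). Qed.

Lemma dirR_differentiable {X : NormedModule R_AbsRing} (f : X -> R) (p v : X) :
  @ex_filterdiff _ X R_NormedModule f (locally p) ->
  is_derive (fun t : R => f (plus p (scal t v))) 0%R (dirR f p v).
Proof.
  intros [lf H]. pose proof (filterdiff_line (Y := R_NormedModule) f p v lf H) as D.
  unfold dirR. now rewrite (is_derive_unique _ _ _ D).
Qed.

Lemma jet_ext_loc (f g : R -> C) (a l : C) :
  locally 0%R (fun t => f t = g t) -> jet f a l -> jet g a l.
Proof.
  intros E [H1 H2]. split.
  - rewrite <- H1. symmetry. apply (locally_singleton _ _ E).
  - now apply (is_derive_ext_loc (V := C_R_NormedModule) f).
Qed.

Lemma dir_ext_loc {X : NormedModule R_AbsRing} (f g : X -> C) (p v : X) :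
  locally p (fun y => f y = g y) -> dir f p v = dir g p v.
Proof.
  intros H. apply (line_locally p v) in H. unfold dir, dirR. f_equal; apply Derive_ext_loc;
   revert H; apply filter_imp; intros t ->; auto.
Qed.

(** Divided differences: each of the quotients (f(e_i) - f(e_j)) / (e_i - e_j) vanishes, and the
    difference of two of them is (e_1 - e_3)(e_1 + e_2 + e_3). Distinctness of the roots permits the
    divisions. *)
Lemma cubic_roots_sum (y : X5) (e1 e2 e3 : R) : (e3 < e2 < e1)%R ->
  cubic y (RtoC e1) = 0 -> cubic y (RtoC e2) = 0 -> cubic y (RtoC e3) = 0 -> (e1 + e2 + e3 = 0)%R.
Proof.
  intros [H32 H21]. unfold cubic. set (a := r2x y). set (b := r3x y). intros E1 E2 E3.
  assert (N : forall u v : R, (u < v)%R -> RtoC v - RtoC u <> 0).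
  { intros u v H. rewrite <- RtoC_minus. apply RtoC_neq. lra. }
  assert (K12 : RtoC e1 ^ 2 + RtoC e1 * RtoC e2 + RtoC e2 ^ 2 = 4 * a).
  { pose proof (N e2 e1 H21).
    transitivity (4 * a + ((RtoC e1 ^ 3 - 4 * a * RtoC e1 - 16 * b) - (RtoC e2 ^ 3 - 4 * a * RtoC
        e2 - 16 * b)) / (RtoC e1 - RtoC e2)); [field; auto|].
    rewrite E1, E2. field; auto. }
  assert (K23 : RtoC e2 ^ 2 + RtoC e2 * RtoC e3 + RtoC e3 ^ 2 = 4 * a).
  { pose proof (N e3 e2 H32).
    transitivity (4 * a + ((RtoC e2 ^ 3 - 4 * a * RtoC e2 - 16 * b) - (RtoC e3 ^ 3 - 4 * a * RtoC
        e3 - 16 * b)) / (RtoC e2 - RtoC e3)); [field; auto|].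
    rewrite E2, E3. field; auto. }
  assert (S : RtoC (e1 + e2 + e3) = RtoC 0).
  { pose proof (N e3 e1 ltac:(lra)).
    transitivity (((RtoC e1 ^ 2 + RtoC e1 * RtoC e2 + RtoC e2 ^ 2) - (RtoC e2 ^ 2 + RtoC e2 * RtoC
        e3 + RtoC e3 ^ 2)) / (RtoC e1 - RtoC e3)).
    - rewrite !RtoC_plus. field; auto.
    - rewrite K12, K23. field; auto. }
  now injection S.
Qed.

Section Param.
Variables (V : C2 -> Prop) (x : C2 -> X5) (q : C2 -> quat) (e1 e2 e3 : C2 -> R).
Hypothesis open_V : open V.
Hypothesis x_param : quaternionic_param V x q e1 e2 e3.

Lemma roots_sum (p : C2) : V p -> (e1 p + e2 p + e3 p = 0)%R.
Proof.
  intros Hp. destruct (x_param p Hp) as (_ & _ & _ & Ho & Hc & _).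
  apply (cubic_roots_sum (x p)); auto; apply Hc; auto.
Qed.

Lemma param_rotate (p : C2) (m : Z) : V p -> (-2 <= m <= 2)%Z ->
  RtoC (qnorm2 (q p)) ^ 2 * xcoord (x p) m =
  rotate2 (qv (q p)) (qw (q p)) (Cconj (qv (q p))) (Cconj (qw (q p))) (xring (e1 p) (e2 p) (e3 p))
      m.
Proof.
  intros Hp Hm. destruct (x_param p Hp) as (Hq & _ & _ & _ & _ & Hx).
  specialize (Hx m Hm).
  assert (N : RtoC (qnorm2 (q p)) <> 0) by (apply RtoC_neq, Rgt_not_eq, qnorm2_pos, Hq).
  pose proof (cc_neq0 2) as Hcc.
  transitivity (RtoC (qnorm2 (q p)) ^ 2 * (cc 2 m * xcoord (x p) m) / cc 2 m); [cfield|].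
  rewrite Hx. unfold rotate2. rewrite !sum_sym2.
  rewrite !wigner2 by (easy || lia). field. repeat split; auto.
Qed.

Lemma param_tangent (p xi : C2) (m : Z) (l : C) : V p -> (-2 <= m <= 2)%Z ->
  jet (fun t : R => xcoord (x (plus p (scal t xi))) m) (xcoord (x p) m) l ->
  RtoC (qnorm2 (q p)) ^ 2 * l =
  rotate2 (qv (q p)) (qw (q p)) (Cconj (qv (q p))) (Cconj (qw (q p)))
   (dxring (e2 p) (rho e1 e3 p) (dirR e2 p xi) (dirR (rho e1 e3) p xi) (sigma q p xi)) m.
Proof.
  intros Hp Hm Hl.
  destruct (x_param p Hp) as (Hq & (D0 & D1 & D2 & D3) & (E1 & E2 & E3) & _).
  set (s := sigma q p xi).
  set (ln := fun t : R => plus p (scal t xi) : C2).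
  assert (ln0 : ln 0%R = p) by apply line_0.
  assert (Hs : qmul (q p) s = dquat q p xi) by now apply qmul_qinv.
  assert (Jv : jet (fun t => qv (q (ln t))) (qv (q p))
     (qv (q p) * (RtoC (q0 s) - Ci * RtoC (q3 s)) + Cconj (qw (q p)) * (RtoC (q2 s) - Ci * RtoC (q1
         s)))).
  { rewrite <- qv_qmul, Hs. rewrite <- ln0 at 1. unfold qv, dquat; simpl.
    apply (jet_complex (fun t => q3 (q (ln t))) (fun t => q0 (q (ln t))));
     apply (dirR_differentiable (fun p => _ (q p))); auto. }
  assert (Jw : jet (fun t => qw (q (ln t))) (qw (q p))
     (qw (q p) * (RtoC (q0 s) - Ci * RtoC (q3 s)) + Cconj (qv (q p)) * (Ci * RtoC (q1 s) - RtoC (q2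
         s)))).
  { rewrite <- qw_qmul, Hs. rewrite <- ln0 at 1. unfold qw, dquat; simpl.
    apply (jet_complex (fun t => q1 (q (ln t))) (fun t => q2 (q (ln t))));
     apply (dirR_differentiable (fun p => _ (q p))); auto. }
  assert (JR : forall f : C2 -> R, differentiableR f p ->
     jet (fun t => RtoC (f (ln t))) (RtoC (f p)) (RtoC (dirR f p xi))).
  { intros f Hf. rewrite <- ln0 at 1. apply (jet_real (fun t => f (ln t))).
    now apply dirR_differentiable. }
  assert (Vloc : locally 0%R (fun t => V (ln t))) by now apply line_locally, open_V.
  assert (Hd : (dirR e1 p xi + dirR e2 p xi + dirR e3 p xi = 0)%R).
  { pose proof (jet_plus _ _ _ _ _ _ (jet_plus _ _ _ _ _ _ (JR _ E1) (JR _ E2)) (JR _ E3)) as J.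
    apply (jet_ext_loc _ (fun _ => RtoC 0)) in J.
    - pose proof (jet_unique _ _ _ _ _ J (jet_const 0)) as E. rewrite <- !RtoC_plus in E.
      now injection E.
    - revert Vloc. apply filter_imp. intros t Ht. rewrite <- !RtoC_plus. f_equal. now apply
        roots_sum. }
  assert (Hr : dirR (rho e1 e3) p xi = (dirR e1 p xi - dirR e3 p xi)%R).
  { apply is_derive_unique.
    apply (is_derive_minus (V := R_NormedModule) (fun t => e1 (ln t)) (fun t => e3 (ln t)));
     now apply dirR_differentiable. }
  rewrite Hr.
  pose proof (rotate_xring_jet _ _ _ _ _ _ (e1 p) (e2 p) (e3 p) (dirR e1 p xi) (dirR e2 p xi) (dirR
      e3 p xi) s m
     Hm (roots_sum p Hp) Hd Jv Jw (JR _ E1) (JR _ E3)) as JP. cbv zeta in JP.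
  (* Only the scale part of q^-1 dq changes N = |q|^2, so dN = 2 sigma_0 N. The term which this adds
     to d(N^2 x) cancels the term 4 sigma_0 of [rotate_xring_jet], as it must for a q defined up to
     scale. *)
  assert (JN : jet (fun t => RtoC (qnorm2 (q (ln t)))) (RtoC (qnorm2 (q p))) (2 * RtoC (q0 s) *
      RtoC (qnorm2 (q p)))).
  { apply (jet_ext (fun t => qv (q (ln t)) * Cconj (qv (q (ln t))) + qw (q (ln t)) * Cconj (qw (q
      (ln t))))).
    - intros t. now rewrite qnorm2_mult.
    - eapply jet_eq; [jet|now rewrite qnorm2_mult|].
      rewrite qnorm2_mult. push_conj.
      pose proof Ci_conj as Hi.
      rewrite Hi. ring. }
  pose proof (jet_mult _ _ _ _ _ _ (jet_pow _ _ _ 1 JN) Hl) as JM. cbv beta in JM.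
  eapply jet_ext_loc in JM.
  - pose proof (jet_unique _ _ _ _ _ JM JP) as E.
    rewrite <- param_rotate in E by easy.
    match type of E with ?u = _ =>
      transitivity (u - 4 * RtoC (q0 s) * (RtoC (qnorm2 (q p)) ^ 2 * xcoord (x p) m)) end.
    + replace (INR 2) with 2%R by (simpl; ring). ring.
    + rewrite E. unfold rho. ring.
  - revert Vloc. apply filter_imp. intros t Ht.
    transitivity (RtoC (qnorm2 (q (ln t))) ^ 2 * xcoord (x (ln t)) m); [reflexivity|].
    rewrite (param_rotate _ _ Ht Hm). unfold rotate2. rewrite sum_sym2. unfold xring. ring.
Qed.

End Param.

(** * Hermitian forms *)

Definition times_i (xi : C2) : C2 := (Ci * fst xi, Ci * snd xi).

(** The form du /\ dz is complex bilinear, so inserting i xi for xi multiplies it by i. With a = A(i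
    xi) - i A(xi), and b likewise for B, this says A(eta) b = a B(eta) for every eta; as A /\ B is
    nonzero on the coordinate vectors, a = b = 0. *)
Lemma holomorphic_factors (c : C) (A B : covector) :
  (forall xi eta, wedge (dw 1) (dw 0) xi eta = c * wedge A B xi eta) ->
  (forall xi, A (times_i xi) = Ci * A xi) /\ (forall xi, B (times_i xi) = Ci * B xi).
Proof.
  intros HW.
  enough (K : forall xi, A (times_i xi) = Ci * A xi /\ B (times_i xi) = Ci * B xi) by (split;
      intros; apply K).
  set (e0 := unitw 0 1). set (e1 := unitw 1 1).
  assert (W01 : c * wedge A B e1 e0 = 1).
  { rewrite <- HW. unfold wedge, dw, e0, e1, unitw. simpl. ring. }
  assert (Nc : c <> 0).
  { intros E. apply (RtoC_neq 1 0 R1_neq_R0). rewrite <- W01, E. ring. }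
  assert (Nd : wedge A B e1 e0 <> 0).
  { intros E. apply (RtoC_neq 1 0 R1_neq_R0). rewrite <- W01, E. ring. }
  intros xi.
  set (a := A (times_i xi) - Ci * A xi). set (b := B (times_i xi) - Ci * B xi).
  assert (K : forall eta, A eta * b - a * B eta = 0).
  { intros eta. transitivity (/ c * (c * wedge A B eta (times_i xi) - Ci * (c * wedge A B eta xi))).
    - unfold a, b, wedge. cfield.
    - rewrite <- !HW. unfold wedge, dw, times_i; simpl. ring. }
  pose proof (K e0) as K0. pose proof (K e1) as K1.
  assert (Z : forall z, wedge A B e1 e0 * z = 0 -> z = 0).
  { intros z Hz. destruct (Ceq_dec z 0) as [E|E]; auto. exfalso. revert Hz. now apply Cmult_neq_0. }
  assert (Hb : b = 0).
  { apply Z. transitivity (B e0 * (A e1 * b - a * B e1) - B e1 * (A e0 * b - a * B e0)); [unfold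
      wedge; ring|].
    rewrite K0, K1. ring. }
  assert (Ha : a = 0).
  { apply Z. transitivity (A e0 * (A e1 * b - a * B e1) - A e1 * (A e0 * b - a * B e0)); [unfold
      wedge; ring|].
    rewrite K0, K1. ring. }
  split.
  - transitivity (a + Ci * A xi); [unfold a; ring|]. rewrite Ha. ring.
  - transitivity (b + Ci * B xi); [unfold b; ring|]. rewrite Hb. ring.
Qed.

Definition real_linear (f : covector) : Prop :=
  (forall xi eta : C2, f (plus xi eta) = f xi + f eta) /\
  (forall (r : R) (xi : C2), f (scal r xi) = RtoC r * f xi).

Lemma real_linear_basis (f : covector) (xi : C2) : real_linear f ->
  f xi = RtoC (Re (fst xi)) * f (unitw 0 1) + RtoC (Im (fst xi)) * f (unitw 0 Ci)
       + RtoC (Re (snd xi)) * f (unitw 1 1) + RtoC (Im (snd xi)) * f (unitw 1 Ci).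
Proof.
  intros [Ha Hs]. rewrite <- !Hs, <- !Ha. f_equal.
  destruct xi as [[a b] [c d]].
  repeat (apply injective_projections; simpl); unfold plus, scal; simpl; unfold mult; simpl; ring.
Qed.

(** The coefficient of dw^a in the one-form [N b]. For [N b] the differential of the derivative of
    kappa in conj w^b it is kappa_{a bbar}. *)
Definition wirtinger_hess (N : nat -> covector) (a b : nat) : C :=
  (N b (unitw a 1) - Ci * N b (unitw a Ci)) / 2.

(** The factor (N(xi) - i N(i xi)) / 2 is the (1,0) part of N. *)
Lemma wirtinger_hess_sum (N : nat -> covector) (xi eta : C2) :
  (forall b, real_linear (N b)) ->
  sum_lt 2 (fun a => sum_lt 2 (fun b => wirtinger_hess N a b * (dw a xi * bar (dw b) eta))) =
  sum_lt 2 (fun b => (N b xi - Ci * N b (times_i xi)) / 2 * bar (dw b) eta).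
Proof.
  intros HN.
  assert (E : forall b, wirtinger_hess N 0 b * fst xi + wirtinger_hess N 1 b * snd xi =
      (N b xi - Ci * N b (times_i xi)) / 2).
  { intros b. rewrite (real_linear_basis _ xi (HN b)), (real_linear_basis _ (times_i xi) (HN b)).
    destruct xi as [[x0 y0] [x1 y1]]. unfold wirtinger_hess. unfold times_i; cbn [fst snd].
    replace (Re (Ci * (x0, y0))) with (- y0)%R by (simpl; ring).
    replace (Im (Ci * (x0, y0))) with x0 by (simpl; ring).
    replace (Re (Ci * (x1, y1))) with (- y1)%R by (simpl; ring).
    replace (Im (Ci * (x1, y1))) with x1 by (simpl; ring).
    change (Re (x0, y0)) with x0. change (Im (x0, y0)) with y0.
    change (Re (x1, y1)) with x1. change (Im (x1, y1)) with y1.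
    replace (x0, y0) with (RtoC x0 + Ci * RtoC y0) by (unfold Ci, RtoC, Cplus, Cmult; simpl;
        f_equal; ring).
    replace (x1, y1) with (RtoC x1 + Ci * RtoC y1) by (unfold Ci, RtoC, Cplus, Cmult; simpl;
        f_equal; ring).
    rewrite !RtoC_opp.
    field [Ci_sqr]. cbv beta; apply RtoC_neq; lra. }
  unfold sum_lt; simpl. rewrite <- !E. unfold dw, bar; simpl. ring.
Qed.

(** The 2-form sum_b N_b /\ conj dw^b has a (1,1) part given by the Wirtinger coefficients and a
    (0,2) part. The hypotheses equate it with a form of type (1,1), so the (0,2) part vanishes;
    inserting i in one argument passes from the 2-form to the symmetric form. *)
Lemma hermitian_form (N : nat -> covector) (c : C) (A B : covector) :
  (forall b, real_linear (N b)) ->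
  (forall xi, A (times_i xi) = Ci * A xi) -> (forall xi, B (times_i xi) = Ci * B xi) ->
  (forall xi eta, sum_lt 2 (fun b => wedge (N b) (bar (dw b)) xi eta) =
     c * (wedge A (bar A) xi eta + wedge B (bar B) xi eta)) ->
  forall xi eta,
  sum_lt 2 (fun a => sum_lt 2 (fun b => wirtinger_hess N a b * symprod (dw a) (bar (dw b)) xi eta))
      =
    c * (abs2 A xi eta + abs2 B xi eta) /\
  sum_lt 2 (fun a => sum_lt 2 (fun b => wirtinger_hess N a b * wedge (dw a) (bar (dw b)) xi eta)) =
    c * (wedge A (bar A) xi eta + wedge B (bar B) xi eta).
Proof.
  intros HN HA HB HW xi eta.
  pose (P := fun xi eta => sum_lt 2 (fun a => sum_lt 2 (fun b => wirtinger_hess N a b * (dw a xi *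
      bar (dw b) eta)))).
  pose proof Ci_conj as Hi.
  pose proof (HW xi eta) as W0. pose proof (HW (times_i xi) eta) as W1.
  pose proof (HW xi (times_i eta)) as W2.
  assert (EP : forall xi eta, P xi eta = sum_lt 2 (fun b => (N b xi - Ci * N b (times_i xi)) / 2 *
      bar (dw b) eta)).
  { intros; now apply wirtinger_hess_sum. }
  assert (S : sum_lt 2 (fun a => sum_lt 2 (fun b => wirtinger_hess N a b * symprod (dw a) (bar (dw
      b)) xi eta))
     = (P xi eta + P eta xi) / 2).
  { unfold P, sum_lt, symprod; simpl. cfield. }
  assert (S' : sum_lt 2 (fun a => sum_lt 2 (fun b => wirtinger_hess N a b * wedge (dw a) (bar (dw
      b)) xi eta))
     = P xi eta - P eta xi).
  { unfold P, sum_lt, wedge; simpl. ring. }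
  rewrite S, S', !EP. clear S S' EP. clearbody P.
  revert W0 W1 W2. unfold wedge, abs2, symprod, bar, sum_lt; simpl fold_right.
  rewrite !HA, !HB. unfold dw; simpl. rewrite !Cmult_conj, Hi. intros W0 W1 W2.
  split.
  (* The combination i/4 (W(xi, i eta) - W(i xi, eta)) annihilates the (2,0) and (0,2) parts and
     polarizes the (1,1) part to the symmetric form. *)
  - match type of W1 with ?x = _ => match type of W2 with ?y = _ =>
     transitivity (Ci * (y - x) / 4) end end.
    + field [Ci_sqr]. cbv beta; repeat split; apply RtoC_neq; lra.
    + rewrite W1, W2. field [Ci_sqr]. cbv beta; repeat split; apply RtoC_neq; lra.
  (* Subtracting i/2 (W(i xi, eta) + W(xi, i eta)) removes the (0,2) part and leaves a form of type
     (1,1) unchanged. *)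
  - match type of W1 with ?x = _ => match type of W2 with ?y = _ => match type of W0 with ?z = _ =>
     transitivity (z - Ci * (y + x) / 2) end end end.
    + field [Ci_sqr]. cbv beta; repeat split; apply RtoC_neq; lra.
    + rewrite W0, W1, W2. field [Ci_sqr]. cbv beta; repeat split; apply RtoC_neq; lra.
Qed.

(** * Differentiation under the integral sign *)

Lemma norm_C (z : C) : @norm R_AbsRing C_R_NormedModule z = Cmod z.
Proof.
  destruct z as [a b]. unfold norm; simpl. unfold prod_norm, Cmod; simpl. f_equal.
  unfold norm; simpl. unfold abs; simpl.
  rewrite !Rmult_1_r. rewrite <- !Rabs_mult. rewrite !Rabs_pos_eq by nra. easy.
Qed.

(** Compactness of [0,1]: the radius [delta t] of a product neighbourhood at each t is picked by
    choice, and a common lower bound for finitely many of them serves all t. *)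
Lemma tube {P : UniformSpace} (Q : P -> R -> Prop) (p0 : P) :
  (forall t, (0 <= t <= 1)%R -> locally ((p0, t) : prod_UniformSpace P R_UniformSpace) (fun u => Q
      (fst u) (snd u))) ->
  locally p0 (fun p => forall t, (0 <= t <= 1)%R -> Q p t).
Proof.
  intros H.
  assert (H' : forall t, exists d : posreal, (0 <= t <= 1)%R -> forall p s, ball p0 d p -> ball t d
      s -> Q p s).
  { intros t. destruct (classic (0 <= t <= 1)%R) as [Ht|Ht].
    - destruct (H t Ht) as [d Hd]. exists d. intros _ p s Hp Hs. now apply (Hd (p, s)).
    - exists (mkposreal 1 Rlt_0_1). tauto. }
  set (delta := fun t => proj1_sig (constructive_indefinite_description _ (H' t))).
  assert (Hdelta : forall t, (0 <= t <= 1)%R -> forall p s, ball p0 (delta t) p -> ball t (delta t)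
      s -> Q p s).
  { intros t. unfold delta. destruct (constructive_indefinite_description _ (H' t)); auto. }
  destruct (compactness_value_1d 0 1 delta) as [d Hd].
  (* The covering property supplied by [compactness_value_1d] is doubly negated, hence the proof by
     contradiction. *)
  exists d. intros p Hp t Ht. apply NNPP. intros HQ. apply (Hd t Ht).
  intros (s & Hs & Hts & Hds). apply HQ. apply (Hdelta s Hs).
  - eapply ball_le; eauto.
  - exact Hts.
Qed.

Lemma Cmod_le_Re_Im (z : C) : (Cmod z <= Rabs (Re z) + Rabs (Im z))%R.
Proof.
  destruct z as [a b]. unfold Cmod, Re, Im; simpl.
  pose proof (Rabs_pos a). pose proof (Rabs_pos b).
  rewrite <- (sqrt_square (Rabs a + Rabs b)) by lra. apply sqrt_le_1_alt.
  pose proof (Rsqr_abs a) as Ha. pose proof (Rsqr_abs b) as Hb. unfold Rsqr in *. nra.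
Qed.

Lemma im_le_Cmod (z : C) : (Rabs (Im z) <= Cmod z)%R.
Proof. eapply Rle_trans; [apply Rmax_r|apply Rmax_Cmod]. Qed.

(** The factor 2 arises because the real mean value theorem is applied to real and imaginary parts
    separately, with different intermediate points. *)
Lemma C_mean_value (f df : R -> C) (D : R) :
  (forall t, (0 <= t <= 1)%R -> @is_derive R_AbsRing C_R_NormedModule f t (df t)) ->
  (forall t, (0 <= t <= 1)%R -> (Cmod (df t) <= D)%R) ->
  (Cmod (f 1%R - f 0%R) <= 2 * D)%R.
Proof.
  intros Hd HD.
  assert (B : forall (g dg : R -> R), (forall t, (0 <= t <= 1)%R -> is_derive g t (dg t)) ->
    (forall t, (0 <= t <= 1)%R -> (Rabs (dg t) <= D)%R) -> (Rabs (g 1 - g 0) <= D)%R).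
  { intros g dg Hg HD'. destruct (MVT_gen g 0 1 dg) as (c & Hc & Ec).
    - rewrite Rmin_left, Rmax_right by lra. intros; apply Hg; lra.
    - rewrite Rmin_left, Rmax_right by lra. intros t Ht.
      apply continuity_pt_filterlim. apply (ex_derive_continuous (V := R_NormedModule)). eexists.
          now apply Hg.
    - rewrite Rmin_left, Rmax_right in Hc by lra. rewrite Ec. replace (dg c * (1 - 0))%R with (dg
        c) by ring.
      now apply HD'. }
  eapply Rle_trans; [apply Cmod_le_Re_Im|].
  assert (Rabs (Re (f 1%R - f 0%R)) <= D)%R.
  { apply (B (fun t => Re (f t)) (fun t => Re (df t))).
    - intros t Ht. now apply is_derive_C, Hd.
    - intros t Ht. eapply Rle_trans; [apply re_le_Cmod|auto]. }
  assert (Rabs (Im (f 1%R - f 0%R)) <= D)%R.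
  { apply (B (fun t => Im (f t)) (fun t => Im (df t))).
    - intros t Ht. now apply is_derive_C, Hd.
    - intros t Ht. eapply Rle_trans; [apply im_le_Cmod|auto]. }
  lra.
Qed.

Lemma continuous_C_iff {P : UniformSpace} (f : P -> C) (x : P) :
  @continuous P C_UniformSpace f x <-> forall eps : posreal, locally x (fun y => (Cmod (f y - f x)
      < eps)%R).
Proof.
  split.
  - intros H eps.
    pose proof (proj1 (filterlim_locally_ball_norm (K := R_AbsRing) (U := C_R_NormedModule) f (f
        x)) H eps) as H'.
    revert H'. apply filter_imp. intros y Hy. unfold ball_norm in Hy. now rewrite norm_C in Hy.
  - intros H. apply (filterlim_locally_ball_norm (K := R_AbsRing) (U := C_R_NormedModule) f (f x)).
    intros eps. generalize (H eps). apply filter_imp. intros y Hy. unfold ball_norm. now rewrite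
        norm_C.
Qed.

Lemma continuous_uniformly {P : UniformSpace} (k : P -> R -> C) (y : P) (eps : posreal) :
  (forall t, (0 <= t <= 1)%R ->
     @continuous (prod_UniformSpace P R_UniformSpace) C_UniformSpace (fun u => k (fst u) (snd u))
         (y, t)) ->
  locally y (fun p => forall t, (0 <= t <= 1)%R -> (Cmod (k p t - k y t) < eps)%R).
Proof.
  intros H. apply (tube (fun p t => (Cmod (k p t - k y t) < eps)%R)). intros t Ht.
  destruct (proj1 (continuous_C_iff _ _) (H t Ht) (pos_div_2 eps)) as [d Hd].
  exists d. intros [p s] [Hp Hs]. simpl in *.
  pose proof (Hd (p, s) (conj Hp Hs)) as K1.
  pose proof (Hd (y, s) (conj (ball_center _ _) Hs)) as K2. simpl in K1, K2.
  replace (k p s - k y s) with ((k p s - k y t) + - (k y s - k y t)) by ring.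
  eapply Rle_lt_trans; [apply Cmod_triangle|]. rewrite Cmod_opp. lra.
Qed.

Lemma minus_plus_l {G : AbelianGroup} (a b : G) : minus (plus a b) a = b.
Proof.
  change (plus (plus a b) (opp a) = b).
  now rewrite (plus_comm a b), <- plus_assoc, plus_opp_r, plus_zero_r.
Qed.

Lemma plus_minus_l {G : AbelianGroup} (a b : G) : plus a (minus b a) = b.
Proof.
  change (plus a (plus b (opp a)) = b).
  now rewrite (plus_comm b), plus_assoc, plus_opp_r, plus_zero_l.
Qed.

(** The differential of the integrand is split into a scalar [k1] that varies with the parameter and
    a linear form [ell] that does not. By the mean value inequality along the segment from y to p,
    the error is then bounded by the variation of [k1], which is uniform in t by the tube lemma. *)
Lemma param_filterdiff {P : NormedModule R_AbsRing} (O : P -> Prop) (y : P) (k k1 : P -> R -> C)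
    (ell : R -> P -> C) (M : R) (I lf : P -> C) :
  locally y O ->
  (forall p t, O p -> (0 <= t <= 1)%R ->
     @filterdiff _ P C_R_NormedModule (fun p => k p t) (locally p) (fun v => k1 p t * ell t v)) ->
  (forall t, (0 <= t <= 1)%R ->
     @continuous (prod_UniformSpace P R_UniformSpace) C_UniformSpace (fun u => k1 (fst u) (snd u))
         (y, t)) ->
  (forall t v, (0 <= t <= 1)%R -> (Cmod (ell t v) <= M * norm v)%R) ->
  @is_linear _ P C_R_NormedModule lf ->
  (forall v, @is_RInt C_R_NormedModule (fun t => k1 y t * ell t v) 0 1 (lf v)) ->
  (forall p, O p -> @is_RInt C_R_NormedModule (k p) 0 1 (I p)) ->
  @filterdiff _ P C_R_NormedModule I (locally y) lf.
Proof.
  intros HO Hk Hk1 HM Hlf HI1 HI. split; auto.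
  intros y' Hy'. apply (is_filter_lim_locally_unique (V := P)) in Hy'. subst y'.
  intros eps.
  (* M' is positive whatever the sign of M, so it can be divided by; the 2 in eps / (2 M') absorbs
     the factor of [C_mean_value]. *)
  set (M' := (Rabs M + 1)%R). assert (0 < M')%R by (unfold M'; pose proof (Rabs_pos M); lra).
  assert (He : (0 < eps / (2 * M'))%R) by (apply Rdiv_lt_0_compat; [apply eps|lra]).
  pose proof (filter_and _ _ HO (continuous_uniformly k1 y (mkposreal _ He) Hk1)) as L.
  apply (locally_norm_le_locally (V := P)) in L. destruct L as [d Hd].
  apply (locally_le_locally_norm (V := P)). exists d. intros p Hp. unfold ball_norm in Hp.
  set (v := minus p y) in *.
  set (n := norm v).
  assert (Hn : (0 <= n)%R) by apply norm_ge_0.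
  assert (Seg : forall s, (0 <= s <= 1)%R -> norm (minus (plus y (scal s v)) y) < d).
  { intros s Hs. eapply Rle_lt_trans; [|exact Hp].
    replace (minus (plus y (scal s v)) y) with (scal s v).
    - eapply Rle_trans; [apply (norm_scal (V := P))|]. unfold abs; simpl. rewrite Rabs_pos_eq by
        lra.
      fold n. nra.
    - symmetry. apply (minus_plus_l (G := NormedModule.AbelianGroup _ P)). }
  assert (E1 : plus y (scal 1%R v) = p).
  { transitivity (plus y v); [apply f_equal, (scal_one (V := P))|]. apply (plus_minus_l (G :=
      NormedModule.AbelianGroup _ P)). }
  assert (B : forall t, (0 <= t <= 1)%R -> (Cmod (k p t - k y t - k1 y t * ell t v) <= eps * n)%R).
  { intros t Ht.
    set (f := fun s : R => k (plus y (scal s v)) t - RtoC s * (k1 y t * ell t v)).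
    set (df := fun s : R => (k1 (plus y (scal s v)) t - k1 y t) * ell t v).
    pose proof (C_mean_value f df (eps / (2 * M') * (M' * n))) as MV.
    replace (k p t - k y t - k1 y t * ell t v) with (f 1%R - f 0%R).
    - replace (eps * n)%R with (2 * (eps / (2 * M') * (M' * n)))%R by (field; lra).
      apply MV.
      + intros s Hs. destruct (Hd (plus y (scal s v)) (Seg s Hs)) as [Os _].
        pose proof (filterdiff_comp' _ _ s _ _ (line_filterdiff y v s) (Hk _ t Os Ht)) as D1.
        assert (D2 : @is_derive R_AbsRing C_R_NormedModule (fun s => RtoC s * (k1 y t * ell t v)) s
            (k1 y t * ell t v)).
        { apply (is_derive_ext (V := C_R_NormedModule) (fun s : R => @scal _ C_R_NormedModule s (k1
            y t * ell t v))).
          - intros r. destruct (k1 y t * ell t v) as [a b]. unfold RtoC, Cmult; simpl.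
            apply injective_projections; simpl; unfold scal; simpl; unfold mult; simpl; ring.
          - pose proof (is_derive_scal_l (V := C_R_NormedModule) (fun r : R => r) s one (k1 y t *
              ell t v) (is_derive_id (K := R_AbsRing) s)) as D.
            now rewrite (scal_one (V := C_R_NormedModule)) in D. }
        assert (D1' : @is_derive R_AbsRing C_R_NormedModule (fun s => k (plus y (scal s v)) t) s
            (k1 (plus y (scal s v)) t * ell t v)).
        { apply (filterdiff_ext_lin _ _ _ D1). intros r.
          destruct (Hk _ t Os Ht) as [Hl _]. apply (linear_scal _ Hl). }
        pose proof (is_derive_minus (V := C_R_NormedModule) _ _ _ _ _ D1' D2) as D.
        unfold df. replace ((k1 (plus y (scal s v)) t - k1 y t) * ell t v) with (k1 (plus y (scal s
            v)) t * ell t v - k1 y t * ell t v) by ring.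
        exact D.
      + intros s Hs. unfold df. rewrite Cmod_mult.
        destruct (Hd (plus y (scal s v)) (Seg s Hs)) as [_ Ks]. specialize (Ks t Ht). simpl in Ks.
        apply Rmult_le_compat; try apply Cmod_ge_0; [lra|].
        eapply Rle_trans; [apply HM, Ht|]. fold n. unfold M'. pose proof (Rle_abs M). nra.
    - unfold f. rewrite E1, line_0. ring. }
  destruct (Hd p Hp) as [Op _].
  assert (Oy : O y) by (apply (locally_singleton _ _ HO)).
  assert (HR : @is_RInt C_R_NormedModule (fun t => k p t - k y t - k1 y t * ell t v) 0 1 (I p - I y
      - lf v)).
  { apply (is_RInt_minus (V := C_R_NormedModule)); auto. apply (is_RInt_minus (V :=
      C_R_NormedModule)); auto. }
  eapply Rle_trans.
  - apply (norm_RInt_le_const (V := C_R_NormedModule) (fun t => k p t - k y t - k1 y t * ell t v) 0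
      1 (I p - I y - lf v) (eps * n)); [lra| |exact HR].
    intros t Ht. rewrite norm_C. exact (B t Ht).
  - unfold n. lra.
Qed.

Notation contC := (@continuous _ C_UniformSpace).
Notation is_RIntC := (@is_RInt C_R_NormedModule).

Lemma continuous_C_pair {P : UniformSpace} (f : P -> C) (x : P) :
  contC f x <-> continuous (fun y => Re (f y)) x /\ continuous (fun y => Im (f y)) x.
Proof.
  split.
  - intros H. split.
    + apply (continuous_comp (V := C_UniformSpace) f fst); [exact H|]. destruct (f x) as [a b].
        apply continuous_fst.
    + apply (continuous_comp (V := C_UniformSpace) f snd); [exact H|]. destruct (f x) as [a b].
        apply continuous_snd.
  - intros [H1 H2]. apply (continuous_ext (fun y => (Re (f y), Im (f y)))).
    { intros y. now destruct (f y). }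
    apply (continuous_comp_2 (fun y => Re (f y)) (fun y => Im (f y)) (fun a b => (a, b) :
        C_UniformSpace)); auto.
    apply (continuous_ext (fun u => u)); [now intros []|]. apply continuous_id.
Qed.

Lemma continuous_Cmult {P : UniformSpace} (f g : P -> C) (x : P) :
  contC f x -> contC g x -> contC (fun y => f y * g y) x.
Proof.
  intros Hf Hg. apply continuous_C_pair in Hf as [F1 F2], Hg as [G1 G2]. apply continuous_C_pair.
  split.
  - apply (continuous_minus (V := R_NormedModule)); apply (continuous_mult (K := R_AbsRing)); auto.
  - apply (continuous_plus (V := R_NormedModule)); apply (continuous_mult (K := R_AbsRing)); auto.
Qed.

Lemma continuous_scale {P : UniformSpace} (c : C) (f : P -> C) (x : P) :
  contC f x -> contC (fun y => c * f y) x.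
Proof. intros Hf. apply (continuous_Cmult (fun _ => c)); auto. apply continuous_const. Qed.

Lemma continuous_Cplus {P : UniformSpace} (f g : P -> C) (x : P) :
  contC f x -> contC g x -> contC (fun y => f y + g y) x.
Proof.
  intros Hf Hg. apply continuous_C_pair in Hf as [F1 F2], Hg as [G1 G2]. apply continuous_C_pair.
  split; now apply (continuous_plus (V := R_NormedModule)).
Qed.

Lemma continuous_Cconj {P : UniformSpace} (f : P -> C) (x : P) :
  contC f x -> contC (fun y => Cconj (f y)) x.
Proof.
  intros Hf. apply continuous_C_pair in Hf as [F1 F2]. apply continuous_C_pair. split; auto.
  now apply (continuous_opp (V := R_NormedModule)).
Qed.

Lemma continuous_RtoC {P : UniformSpace} (f : P -> R) (x : P) :
  continuous f x -> contC (fun y => RtoC (f y)) x.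
Proof. intros H. apply continuous_C_pair. split; auto. apply continuous_const. Qed.

Lemma continuous_Cinv {P : UniformSpace} (f : P -> C) (x : P) :
  contC f x -> f x <> 0 -> contC (fun y => / f y) x.
Proof.
  intros H Hx.
  pose proof H as H'. apply continuous_C_pair in H' as [F1 F2].
  assert (D : (Re (f x) ^ 2 + Im (f x) ^ 2 <> 0)%R).
  { intros E. apply Hx. apply injective_projections; unfold Re, Im in E; simpl; nra. }
  set (d := fun y => (/ (Re (f y) ^ 2 + Im (f y) ^ 2))%R).
  assert (Hd : continuous d x).
  { unfold d. apply (continuous_comp (V := R_UniformSpace) (fun y => (Re (f y) ^ 2 + Im (f y) ^
      2)%R) Rinv).
    - apply (continuous_ext (fun y => plus (mult (Re (f y)) (Re (f y))) (mult (Im (f y)) (Im (f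
        y))))).
      { intros y. unfold plus, mult; simpl; ring. }
      apply (continuous_plus (V := R_NormedModule)); apply (continuous_mult (K := R_AbsRing)); auto.
    - apply continuous_Rinv; auto. }
  apply continuous_C_pair. split.
  - apply (continuous_mult (K := R_AbsRing) (fun y => Re (f y)) d); auto.
  - apply (continuous_mult (K := R_AbsRing) (fun y => (- Im (f y))%R) d); auto.
    now apply (continuous_opp (V := R_NormedModule)).
Qed.

Lemma continuous_pair2 {P : UniformSpace} (F : C * C -> C) (f g : P -> C) (x : P) :
  @continuous (prod_UniformSpace C_UniformSpace C_UniformSpace) C_UniformSpace F (f x, g x) ->
  contC f x -> contC g x -> contC (fun y => F (f y, g y)) x.
Proof.
  intros HF Hf Hg.
  apply (continuous_comp_2 (V := C_UniformSpace) (W := C_UniformSpace) f g (fun a b => F (a, b)));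
      auto.
  apply (continuous_ext F); auto. now intros [].
Qed.

Lemma is_RInt_Cmult (f : R -> C) (a b : R) (c l : C) :
  is_RIntC f a b l -> is_RIntC (fun t => c * f t) a b (c * l).
Proof.
  intros H.
  pose proof (is_RInt_fct_extend_fst (U := R_NormedModule) (V := R_NormedModule) f a b l H) as H1.
  pose proof (is_RInt_fct_extend_snd (U := R_NormedModule) (V := R_NormedModule) f a b l H) as H2.
  pose proof (fun k g m => is_RInt_scal (V := R_NormedModule) g a b k m) as S.
  apply (is_RInt_fct_extend_pair (U := R_NormedModule) (V := R_NormedModule)).
  - apply (is_RInt_minus (V := R_NormedModule)); now apply S.
  - apply (is_RInt_ext (fun t => plus (scal (fst c) (snd (f t))) (scal (snd c) (fst (f t))))).
    { intros t _. unfold plus, scal; simpl; unfold mult; simpl; ring. }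
    apply (is_RInt_plus (V := R_NormedModule)); now apply S.
Qed.

Lemma is_RInt_C_const (c : C) : is_RIntC (fun _ => c) 0 1 c.
Proof.
  assert (E : @scal _ C_R_NormedModule (1 - 0)%R c = c).
  { rewrite Rminus_0_r. apply (scal_one (V := C_R_NormedModule)). }
  exact (eq_ind _ (is_RIntC (fun _ => c) 0 1) (is_RInt_const (V := C_R_NormedModule) 0 1 c) _ E).
Qed.

Lemma is_RInt_C_continuous (f : R -> C) :
  (forall t, (0 <= t <= 1)%R -> contC f t) -> is_RIntC f 0 1 (@RInt C_R_CompleteNormedModule f 0 1).
Proof.
  intros H. apply (RInt_correct (V := C_R_CompleteNormedModule)).
  apply (ex_RInt_continuous (V := C_R_CompleteNormedModule)).
  rewrite Rmin_left, Rmax_right by lra. exact H.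
Qed.

Lemma param_continuous {P : UniformSpace} (k : P -> R -> C) (I : P -> C) (y : P) :
  (forall t, (0 <= t <= 1)%R ->
     @continuous (prod_UniformSpace P R_UniformSpace) C_UniformSpace (fun u => k (fst u) (snd u))
         (y, t)) ->
  locally y (fun p => is_RIntC (k p) 0 1 (I p)) ->
  contC I y.
Proof.
  intros Hk HI. apply continuous_C_iff. intros eps.
  generalize (filter_and _ _ HI (continuous_uniformly k y (pos_div_2 eps) Hk)).
  apply filter_imp. intros p [Hp Ht].
  assert (HR : is_RIntC (fun t => k p t - k y t) 0 1 (I p - I y)).
  { apply (is_RInt_minus (V := C_R_NormedModule)); auto. apply (locally_singleton _ _ HI). }
  apply (norm_RInt_le_const (V := C_R_NormedModule) (fun t => k p t - k y t) 0 1 _ (eps / 2)) in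
      HR; [|lra|].
  - rewrite norm_C in HR. pose proof (cond_pos eps). lra.
  - intros t H. rewrite norm_C. apply Rlt_le, (Ht t H).
Qed.

(** * The derivative of a holomorphic function is holomorphic *)

Notation contCC := (@continuous (prod_UniformSpace C_UniformSpace C_UniformSpace) C_UniformSpace).
Notation diffC := (@filterdiff R_AbsRing C_R_NormedModule C_R_NormedModule).

Definition circ (t : R) : C := (cos (2 * PI * t), sin (2 * PI * t)).

Lemma circ_derive (t : R) : @is_derive R_AbsRing C_R_NormedModule circ t (2 * RtoC PI * Ci * circ
    t).
Proof.
  apply is_derive_C. unfold circ; simpl. split; auto_derive; auto; ring.
Qed.

Lemma circ_continuous (t : R) : contC circ t.
Proof.
  apply (ex_derive_continuous (V := C_R_NormedModule) circ). eexists. apply circ_derive.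
Qed.

Lemma circ_conj (t : R) : circ t * Cconj (circ t) = 1.
Proof.
  unfold circ, Cconj, Cmult, RtoC; simpl. pose proof (sin2_cos2 (2 * PI * t)) as H. unfold Rsqr in
      H.
  f_equal; lra.
Qed.

Lemma circ_Cmod (t : R) : Cmod (circ t) = 1%R.
Proof.
  unfold circ, Cmod; simpl. pose proof (sin2_cos2 (2 * PI * t)) as H. unfold Rsqr in H.
  transitivity (sqrt 1); [f_equal; lra|apply sqrt_1].
Qed.

Lemma circ_period : circ 1 = circ 0.
Proof.
  unfold circ. rewrite Rmult_1_r, Rmult_0_r, cos_2PI, sin_2PI, cos_0, sin_0. auto.
Qed.

(* [F1] is the derivative of [F] in the first variable; the second one is a parameter. *)
Definition x_smooth (U : C * C -> Prop) (F F1 : C * C -> C) : Prop :=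
  (@open (prod_UniformSpace C_UniformSpace C_UniformSpace) U) /\
  forall x z, U (x, z) -> contCC F (x, z) /\ contCC F1 (x, z) /\
    diffC (fun x => F (x, z)) (locally x) (fun v => F1 (x, z) * v).

Lemma is_linear_Cmult (c : C) : @is_linear _ C_R_NormedModule C_R_NormedModule (fun v => c * v).
Proof.
  constructor.
  - intros a b. change (c * (a + b) = c * a + c * b). ring.
  - intros r a. apply injective_projections; simpl; unfold scal; simpl; unfold mult; simpl; ring.
  - exists (Cmod c + 1)%R. split; [pose proof (Cmod_ge_0 c); lra|].
    intros a. rewrite !norm_C, Cmod_mult. pose proof (Cmod_ge_0 a). lra.
Qed.

Lemma diffC_unique (f : C -> C) (x a b : C) :
  diffC f (locally x) (fun v => a * v) -> diffC f (locally x) (fun v => b * v) -> a = b.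
Proof.
  intros Ha Hb. apply (dir_filterdiff (X := C_R_NormedModule) f x (RtoC 1)) in Ha, Hb.
  rewrite Ha in Hb. transitivity (a * 1); [ring|]. rewrite Hb. ring.
Qed.

Lemma diffC_curve (f : C -> C) (g : R -> C) (t : R) (a g' : C) :
  diffC f (locally (g t)) (fun v => a * v) ->
  @is_derive R_AbsRing C_R_NormedModule g t g' ->
  @is_derive R_AbsRing C_R_NormedModule (fun t => f (g t)) t (a * g').
Proof.
  intros Hf Hg. pose proof (filterdiff_comp' (V := C_R_NormedModule) (W := C_R_NormedModule) g f t
      _ _ Hg Hf) as D.
  apply (filterdiff_ext_lin _ _ _ D). intros s.
  destruct (is_linear_Cmult a) as [_ Hs _]. apply Hs.
Qed.

Lemma filterdiff_shift (c x : C) : diffC (fun y => y + c) (locally x) (fun v => v).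
Proof.
  pose proof (filterdiff_plus_fct (K := R_AbsRing) (V := C_R_NormedModule) (F := locally x)
    (fun y : C => y) (fun _ : C => c) _ _
    (filterdiff_id (K := R_AbsRing) (V := C_R_NormedModule) (locally x))
    (filterdiff_const (K := R_AbsRing) (V := C_R_NormedModule) c)) as D.
  apply (filterdiff_ext_lin _ _ _ D). intros v. apply (plus_zero_r (G := C_R_NormedModule)).
Qed.

Section Circle.
Variables (U : C * C -> Prop) (F F1 : C * C -> C) (x0 z0 : C) (r : R).
Hypothesis HF : x_smooth U F F1.
Hypothesis r_pos : (0 < r)%R.
Hypothesis disc : forall x z, (Cmod (x - x0) < 3 * r)%R -> (Cmod (z - z0) < r)%R -> U (x, z).

(** The radius 3 r leaves room for a centre within r of x0 and a circle of radius below 2 r. The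
    scale l thus ranges over an open set containing [0,1], on which the circular mean can be
    differentiated in l. *)
Lemma disc_circle (x z : C) (l t : R) : (Cmod (x - x0) < r)%R -> (Cmod (z - z0) < r)%R -> (Rabs l <
    2)%R ->
  U (x + RtoC l * RtoC r * circ t, z).
Proof.
  intros Hx Hz Hl. apply disc; auto.
  replace (x + RtoC l * RtoC r * circ t - x0) with ((x - x0) + RtoC l * RtoC r * circ t) by ring.
  eapply Rle_lt_trans; [apply Cmod_triangle|]. rewrite !Cmod_mult, circ_Cmod, !Cmod_R, (Rabs_pos_eq
      r) by lra.
  pose proof (Rabs_pos l). nra.
Qed.

Lemma circle_continuous (G : C * C -> C) (l t : R) (x z : C) :
  (forall x z, U (x, z) -> contCC G (x, z)) ->
  (Cmod (x - x0) < r)%R -> (Cmod (z - z0) < r)%R -> (Rabs l < 2)%R ->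
  contC (fun t => G (x + RtoC l * RtoC r * circ t, z)) t.
Proof.
  intros HG Hx Hz Hl. apply continuous_pair2.
  - apply HG. now apply disc_circle.
  - apply continuous_Cplus; [apply continuous_const|]. apply continuous_scale, circ_continuous.
  - apply continuous_const.
Qed.

(* The circular mean over radius [l * r] has vanishing derivative in [l]: up to the factor
   [2 i pi l] its integrand is a derivative in the angle. *)
Lemma circle_mean (x z : C) : (Cmod (x - x0) < r)%R -> (Cmod (z - z0) < r)%R ->
  is_RIntC (fun t => F (x + RtoC r * circ t, z)) 0 1 (F (x, z)).
Proof.
  intros Hx Hz. destruct HF as [_ HU].
  set (k := fun l t : R => F (x + RtoC l * RtoC r * circ t, z)).
  set (k1 := fun l t : R => F1 (x + RtoC l * RtoC r * circ t, z)).
  assert (Ck : forall l, (Rabs l < 2)%R -> is_RIntC (k l) 0 1 (@RInt C_R_CompleteNormedModule (k l)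
      0 1)).
  { intros l Hl. apply is_RInt_C_continuous. intros t Ht. apply circle_continuous; auto. intros a b
      Hab; apply (HU a b Hab). }
  set (M := fun l => @RInt C_R_CompleteNormedModule (k l) 0 1 : C) in *.
  pose proof two_pi_i_neq0 as Pi0.
  assert (I0 : forall l, (Rabs l < 2)%R -> is_RIntC (fun t => k1 l t * circ t) 0 1 (RtoC 0)).
  (* The derivative of [k l] in the angle carries the factor l, so l = 0 is treated apart: there the
     integrand is a constant multiple of [circ], which is itself proportional to the derivative of a
     periodic function. *)
  { intros l Hl. destruct (Req_dec l 0) as [->|Hl0].
    - apply (is_RInt_ext (V := C_R_NormedModule) (fun t => (F1 (x, z) / (2 * RtoC PI * Ci)) * (2 *
        RtoC PI * Ci * circ t))).
      + intros t _. unfold k1. replace (x + 0 * RtoC r * circ t) with x by ring.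
        change (F1 (x, z) / (2 * PI * Ci) * (2 * PI * Ci * circ t) = F1 (x, z) * circ t). field.
        repeat split; intros E; apply Pi0; rewrite E; ring.
      + replace (RtoC 0) with (F1 (x, z) / (2 * RtoC PI * Ci) * (circ 1 - circ 0)) by (rewrite
          circ_period; ring).
        apply is_RInt_Cmult. apply (is_RInt_derive (V := C_R_CompleteNormedModule)).
        * intros; apply circ_derive.
        * intros; apply continuous_scale, circ_continuous.
    - assert (Hl1 : RtoC l * RtoC r <> 0).
      { apply Cmult_neq_0; apply RtoC_neq; lra. }
      apply (is_RInt_ext (V := C_R_NormedModule) (fun t => (/ (2 * RtoC PI * Ci * (RtoC l * RtoC
          r))) * (k1 l t * (RtoC l * RtoC r * (2 * RtoC PI * Ci * circ t))))).
      + intros t _.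
        change (/ (2 * PI * Ci * (l * r)) * (k1 l t * (l * r * (2 * PI * Ci * circ t))) = k1 l t *
            circ t). field.
        repeat split; intros E; (apply Pi0; rewrite E; ring) || (apply Hl1; rewrite E; ring).
      + replace (RtoC 0) with (/ (2 * RtoC PI * Ci * (RtoC l * RtoC r)) * (k l 1%R - k l 0%R)) by
          (unfold k; rewrite circ_period; ring).
        apply is_RInt_Cmult. apply (is_RInt_derive (V := C_R_CompleteNormedModule)).
        * intros t _. unfold k, k1. apply (diffC_curve (fun x => F (x, z)) (fun t => x + RtoC l *
            RtoC r * circ t)).
          -- apply HU. now apply disc_circle.
          -- apply is_derive_C. unfold circ; simpl. split; auto_derive; auto; ring.
        * intros t _. apply continuous_Cmult.
          -- apply circle_continuous; auto. intros a b Hab; apply (HU a b Hab).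
          -- apply continuous_scale, continuous_scale, circ_continuous. }
  assert (DM : forall l, (0 <= l <= 1)%R -> @is_derive R_AbsRing C_R_NormedModule M l (RtoC 0)).
  { intros l Hl.
    assert (Hl2 : (Rabs l < 2)%R) by (apply Rabs_def1; lra).
    apply (filterdiff_ext_lin _ (fun _ : R => RtoC 0)).
    2:{ intros s. symmetry. apply (scal_zero_r (V := C_R_NormedModule)). }
    apply (param_filterdiff (P := R_NormedModule) (fun l => (Rabs l < 2)%R) l k k1 (fun t v => RtoC
        v * RtoC r * circ t) r).
    - apply (open_comp (fun l : R => Rabs l) (fun y => (y < 2)%R)).
      + intros y _. apply continuous_Rabs.
      + apply open_lt.
      + exact Hl2.
    - intros l' t Hl' Ht. unfold k, k1.
      apply (filterdiff_ext_lin _ (fun s : R => @scal _ C_R_NormedModule s (F1 (x + RtoC l' * RtoC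
          r * circ t, z) * (RtoC r * circ t)))).
      + apply (diffC_curve (fun x => F (x, z)) (fun l => x + RtoC l * RtoC r * circ t)).
        * apply HU. now apply disc_circle.
        * apply is_derive_C. unfold circ; simpl. split; auto_derive; auto; ring.
      + intros s. apply injective_projections; simpl; unfold scal; simpl; unfold mult; simpl; ring.
    - intros t Ht. unfold k1.
      apply (continuous_pair2 F1 (fun u : R * R => x + RtoC (fst u) * RtoC r * circ (snd u)) (fun _
          => z) (l, t)).
      + apply HU. now apply disc_circle.
      + apply continuous_Cplus; [apply continuous_const|]. apply continuous_Cmult.
        * apply continuous_Cmult; [|apply continuous_const]. apply continuous_RtoC, continuous_fst.
        * apply (continuous_comp snd circ); [apply continuous_snd|apply circ_continuous].
      + apply continuous_const.
    - intros t v Ht. rewrite !Cmod_mult, circ_Cmod, !Cmod_R, (Rabs_pos_eq r) by lra.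
      unfold norm; simpl; unfold abs; simpl. lra.
    - apply (is_linear_zero (U := R_NormedModule) (V := C_R_NormedModule)).
    - intros v. apply (is_RInt_ext (V := C_R_NormedModule) (fun t => (RtoC v * RtoC r) * (k1 l t *
        circ t))).
      + intros t _. change (v * r * (k1 l t * circ t) = k1 l t * (v * r * circ t)). ring.
      + replace (RtoC 0) with (RtoC v * RtoC r * 0) by ring. apply is_RInt_Cmult, I0, Hl2.
    - intros l' Hl'. now apply Ck. }
  assert (E : M 1%R = M 0%R).
  { symmetry. apply (eq_is_derive (V := C_R_NormedModule) M 0 1); [exact DM|lra]. }
  assert (M0 : M 0%R = F (x, z)).
  { apply (is_RInt_unique (V := C_R_CompleteNormedModule) (k 0%R) 0 1 (F (x, z))).
    apply (is_RInt_ext (V := C_R_NormedModule) (fun t => F (x, z))).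
    - intros t _. unfold k. now replace (x + 0 * RtoC r * circ t) with x by ring.
    - apply is_RInt_C_const. }
  rewrite <- M0, <- E.
  apply (is_RInt_ext (V := C_R_NormedModule) (k 1%R)).
  - intros t _. unfold k. now rewrite Cmult_1_l.
  - apply Ck. rewrite Rabs_R1. lra.
Qed.

Lemma disc_circle1 (x z : C) (t : R) : (Cmod (x - x0) < r)%R -> (Cmod (z - z0) < r)%R -> U (x +
    RtoC r * circ t, z).
Proof.
  intros Hx Hz. replace (x + RtoC r * circ t) with (x + RtoC 1 * RtoC r * circ t) by ring.
  apply disc_circle; auto. rewrite Rabs_R1; lra.
Qed.

Lemma circle_continuous_joint {P : UniformSpace} (G : C * C -> C) (f h : P -> C) (g : R -> C) (p :
    P) (t : R) :
  (forall x z, U (x, z) -> contCC G (x, z)) -> (forall t, contC g t) ->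
  (Cmod (f p - x0) < r)%R -> (Cmod (h p - z0) < r)%R -> contC f p -> contC h p ->
  @continuous (prod_UniformSpace P R_UniformSpace) C_UniformSpace
    (fun u => G (f (fst u) + RtoC r * circ (snd u), h (fst u)) * g (snd u)) (p, t).
Proof.
  intros HG Hg Hx Hz Hf Hh. apply continuous_Cmult.
  - apply (continuous_pair2 G (fun u : P * R => f (fst u) + RtoC r * circ (snd u)) (fun u => h (fst
      u)) (p, t)).
    + apply HG. now apply disc_circle1.
    + apply continuous_Cplus.
      * apply (continuous_comp fst f); [apply continuous_fst|exact Hf].
      * apply continuous_scale. apply (continuous_comp snd circ); [apply continuous_snd|apply
          circ_continuous].
    + apply (continuous_comp fst h); [apply continuous_fst|exact Hh].
  - apply (continuous_comp snd g); [apply continuous_snd|apply Hg].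
Qed.

(** The weight g is left free: g = 1 differentiates the mean value property, and g = conj circ / r
    differentiates the formula for F1. *)
Lemma circle_diff (z : C) (g : R -> C) (I : C -> C) (x : C) :
  (forall t, contC g t) -> (Cmod (z - z0) < r)%R -> (Cmod (x - x0) < r)%R ->
  (forall x', (Cmod (x' - x0) < r)%R ->
     is_RIntC (fun t => F (x' + RtoC r * circ t, z) * g t) 0 1 (I x')) ->
  diffC I (locally x)
    (fun v => (@RInt C_R_CompleteNormedModule (fun t => F1 (x + RtoC r * circ t, z) * g t) 0 1 : C)
        * v).
Proof.
  intros Hg Hz Hx HI. destruct HF as [_ HU].
  set (c := @RInt C_R_CompleteNormedModule (fun t => F1 (x + RtoC r * circ t, z) * g t) 0 1 : C).
  assert (Hc : is_RIntC (fun t => F1 (x + RtoC r * circ t, z) * g t) 0 1 c).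
  { apply is_RInt_C_continuous. intros t _. apply continuous_Cmult; auto.
    apply (continuous_ext (fun t => F1 (x + RtoC 1 * RtoC r * circ t, z))).
    - intros s. now rewrite Cmult_1_l.
    - apply circle_continuous; auto; [intros a b Hab; apply (HU a b Hab)|rewrite Rabs_R1; lra]. }
  apply (param_filterdiff (P := C_R_NormedModule) (fun x' => (Cmod (x' - x0) < r)%R) x
    (fun x' t => F (x' + RtoC r * circ t, z) * g t) (fun x' t => F1 (x' + RtoC r * circ t, z) * g t)
    (fun _ v => v) 1).
  - assert (Hd : (0 < r - Cmod (x - x0))%R) by lra.
    assert (Hcont : contC (fun y : C => y) x) by apply continuous_id.
    generalize (proj1 (continuous_C_iff (fun y : C => y) x) Hcont (mkposreal _ Hd)).
    apply filter_imp. simpl. intros y Hy.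
    replace (y - x0) with ((y - x) + (x - x0)) by ring.
    eapply Rle_lt_trans; [apply Cmod_triangle|lra].
  - intros x' t Hx' Ht.
    pose proof (is_linear_Cmult (g t)) as Lg.
    assert (D1 : diffC (fun x' => F (x' + RtoC r * circ t, z)) (locally x') (fun v => F1 (x' + RtoC
        r * circ t, z) * v)).
    { apply (filterdiff_comp' (V := C_R_NormedModule) (W := C_R_NormedModule) (fun x' => x' + RtoC
        r * circ t) (fun x => F (x, z)) x' (fun v => v) (fun v => F1 (x' + RtoC r * circ t, z) *
        v)).
      - apply filterdiff_shift.
      - apply HU. now apply disc_circle1. }
    pose proof (filterdiff_comp' (V := C_R_NormedModule) (W := C_R_NormedModule) _ (fun w => g t *
        w) x' _ _ D1
       (filterdiff_linear _ Lg)) as D2.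
    apply (filterdiff_ext_lin (K := R_AbsRing) (U := C_R_NormedModule) (V := C_R_NormedModule) _
        (fun v : C => g t * (F1 (x' + RtoC r * circ t, z) * v))).
    + apply (filterdiff_ext (K := R_AbsRing) (U := C_R_NormedModule) (V := C_R_NormedModule) (fun y
        : C => g t * F (y + RtoC r * circ t, z))); [|exact D2]. intros y. apply Cmult_comm.
    + intros v. change (g t * (F1 (x' + RtoC r * circ t, z) * v) = F1 (x' + RtoC r * circ t, z) * g
        t * v). ring.
  - intros t Ht. apply (circle_continuous_joint F1 (fun y => y) (fun _ => z)); auto.
    + intros a b Hab; apply (HU a b Hab).
    + apply continuous_id.
    + apply continuous_const.
  - intros t v Ht. rewrite norm_C. lra.
  - apply is_linear_Cmult.
  - intros v. apply (is_RInt_ext (V := C_R_NormedModule) (fun t => v * (F1 (x + RtoC r * circ t, z)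
      * g t))).
    + intros t _. apply Cmult_comm.
    + rewrite (Cmult_comm c). now apply is_RInt_Cmult.
  - exact HI.
Qed.

(** Cauchy's formula for the derivative. Its right-hand side involves F but not F1, so it can be
    differentiated once more in x. *)
Lemma circle_derivative (x z : C) : (Cmod (x - x0) < r)%R -> (Cmod (z - z0) < r)%R ->
  is_RIntC (fun t => F (x + RtoC r * circ t, z) * (Cconj (circ t) / RtoC r)) 0 1 (F1 (x, z)).
Proof.
  intros Hx Hz. pose proof HF as [_ HU].
  assert (R0 : RtoC r <> 0) by (apply RtoC_neq; lra).
  pose proof two_pi_i_neq0 as Pi0.
  assert (C1 : forall t, contC (fun t => F1 (x + RtoC r * circ t, z)) t).
  { intros t. apply (continuous_ext (fun t => F1 (x + RtoC 1 * RtoC r * circ t, z))).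
    - intros s. now rewrite Cmult_1_l.
    - apply circle_continuous; auto; [intros a b Hab; apply (HU a b Hab)|rewrite Rabs_R1; lra]. }
  assert (C0 : forall t, contC (fun t => F (x + RtoC r * circ t, z)) t).
  { intros t. apply (continuous_ext (fun t => F (x + RtoC 1 * RtoC r * circ t, z))).
    - intros s. now rewrite Cmult_1_l.
    - apply circle_continuous; auto; [intros a b Hab; apply (HU a b Hab)|rewrite Rabs_R1; lra]. }
  (* Differentiating [circle_mean] in the centre and comparing with F1: the mean value property
     passes to the derivative. *)
  assert (M1 : is_RIntC (fun t => F1 (x + RtoC r * circ t, z)) 0 1 (F1 (x, z))).
  { assert (E : F1 (x, z) = @RInt C_R_CompleteNormedModule (fun t => F1 (x + RtoC r * circ t, z) *
      1) 0 1).
    { apply (diffC_unique (fun x => F (x, z)) x).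
      - apply HU. replace x with (x + RtoC 0 * RtoC r * circ 0) by ring. apply disc_circle; auto.
          rewrite Rabs_R0; lra.
      - apply circle_diff; auto.
        + intros t; apply continuous_const.
        + intros x' Hx'. apply (is_RInt_ext (V := C_R_NormedModule) (fun t => F (x' + RtoC r * circ
            t, z))).
          * intros t _. symmetry. apply Cmult_1_r.
          * now apply circle_mean. }
    rewrite E. apply (is_RInt_ext (V := C_R_NormedModule) (fun t => F1 (x + RtoC r * circ t, z) *
        1)).
    - intros t _. apply Cmult_1_r.
    - apply is_RInt_C_continuous. intros t _. apply continuous_Cmult; [apply C1|apply
        continuous_const]. }
  (* Integration by parts on the circle: the integrand is the derivative in t of the periodic
     function F conj circ, simplified by circ conj circ = 1. *)
  assert (M2 : is_RIntC (fun t => 2 * RtoC PI * Ci * (RtoC r * F1 (x + RtoC r * circ t, z) - F (x +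
      RtoC r * circ t, z) * Cconj (circ t))) 0 1 (RtoC 0)).
  { set (f := fun t => F (x + RtoC r * circ t, z) * Cconj (circ t)).
    assert (E : RtoC 0 = @minus C_R_NormedModule (f 1%R) (f 0%R)).
    { unfold f. rewrite circ_period. symmetry. apply (minus_eq_zero (G := C_R_NormedModule)). }
    rewrite E. apply (is_RInt_derive (V := C_R_CompleteNormedModule)).
    - intros t _. unfold f.
      pose proof (diffC_curve (fun x => F (x, z)) (fun t => x + RtoC r * circ t) t (F1 (x + RtoC r
          * circ t, z)) (RtoC r * (2 * RtoC PI * Ci * circ t))) as D1.
      assert (D2 : @is_derive R_AbsRing C_R_NormedModule (fun t => x + RtoC r * circ t) t (RtoC r *
          (2 * RtoC PI * Ci * circ t))).
      { apply is_derive_C. unfold circ; simpl. split; auto_derive; auto; ring. }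
      pose proof (is_derive_Cmult _ _ t _ _ (D1 (proj2 (proj2 (HU _ _ (disc_circle1 x z t Hx Hz))))
          D2) (is_derive_Cconj _ _ _ (circ_derive t))) as D.
      match type of D with is_derive _ _ ?d =>
        replace (2 * RtoC PI * Ci * (RtoC r * F1 (x + RtoC r * circ t, z) - F (x + RtoC r * circ t,
            z) * Cconj (circ t))) with d; [exact D|] end.
      push_conj. rewrite Ci_conj.
      match goal with |- ?f1 * (?rr * (?p * circ t)) * Cconj (circ t) + _ = _ =>
        transitivity (f1 * rr * p * (circ t * Cconj (circ t)) - F (x + RtoC r * circ t, z) * p *
            Cconj (circ t)); [ring|] end.
      rewrite circ_conj. ring.
    - intros t _. apply continuous_scale. unfold Cminus.
      apply continuous_Cplus; [apply continuous_scale, C1|].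
      apply (continuous_ext (fun t => (- (1)) * (F (x + RtoC r * circ t, z) * Cconj (circ t)))).
      + intros s. change (- (1) * (F (x + r * circ s, z) * Cconj (circ s)) = - (F (x + r * circ s,
          z) * Cconj (circ s))). ring.
      + apply continuous_scale, continuous_Cmult; auto. apply continuous_Cconj, circ_continuous. }
  apply (is_RInt_ext (V := C_R_NormedModule) (fun t => @minus C_R_NormedModule (F1 (x + RtoC r *
      circ t, z)) (/ (2 * RtoC PI * Ci * RtoC r) * (2 * RtoC PI * Ci * (RtoC r * F1 (x + RtoC r *
      circ t, z) - F (x + RtoC r * circ t, z) * Cconj (circ t)))))).
  - intros t _.
    change (F1 (x + RtoC r * circ t, z) - (/ (2 * RtoC PI * Ci * RtoC r) * (2 * RtoC PI * Ci *
        (RtoC r * F1 (x + RtoC r * circ t, z) - F (x + RtoC r * circ t, z) * Cconj (circ t)))) = F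
        (x + RtoC r * circ t, z) * (Cconj (circ t) / RtoC r)).
    field. repeat split; auto; intros E; apply Pi0; rewrite E; ring.
  - assert (E : F1 (x, z) = @minus C_R_NormedModule (F1 (x, z)) (/ (2 * RtoC PI * Ci * RtoC r) *
      0)).
    { change (F1 (x, z) = F1 (x, z) - (/ (2 * RtoC PI * Ci * RtoC r) * 0)). ring. }
    rewrite E. apply (is_RInt_minus (V := C_R_NormedModule)); auto. now apply is_RInt_Cmult.
Qed.
End Circle.

Lemma open_polydisc (U : C * C -> Prop) (x0 z0 : C) :
  @open (prod_UniformSpace C_UniformSpace C_UniformSpace) U -> U (x0, z0) ->
  exists r, (0 < r)%R /\ forall x z, (Cmod (x - x0) < 3 * r)%R -> (Cmod (z - z0) < r)%R -> U (x, z).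
Proof.
  intros HU H0. destruct (HU _ H0) as [d Hd].
  exists (d / 3)%R. pose proof (cond_pos d). split; [lra|].
  assert (B : forall a b : C, (Cmod (b - a) < d)%R -> @ball C_UniformSpace a d b).
  { intros a b Hab. split.
    - eapply Rle_lt_trans; [|exact Hab]. apply (re_le_Cmod (b - a)).
    - eapply Rle_lt_trans; [|exact Hab]. apply (im_le_Cmod (b - a)). }
  intros x z Hx Hz. apply (Hd (x, z)). split; apply B; simpl; lra.
Qed.

Lemma locally_polydisc (x0 z0 : C) (r : R) : (0 < r)%R ->
  @locally (prod_UniformSpace C_UniformSpace C_UniformSpace) (x0, z0)
    (fun u => (Cmod (fst u - x0) < r)%R /\ (Cmod (snd u - z0) < r)%R).
Proof.
  intros Hr. apply filter_and.
  - apply (proj1 (continuous_C_iff (P := prod_UniformSpace C_UniformSpace C_UniformSpace) fst (x0,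
      z0)) (continuous_fst x0 z0) (mkposreal r Hr)).
  - apply (proj1 (continuous_C_iff (P := prod_UniformSpace C_UniformSpace C_UniformSpace) snd (x0,
      z0)) (continuous_snd x0 z0) (mkposreal r Hr)).
Qed.

(** Near each point F1 is the integral of F against conj circ / r over a fixed circle.
    Differentiating under that integral gives the derivative of F1 as an integral of F1, which is
    jointly continuous in both variables. *)
Lemma x_smooth_derivative (U : C * C -> Prop) (F F1 : C * C -> C) :
  x_smooth U F F1 -> exists F2, x_smooth U F1 F2.
Proof.
  intros HF.
  (* The radius of the circle depends on the point. A directional derivative defines F2 on all of U
     at once, and it agrees with each local integral. *)
  set (F2 := fun u : C * C => dir (X := C_R_NormedModule) (fun x => F1 (x, snd u)) (fst u) (RtoC
      1)).
  exists F2. pose proof HF as [Uopen HU]. split; auto.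
  intros x0 z0 H0. split; [apply (HU _ _ H0)|].
  destruct (open_polydisc U x0 z0 Uopen H0) as (r & Hr & disc).
  set (g := fun t => Cconj (circ t) / RtoC r).
  assert (Hg : forall t, contC g t).
  { intros t. apply continuous_Cmult; [|apply continuous_const]. apply continuous_Cconj,
      circ_continuous. }
  set (c := fun u : C * C => @RInt C_R_CompleteNormedModule (fun t => F1 (fst u + RtoC r * circ t,
      snd u) * g t) 0 1 : C).
  assert (D : forall x z, (Cmod (x - x0) < r)%R -> (Cmod (z - z0) < r)%R ->
     diffC (fun x => F1 (x, z)) (locally x) (fun v => c (x, z) * v)).
  { intros x z Hx Hz. apply (circle_diff U F F1 x0 z0 r HF Hr disc z g (fun x => F1 (x, z)) x Hg Hz
      Hx).
    intros x' Hx'. now apply (circle_derivative U F F1 x0 z0 r). }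
  assert (E : forall x z, (Cmod (x - x0) < r)%R -> (Cmod (z - z0) < r)%R -> F2 (x, z) = c (x, z)).
  { intros x z Hx Hz. unfold F2. simpl fst; simpl snd.
    rewrite (dir_filterdiff (X := C_R_NormedModule) _ _ _ _ (D x z Hx Hz)). apply Cmult_1_r. }
  assert (Z : forall y : C, (Cmod (y - y) < r)%R).
  { intros y. replace (y - y) with (RtoC 0) by ring. now rewrite Cmod_0. }
  split.
  - apply (continuous_ext_loc F2 c).
    + generalize (locally_polydisc x0 z0 r Hr). apply filter_imp. intros [x z] [Hx Hz]. symmetry.
        now apply E.
    + apply (param_continuous (P := prod_UniformSpace C_UniformSpace C_UniformSpace)
        (fun u t => F1 (fst u + RtoC r * circ t, snd u) * g t) c (x0, z0)).
      * intros t _. apply (circle_continuous_joint U x0 z0 r Hr disc F1 fst snd g (x0, z0) t); auto.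
        -- intros a b Hab; apply (HU a b Hab).
        -- apply continuous_fst.
        -- apply continuous_snd.
      * generalize (locally_polydisc x0 z0 r Hr). apply filter_imp. intros [x z] [Hx Hz].
        unfold c. apply is_RInt_C_continuous. intros t _. simpl fst in *; simpl snd in *.
        apply continuous_Cmult; auto.
        apply (continuous_ext (fun t => F1 (x + RtoC 1 * RtoC r * circ t, z))).
        -- intros s. now rewrite Cmult_1_l.
        -- apply (circle_continuous U x0 z0 r Hr disc); auto; [intros a b Hab; apply (HU a b
            Hab)|rewrite Rabs_R1; lra].
  - rewrite E by apply Z. apply D; apply Z.
Qed.

Lemma holomorphic2_x_smooth (U : CC2 -> Prop) (F : CC2 -> C) :
  holomorphic2 U F -> exists F1, x_smooth U F F1.
Proof.
  intros [HU (F1 & F2 & H)]. exists F1. split; [exact HU|].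
  intros x z Hxz. destruct (H (x, z) Hxz) as (C1 & C2 & D). split; [|split].
  - apply (filterdiff_continuous (K := C_AbsRing) (U := CC2) (V := C_NormedModule) F (x, z)).
      eexists. exact D.
  - exact C1.
  - split; [apply is_linear_Cmult|].
    intros y Hy. apply (is_filter_lim_locally_unique (V := C_R_NormedModule)) in Hy. subst y.
    intros eps.
    destruct D as [_ D]. specialize (D (x, z) (fun P HP => HP)).
    specialize (D eps).
    assert (L : filterlim (fun y : C => (y, z) : CC2) (@locally C_UniformSpace x) (@locally
        (prod_UniformSpace C_UniformSpace C_UniformSpace) (x, z))).
    { apply (continuous_comp_2 (V := C_UniformSpace) (W := C_UniformSpace) (fun y : C => y) (fun _
        => z) (fun a b => (a, b) : prod_UniformSpace C_UniformSpace C_UniformSpace)).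
      - apply continuous_id.
      - apply continuous_const.
      - apply (continuous_ext (fun u => u)); [now intros []|apply continuous_id]. }
    specialize (L _ D). revert L. unfold filtermap. apply filter_imp. intros y Hy. simpl in Hy.
    rewrite !norm_C.
    (* The norm on pairs is Euclidean; on the slice the second increment is zero, so the
       two-variable estimate becomes the one-variable estimate. *)
    change (Cmod (F (y, z) - F (x, z) - (F1 (x, z) * (y - x) + F2 (x, z) * (z - z))) <=
       eps * sqrt (Cmod (y - x) ^ 2 + Cmod (z - z) ^ 2))%R in Hy.
    replace (z - z) with (RtoC 0) in Hy by ring. rewrite Cmod_0, pow_i, Rplus_0_r, sqrt_pow2 in Hy
        by (lia || apply Cmod_ge_0).
    rewrite Cmult_0_r, Cplus_0_r in Hy. exact Hy.
Qed.

(** * Contour integrals *)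

Notation linXC := (@is_linear R_AbsRing X5 C_R_NormedModule).
Notation diffX := (@filterdiff R_AbsRing X5 C_R_NormedModule).

Lemma is_linear_Cplus {P : NormedModule R_AbsRing} (f g : P -> C) :
  @is_linear _ P C_R_NormedModule f -> @is_linear _ P C_R_NormedModule g ->
  @is_linear _ P C_R_NormedModule (fun v => f v + g v).
Proof.
  intros Hf Hg.
  exact (is_linear_comp (V := prod_NormedModule _ C_R_NormedModule C_R_NormedModule) (W :=
      C_R_NormedModule)
    (fun v => (f v, g v)) (fun u => plus (fst u) (snd u)) (is_linear_prod f g Hf Hg)
        is_linear_plus).
Qed.

Lemma is_linear_scale {P : NormedModule R_AbsRing} (c : C) (f : P -> C) :
  @is_linear _ P C_R_NormedModule f -> @is_linear _ P C_R_NormedModule (fun v => c * f v).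
Proof.
  intros Hf. exact (is_linear_comp (V := C_R_NormedModule) (W := C_R_NormedModule) f (fun w => c *
      w) Hf (is_linear_Cmult c)).
Qed.

Lemma is_linear_Cconj : @is_linear _ C_R_NormedModule C_R_NormedModule Cconj.
Proof.
  constructor.
  - intros a b. apply Cplus_conj.
  - intros r a. apply injective_projections; simpl; unfold scal; simpl; unfold mult; simpl; ring.
  - exists 1%R. split; [lra|]. intros a. rewrite !norm_C, Cmod_conj. lra.
Qed.

Lemma is_linear_RtoC : @is_linear _ R_NormedModule C_R_NormedModule RtoC.
Proof.
  constructor.
  - intros a b. apply RtoC_plus.
  - intros r a. apply injective_projections; simpl; unfold scal; simpl; unfold mult; simpl; ring.
  - exists 1%R. split; [lra|]. intros a. rewrite norm_C, Cmod_R. unfold norm; simpl; unfold abs;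
      simpl. lra.
Qed.

Lemma is_linear_xcoord (m : Z) : linXC (fun v => xcoord v m).
Proof.
  assert (F : @is_linear _ X5 C2 fst) by apply is_linear_fst.
  assert (F2 : linXC (fun v => fst (fst v))).
  { apply (is_linear_comp (V := C2) (W := C_R_NormedModule) fst fst F). apply is_linear_fst. }
  assert (F1 : linXC (fun v => snd (fst v))).
  { apply (is_linear_comp (V := C2) (W := C_R_NormedModule) fst snd F). apply is_linear_snd. }
  assert (F0 : linXC (fun v => RtoC (snd v))).
  { apply (is_linear_comp (V := R_NormedModule) (W := C_R_NormedModule) snd RtoC); [apply
      is_linear_snd|apply is_linear_RtoC]. }
  destruct m as [|[|[]|]|[|[]|]]; unfold xcoord; auto; try apply (is_linear_zero (U := X5) (V :=
      C_R_NormedModule)).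
  - exact (is_linear_comp (V := C_R_NormedModule) (W := C_R_NormedModule) _ Cconj F2
      is_linear_Cconj).
  - exact (is_linear_comp (V := C_R_NormedModule) (W := C_R_NormedModule) _ opp
     (is_linear_comp (V := C_R_NormedModule) (W := C_R_NormedModule) _ Cconj F1 is_linear_Cconj)
         is_linear_opp).
Qed.

Definition dx_form (a : Z -> C) (v : X5) : C := sum_sym 2 (fun m => a m * xcoord v m).

Lemma is_linear_dx_form (a : Z -> C) : linXC (dx_form a).
Proof.
  unfold dx_form.
  assert (T : forall m, linXC (fun v => a m * xcoord v m)) by (intros; apply is_linear_scale,
      is_linear_xcoord).
  apply (is_linear_Cplus (P := X5) (fun v => a (-2)%Z * xcoord v (-2))); auto.
  apply (is_linear_Cplus (P := X5) (fun v => a (-1)%Z * xcoord v (-1))); auto.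
  apply (is_linear_Cplus (P := X5) (fun v => a 0%Z * xcoord v 0)); auto.
  apply (is_linear_Cplus (P := X5) (fun v => a 1%Z * xcoord v 1)); auto.
  apply (is_linear_Cplus (P := X5) (fun v => a 2%Z * xcoord v 2)); auto.
  apply (is_linear_zero (U := X5) (V := C_R_NormedModule)).
Qed.

Lemma x_NS_dx_form (v : X5) (zeta : C) : x_NS v zeta = dx_form (fun m => Cpowz zeta (- m)) v.
Proof. unfold x_NS, dx_form. rewrite !sum_sym2. ring. Qed.

Lemma xcoord_continuous (m : Z) (y : X5) : contC (fun v : X5 => xcoord v m) y.
Proof.
  apply (filterdiff_continuous (K := R_AbsRing) (U := X5) (V := C_R_NormedModule) (fun v => xcoord
      v m) y).
  eexists. apply filterdiff_linear, is_linear_xcoord.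
Qed.

Lemma Cpowz_continuous (g : R -> C) (k : Z) (t : R) : (-2 <= k <= 2)%Z -> contC g t -> g t <> 0 ->
  contC (fun t => Cpowz (g t) k) t.
Proof.
  intros Hk Hg H0.
  assert (P1 : contC (fun t => g t ^ 1) t) by (apply continuous_Cmult; [exact Hg|apply
      continuous_const]).
  assert (P2 : contC (fun t => g t ^ 2) t) by (apply continuous_Cmult; [exact Hg|exact P1]).
  spin2 k; unfold Cpowz; simpl Pos.to_nat; auto.
  - apply (continuous_Cinv (fun t => g t ^ 2)); auto. now apply Cpow_nz.
  - apply (continuous_Cinv (fun t => g t ^ 1)); auto. now apply Cpow_nz.
  - apply continuous_const.
Qed.

Lemma Cpowz_add (z : C) (a b : Z) : z <> 0 -> (-2 <= a <= 2)%Z -> (-2 <= b <= 2)%Z ->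
  Cpowz z (a + b) = Cpowz z a * Cpowz z b.
Proof.
  intros Hz Ha Hb. spin2 a; spin2 b; unfold Cpowz; simpl Z.add; simpl Pos.to_nat; cbv iota; simpl;
      field; auto;
   repeat split; auto.
Qed.

Section Arc.
Variables (Omega : X5 -> Prop) (gamma : R -> C) (U : C * C -> Prop).
Hypothesis open_Omega : open Omega.
Hypothesis gamma_cont : forall t, (0 <= t <= 1)%R -> contC gamma t.
Hypothesis gamma_neq0 : forall t, (0 <= t <= 1)%R -> gamma t <> 0.
Hypothesis gamma_dom : forall y t, Omega y -> (0 <= t <= 1)%R -> U (x_NS y (gamma t), gamma t).

(** A class of integrals closed under differentiation: x_NS is linear in x_m with coefficient
    zeta^(-m), so the derivative in x_m replaces K by its x-derivative and the weight g by g
    zeta^(-m). *)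
Definition weighted (K : C * C -> C) (g : R -> C) (y : X5) : C :=
  @RInt C_R_CompleteNormedModule (fun t => K (x_NS y (gamma t), gamma t) * g t) 0 1.

Lemma x_NS_continuous (y : X5) (t : R) : (0 <= t <= 1)%R ->
  @continuous (prod_UniformSpace X5 R_UniformSpace) C_UniformSpace
    (fun u => x_NS (fst u) (gamma (snd u))) (y, t).
Proof.
  intros Ht. unfold x_NS.
  assert (T : forall m, (-2 <= m <= 2)%Z -> @continuous (prod_UniformSpace X5 R_UniformSpace)
      C_UniformSpace
     (fun u => xcoord (fst u) m * Cpowz (gamma (snd u)) (- m)) (y, t)).
  { intros m Hm. apply continuous_Cmult.
    - apply (continuous_comp (V := X5) fst (fun v => xcoord v m)); [apply continuous_fst|apply
        xcoord_continuous].
    - apply (continuous_comp (V := R_UniformSpace) snd (fun t => Cpowz (gamma t) (- m))); [apply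
        continuous_snd|].
      apply Cpowz_continuous; auto; lia. }
  pose proof (continuous_Cplus _ _ _ (T (-2)%Z ltac:(lia)) (continuous_Cplus _ _ _ (T (-1)%Z
      ltac:(lia))
    (continuous_Cplus _ _ _ (T 0%Z ltac:(lia)) (continuous_Cplus _ _ _ (T 1%Z ltac:(lia))
    (continuous_Cplus _ _ _ (T 2%Z ltac:(lia)) (continuous_const (RtoC 0) _)))))) as S.
  exact S.
Qed.

Lemma weighted_integrable (K : C * C -> C) (g : R -> C) (y : X5) :
  (forall x z, U (x, z) -> contCC K (x, z)) -> (forall t, (0 <= t <= 1)%R -> contC g t) -> Omega y
      ->
  is_RIntC (fun t => K (x_NS y (gamma t), gamma t) * g t) 0 1 (weighted K g y).
Proof.
  intros HK Hg Hy. apply is_RInt_C_continuous. intros t Ht. apply continuous_Cmult; auto.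
  apply continuous_pair2; auto.
  apply (continuous_comp_2 (V := X5) (W := R_UniformSpace) (fun _ : R => y) (fun t => t) (fun y t
      => x_NS y (gamma t)) t).
  - apply continuous_const.
  - apply continuous_id.
  - now apply x_NS_continuous.
Qed.

Lemma weighted_diff (K K1 : C * C -> C) (g : R -> C) (y : X5) :
  x_smooth U K K1 -> (forall t, (0 <= t <= 1)%R -> contC g t) -> Omega y ->
  diffX (weighted K g) (locally y) (dx_form (fun m => weighted K1 (fun t => g t * Cpowz (gamma t)
      (- m)) y)).
Proof.
  intros [_ HU] Hg Hy.
  (* The bound on the linear map v -> x_NS v must be uniform along the contour; it comes from the
     boundedness of the powers of gamma on [0,1], where gamma is continuous and does not vanish. *)
  assert (B : exists M, forall t v, (0 <= t <= 1)%R -> (Cmod (x_NS v (gamma t)) <= M * norm v)%R).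
  { assert (Bm : forall m, (-2 <= m <= 2)%Z -> exists M, forall t v, (0 <= t <= 1)%R ->
       (Cmod (xcoord v m * Cpowz (gamma t) (- m)) <= M * norm v)%R).
    { intros m Hm. destruct (is_linear_xcoord m) as [_ _ [M1 [HM1 Hn]]].
      destruct (bounded_continuity (V := C_R_NormedModule) (fun t => Cpowz (gamma t) (- m)) 0 1) as
          [M2 HM2].
      { intros t Ht. apply Cpowz_continuous; auto; lia. }
      exists (M1 * M2)%R. intros t v Ht. rewrite Cmod_mult.
      specialize (Hn v). rewrite norm_C in Hn. specialize (HM2 t Ht). rewrite norm_C in HM2.
      replace (M1 * M2 * norm v)%R with ((M1 * norm v) * M2)%R by ring.
      apply Rmult_le_compat; try apply Cmod_ge_0; lra. }
    destruct (Bm (-2)%Z ltac:(lia)) as [M1 B1]. destruct (Bm (-1)%Z ltac:(lia)) as [M2 B2].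
    destruct (Bm 0%Z ltac:(lia)) as [M3 B3]. destruct (Bm 1%Z ltac:(lia)) as [M4 B4].
    destruct (Bm 2%Z ltac:(lia)) as [M5 B5].
    exists (M1 + M2 + M3 + M4 + M5)%R. intros t v Ht.
    specialize (B1 t v Ht). specialize (B2 t v Ht). specialize (B3 t v Ht). specialize (B4 t v Ht).
        specialize (B5 t v Ht).
    unfold x_NS. rewrite sum_sym2, Cplus_0_r.
    eapply Rle_trans; [apply Cmod_triangle|]. rewrite !Rmult_plus_distr_r, !Rplus_assoc. apply
        Rplus_le_compat; auto.
    eapply Rle_trans; [apply Cmod_triangle|]. apply Rplus_le_compat; auto.
    eapply Rle_trans; [apply Cmod_triangle|]. apply Rplus_le_compat; auto.
    eapply Rle_trans; [apply Cmod_triangle|]. apply Rplus_le_compat; auto. }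
  destruct B as [M HM].
  apply (param_filterdiff (P := X5) Omega y
    (fun p t => K (x_NS p (gamma t), gamma t) * g t) (fun p t => K1 (x_NS p (gamma t), gamma t) * g
        t)
    (fun t v => x_NS v (gamma t)) M).
  - now apply open_Omega.
  - intros p t Hp Ht.
    assert (Lx : linXC (fun v => x_NS v (gamma t))).
    { generalize (is_linear_dx_form (fun m => Cpowz (gamma t) (- m))).
      intros [L1 L2 L3]. constructor; intros; try rewrite !x_NS_dx_form; auto.
      destruct L3 as [M3 L3]. exists M3. split; [apply L3|]. intros. rewrite x_NS_dx_form. apply
          L3. }
    pose proof (filterdiff_comp' (V := C_R_NormedModule) (W := C_R_NormedModule) (fun v : X5 =>
        x_NS v (gamma t)) (fun x => K (x, gamma t)) p _ _
      (filterdiff_linear _ Lx) (proj2 (proj2 (HU _ _ (gamma_dom p t Hp Ht))))) as D1.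
    pose proof (filterdiff_comp' (V := C_R_NormedModule) (W := C_R_NormedModule) _ (fun w => g t *
        w) p _ _ D1
       (filterdiff_linear _ (is_linear_Cmult (g t)))) as D2.
    apply (filterdiff_ext_lin (K := R_AbsRing) (U := X5) (V := C_R_NormedModule) _ (fun v : X5 => g
        t * (K1 (x_NS p (gamma t), gamma t) * x_NS v (gamma t)))).
    + apply (filterdiff_ext (K := R_AbsRing) (U := X5) (V := C_R_NormedModule) (fun y : X5 => g t *
        K (x_NS y (gamma t), gamma t))); [|exact D2].
      intros y'. apply Cmult_comm.
    + intros v. change (g t * (K1 (x_NS p (gamma t), gamma t) * x_NS v (gamma t)) = K1 (x_NS p
        (gamma t), gamma t) * g t * x_NS v (gamma t)). ring.
  - intros t Ht. apply continuous_Cmult.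
    + apply (continuous_pair2 K1 (fun u : X5 * R => x_NS (fst u) (gamma (snd u))) (fun u => gamma
        (snd u)) (y, t)).
      * apply HU. now apply gamma_dom.
      * now apply x_NS_continuous.
      * apply (continuous_comp (V := R_UniformSpace) snd gamma); [apply continuous_snd|now apply
          gamma_cont].
    + apply (continuous_comp (V := R_UniformSpace) snd g); [apply continuous_snd|now apply Hg].
  - exact HM.
  - apply is_linear_dx_form.
  - intros v.
    assert (T : forall m, (-2 <= m <= 2)%Z -> is_RIntC (fun t => xcoord v m * (K1 (x_NS y (gamma
        t), gamma t) * (g t * Cpowz (gamma t) (- m)))) 0 1
        (xcoord v m * weighted K1 (fun t => g t * Cpowz (gamma t) (- m)) y)).
    { intros m Hm. apply is_RInt_Cmult, weighted_integrable; auto.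
      - intros a b Hab; apply (HU a b Hab).
      - intros t Ht. apply continuous_Cmult; auto. apply Cpowz_continuous; auto; lia. }
    pose proof (fun f l g m A B => is_RInt_plus (V := C_R_NormedModule) f g 0 1 l m A B) as P.
    pose proof (P _ _ _ _ (P _ _ _ _ (P _ _ _ _ (P _ _ _ _ (T (-2)%Z ltac:(lia)) (T (-1)%Z
        ltac:(lia))) (T 0%Z ltac:(lia))) (T 1%Z ltac:(lia))) (T 2%Z ltac:(lia))) as S.
    match type of S with @is_RInt _ ?f _ _ ?l => assert (El : l = dx_form (fun m => weighted K1
        (fun t => g t * Cpowz (gamma t) (- m)) y) v) end.
    { unfold dx_form. rewrite sum_sym2. unfold plus; simpl. unfold prod_plus; simpl.
      apply injective_projections; simpl; unfold plus; simpl; ring. }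
    rewrite <- El.
    apply (is_RInt_ext (V := C_R_NormedModule) _ _ _ _ _) with (2 := S).
    intros t _. rewrite (x_NS_dx_form v). unfold dx_form. rewrite sum_sym2.
    match goal with |- ?a = ?b => transitivity (xcoord v (-2) * (K1 (x_NS y (gamma t), gamma t) *
        (g t * Cpowz (gamma t) (- -2))) +
      xcoord v (-1) * (K1 (x_NS y (gamma t), gamma t) * (g t * Cpowz (gamma t) (- -1))) +
      xcoord v 0 * (K1 (x_NS y (gamma t), gamma t) * (g t * Cpowz (gamma t) (- 0))) +
      xcoord v 1 * (K1 (x_NS y (gamma t), gamma t) * (g t * Cpowz (gamma t) (- 1))) +
      xcoord v 2 * (K1 (x_NS y (gamma t), gamma t) * (g t * Cpowz (gamma t) (- 2))));
          [reflexivity|] end.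
    match goal with |- ?a = ?b => change (@eq C a b) end. cbn [Z.opp]. ring.
  - intros p Hp. apply weighted_integrable; auto. intros a b Hab; apply (HU a b Hab).
Qed.
End Arc.

(* [G m] and [H (m + m')] stand for f_{x_m} and f_{x_m x_m'}. *)
Definition hankel (Omega : X5 -> Prop) (f : X5 -> C) : Prop :=
  exists G H : Z -> X5 -> C, forall y, Omega y ->
    diffX f (locally y) (dx_form (fun m => G m y)) /\
    forall m, (-2 <= m <= 2)%Z -> diffX (G m) (locally y) (dx_form (fun m' => H (m + m')%Z y)).

Lemma filterdiff_dx_ext (f : X5 -> C) (y : X5) (a b : Z -> C) :
  (forall m, (-2 <= m <= 2)%Z -> a m = b m) ->
  diffX f (locally y) (dx_form a) -> diffX f (locally y) (dx_form b).
Proof.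
  intros E H. apply (filterdiff_ext_lin (K := R_AbsRing) (U := X5) (V := C_R_NormedModule) _
      (dx_form a)); auto.
  intros v. unfold dx_form. rewrite !sum_sym2. now rewrite !E by lia.
Qed.

Lemma filterdiff_dx_plus (f g : X5 -> C) (y : X5) (a b : Z -> C) :
  diffX f (locally y) (dx_form a) -> diffX g (locally y) (dx_form b) ->
  diffX (fun y => f y + g y) (locally y) (dx_form (fun m => a m + b m)).
Proof.
  intros Hf Hg.
  pose proof (filterdiff_plus_fct (K := R_AbsRing) (V := C_R_NormedModule) f g _ _ Hf Hg) as D.
  apply (filterdiff_ext_lin (K := R_AbsRing) (U := X5) (V := C_R_NormedModule) _ _ _ D).
  intros v. change (dx_form a v + dx_form b v = dx_form (fun m => a m + b m) v).
  unfold dx_form. rewrite !sum_sym2. ring.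
Qed.

Lemma hankel_plus (Omega : X5 -> Prop) (f g : X5 -> C) :
  hankel Omega f -> hankel Omega g -> hankel Omega (fun y => f y + g y).
Proof.
  intros (G & H & Hf) (G' & H' & Hg).
  exists (fun m y => G m y + G' m y), (fun m y => H m y + H' m y). intros y Hy.
  destruct (Hf y Hy) as [F1 F2], (Hg y Hy) as [G1 G2]. split.
  - now apply filterdiff_dx_plus.
  - intros m Hm. apply (filterdiff_dx_plus _ _ _ (fun m' => H (m + m')%Z y)); auto.
Qed.

Lemma hankel_zero (Omega : X5 -> Prop) : hankel Omega (fun _ => 0).
Proof.
  assert (D : forall y, diffX (fun _ => RtoC 0) (locally y) (dx_form (fun _ => 0))).
  { intros y. apply (filterdiff_ext_lin (K := R_AbsRing) (U := X5) (V := C_R_NormedModule) _ (fun _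
      => RtoC 0)).
    - apply (filterdiff_const (K := R_AbsRing) (V := C_R_NormedModule) (RtoC 0)).
    - intros v. change (RtoC 0 = dx_form (fun _ => 0) v). unfold dx_form. rewrite sum_sym2. ring. }
  exists (fun _ _ => 0), (fun _ _ => 0). split; auto.
Qed.

(** Two differentiations multiply the weight by zeta^(-m) zeta^(-m') = zeta^(-(m+m')), so the second
    derivative depends on m + m' only. *)
Lemma hankel_arc (Omega : X5 -> Prop) (a : arc) :
  open Omega -> arc_ok Omega a -> hankel Omega (arc_integral a).
Proof.
  intros HO (Hd & Hv & Hhol & H0 & Hdom).
  destruct (holomorphic2_x_smooth _ _ Hhol) as [F1 S1].
  destruct (x_smooth_derivative _ _ _ S1) as [F2 S2].
  pose proof two_pi_i_neq0 as Pi0.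
  assert (Cp : forall t, contC (path a) t).
  { intros t. apply (ex_derive_continuous (V := C_R_NormedModule) (path a)). eexists. apply Hd. }
  set (g := fun t => velocity a t / (2 * RtoC PI * Ci * path a t)).
  assert (Cg : forall t, (0 <= t <= 1)%R -> contC g t).
  { intros t Ht. apply continuous_Cmult; [apply Hv|]. apply (continuous_Cinv (fun t => 2 * RtoC PI
      * Ci * path a t)).
    - apply continuous_scale, Cp.
    - apply Cmult_neq_0; auto. }
  set (gm := fun m t => g t * Cpowz (path a t) (- m)).
  assert (Cgm : forall m t, (-2 <= m <= 2)%Z -> (0 <= t <= 1)%R -> contC (gm m) t).
  { intros m t Hm Ht. apply continuous_Cmult; auto. apply Cpowz_continuous; auto; lia. }
  exists (fun m => weighted (path a) F1 (gm m)), (fun k => weighted (path a) F2 (gm k)).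
  intros y Hy. split.
  - apply (filterdiff_ext (K := R_AbsRing) (U := X5) (V := C_R_NormedModule) (weighted (path a)
      (branch a) g)).
    + intros y'. unfold weighted, arc_integral.
      apply (RInt_ext (V := C_R_CompleteNormedModule)). intros t _. unfold g, Cdiv.
      match goal with |- ?a = ?b => change (@eq C a b) end. ring.
    + apply (weighted_diff Omega (path a) (branch_dom a)); auto.
  - intros m Hm. eapply filterdiff_dx_ext; [|apply (weighted_diff Omega (path a) (branch_dom a) HO
      (fun t _ => Cp t) H0 Hdom F1 F2 (gm m)); auto].
    intros m' Hm'. cbv beta. unfold weighted. apply (RInt_ext (V := C_R_CompleteNormedModule)).
    rewrite Rmin_left, Rmax_right by lra. intros t Ht. unfold gm.
    replace (- (m + m'))%Z with (- m + - m')%Z by lia.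
    rewrite Cpowz_add by (try apply H0; lia || lra).
    match goal with |- ?a = ?b => change (@eq C a b) end. ring.
Qed.

Lemma hankel_ext (Omega : X5 -> Prop) (f g : X5 -> C) : open Omega ->
  (forall y, Omega y -> f y = g y) -> hankel Omega f -> hankel Omega g.
Proof.
  intros HO E (G & H & Hf). exists G, H. intros y Hy. destruct (Hf y Hy) as [F1 F2]. split; auto.
  apply (filterdiff_ext_locally (K := R_AbsRing) (U := X5) (V := C_R_NormedModule) f); auto.
  generalize (HO y Hy). apply filter_imp. exact E.
Qed.

Lemma hankel_potential (Omega : X5 -> Prop) (L : X5 -> R) :
  open Omega -> contour_potential Omega L -> hankel Omega (Lc L).
Proof.
  intros HO (loops & Hloops & HL).
  apply (hankel_ext Omega (contour_integral loops)); auto.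
  { intros y Hy. symmetry. now apply HL. }
  assert (Hall : forall a, In a (concat loops) -> arc_ok Omega a).
  { intros a Ha. apply in_concat in Ha as (l & Hl & Ha).
    rewrite Forall_forall in Hloops. specialize (Hloops l Hl).
    destruct (In_nth_error l a Ha) as [i Hi].
    (* [closed_loop] yields [arc_ok] for an arc paired with its successor, so the cyclic successor
       index must be shown to be in range. *)
    assert (Hlen : (S i mod length l < length l)%nat).
    { apply Nat.mod_upper_bound. destruct l; [destruct Ha|discriminate]. }
    destruct (nth_error l (S i mod length l)) as [b|] eqn:Hb.
    - now destruct (Hloops i a b Hi Hb).
    - apply nth_error_None in Hb. lia. }
  unfold contour_integral. induction (concat loops) as [|a l IH]; simpl.
  - apply hankel_zero.
  - apply hankel_plus.
    + apply hankel_arc; auto. apply Hall. now left.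
    + apply IH. intros b Hb. apply Hall. now right.
Qed.

Lemma partialx_dx_form (f : X5 -> C) (y : X5) (a : Z -> C) (m : Z) : (-2 <= m <= 2)%Z ->
  diffX f (locally y) (dx_form a) -> partialx m f y = a m.
Proof.
  intros Hm H.
  assert (D : forall v, dir f y v = dx_form a v) by (intros; now apply dir_filterdiff).
  pose proof Ci_conj as Hi.
  spin2 m; unfold partialx; rewrite !D; unfold dx_form; rewrite !sum_sym2; unfold xcoord, mkX;
      simpl fst; simpl snd;
   rewrite ?Hi, ?RtoC_conj; try (field [Ci_sqr]; cbv beta; apply RtoC_neq; lra); ring.
Qed.

(** * Common zeros of real linear forms *)

(** Gaussian elimination by induction on the number of equations. A nonzero entry of the last column
    serves as pivot, [s] enumerates the other rows, and t is the last unknown solved from the pivot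
    row. If the last column vanishes, the last basis vector is a solution. *)
Lemma nontrivial_kernel (n : nat) : forall f : nat -> nat -> R,
  exists c : nat -> R, (exists j, (j <= n)%nat /\ c j <> 0%R) /\
    forall i, (i < n)%nat -> sum_f_R0 (fun j => f i j * c j)%R n = 0%R.
Proof.
  induction n as [|n IH]; intros f.
  { exists (fun _ => 1%R). split; [exists 0%nat; split; [lia|lra]|lia]. }
  destruct (classic (exists i0, (i0 < S n)%nat /\ f i0 (S n) <> 0%R)) as [(i0 & Hi0 & Hf)|Hf].
  - set (s := fun i => if Nat.ltb i i0 then i else S i).
    destruct (IH (fun i j => f (s i) j - f (s i) (S n) / f i0 (S n) * f i0 j)%R) as (c & (j & Hj &
        Hc) & Hk).
    set (t := (- sum_f_R0 (fun j => f i0 j * c j) n / f i0 (S n))%R).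
    set (c' := fun j => if Nat.ltb n j then t else c j).
    assert (E : forall i, sum_f_R0 (fun j => f i j * c' j)%R (S n) =
       (sum_f_R0 (fun j => f i j * c j) n + f i (S n) * t)%R).
    { intros i. simpl. f_equal.
      - apply sum_eq. intros k Hk'. unfold c'. now rewrite (proj2 (Nat.ltb_ge n k)) by lia.
      - unfold c'. now rewrite (proj2 (Nat.ltb_lt n (S n))) by lia. }
    exists c'. split.
    + exists j. split; [lia|]. unfold c'. now rewrite (proj2 (Nat.ltb_ge n j)) by lia.
    + intros i Hi. rewrite E. destruct (Nat.eq_dec i i0) as [->|Hne].
      * unfold t. field. exact Hf.
      * assert (exists i', (i' < n)%nat /\ s i' = i) as (i' & Hi' & <-).
        { destruct (Nat.ltb_spec i i0).
          - exists i. split; [lia|]. unfold s. now rewrite (proj2 (Nat.ltb_lt _ _)).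
          - exists (pred i). split; [lia|]. unfold s. rewrite (proj2 (Nat.ltb_ge _ _)); lia. }
        rewrite <- (Hk i' Hi'). unfold t.
        rewrite (sum_eq (fun j0 => (f (s i') j0 - f (s i') (S n) / f i0 (S n) * f i0 j0) * c j0)%R
          (fun j0 => f (s i') j0 * c j0 - (f i0 j0 * c j0) * (f (s i') (S n) / f i0 (S n)))%R) by
              (intros; ring).
        rewrite minus_sum, <- scal_sum. field. exact Hf.
  - exists (fun j => if Nat.eqb j (S n) then 1%R else 0%R). split.
    + exists (S n). rewrite Nat.eqb_refl. split; [lia|lra].
    + intros i Hi. simpl. rewrite Nat.eqb_refl.
      assert (f i (S n) = 0%R) as ->.
      { apply NNPP. intros Hne. apply Hf. now exists i. }
      rewrite (sum_eq _ (fun _ => 0%R)).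
      * rewrite sum_cte. ring.
      * intros j Hj. rewrite (proj2 (Nat.eqb_neq j (S n))) by lia. ring.
Qed.

Definition R_linear (f : C2 -> R) : Prop :=
  (forall xi eta : C2, f (plus xi eta) = (f xi + f eta)%R) /\
  (forall (r : R) (xi : C2), f (scal r xi) = (r * f xi)%R).

Lemma three_forms_kernel (f g h : C2 -> R) : R_linear f -> R_linear g -> R_linear h ->
  exists xi : C2, xi <> zero /\ f xi = 0%R /\ g xi = 0%R /\ h xi = 0%R.
Proof.
  intros Hf Hg Hh.
  set (e := fun j : nat => match j with O => unitw 0 1 | 1%nat => unitw 0 Ci | 2%nat => unitw 1 1 |
      _ => unitw 1 Ci end).
  set (F := fun i : nat => match i with O => f | 1%nat => g | _ => h end).
  destruct (nontrivial_kernel 3 (fun i j => F i (e j))) as (c & (j & Hj & Hc) & Hk).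
  set (xi := ((c 0%nat, c 1%nat), (c 2%nat, c 3%nat)) : C2).
  assert (E : forall k, R_linear k -> k xi = sum_f_R0 (fun j => k (e j) * c j)%R 3).
  { intros k [Ha Hs].
    assert (X : xi = plus (plus (plus (scal (c 0%nat) (e 0%nat)) (scal (c 1%nat) (e 1%nat))) (scal
        (c 2%nat) (e 2%nat))) (scal (c 3%nat) (e 3%nat))).
    { unfold xi, e, unitw, Ci, RtoC. repeat (apply injective_projections; simpl); unfold plus,
        scal; simpl; unfold mult; simpl; ring. }
    rewrite X, !Ha, !Hs. simpl. ring. }
  exists xi. split.
  - intros X. injection X as X0 X1 X2 X3.
    destruct j as [|[|[|[|]]]]; try lia; contradiction.
  - rewrite !E by auto. repeat split; [apply (Hk 0%nat)|apply (Hk 1%nat)|apply (Hk 2%nat)]; lia.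
Qed.

Lemma dirR_linear (f : C2 -> R) (p : C2) : differentiableR f p -> R_linear (dirR f p).
Proof.
  intros [lf H].
  assert (E : forall v, dirR f p v = lf v).
  { intros v. apply is_derive_unique. apply (filterdiff_line (Y := R_NormedModule) f p v lf H). }
  destruct H as [[L1 L2 _] _]. split; intros; rewrite !E; auto.
Qed.

Lemma sigma_linear (q : C2 -> quat) (p : C2) :
  differentiableR (fun p => q0 (q p)) p -> differentiableR (fun p => q1 (q p)) p ->
  differentiableR (fun p => q2 (q p)) p -> differentiableR (fun p => q3 (q p)) p ->
  R_linear (fun xi => q1 (sigma q p xi)) /\ R_linear (fun xi => q2 (sigma q p xi)) /\
  R_linear (fun xi => q3 (sigma q p xi)).
Proof.
  intros D0 D1 D2 D3.
  apply dirR_linear in D0 as [A0 S0], D1 as [A1 S1], D2 as [A2 S2], D3 as [A3 S3].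
  unfold R_linear, sigma, dquat, qmul; cbn [q0 q1 q2 q3].
  repeat apply conj; intros; rewrite ?A0, ?A1, ?A2, ?A3, ?S0, ?S1, ?S2, ?S3; ring.
Qed.

(** * The Legendre transform *)

Lemma dir_real {X : NormedModule R_AbsRing} (f : X -> R) (y v : X) :
  dir (fun y => RtoC (f y)) y v = RtoC (dirR f y v).
Proof. unfold dir, dirR, RtoC. simpl. f_equal. apply Derive_const. Qed.

Lemma partialx_real (f : X5 -> R) (y : X5) :
  real_spin (fun m => Cconj (partialx m (Lc f) y)).
Proof.
  unfold real_spin, partialx, Lc. rewrite !dir_real.
  assert (N2 : RtoC 2 <> 0) by (apply RtoC_neq; lra).
  unfold Cdiv. push_conj. rewrite !Cinv_conj, !Ci_conj by easy. push_conj.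
  repeat split; auto; field; easy.
Qed.

(** L_{x_0} is itself a real function, so [partialx_real] applies to it. *)
Lemma h_real (L : X5 -> R) (y : X5) : real_spin (h L y).
Proof.
  assert (E : forall m, h L y m = Cconj (partialx m (Lc (fun y => dirR L y (mkX 0 0 1))) y)).
  { intros m. unfold h. f_equal.
    assert (D : forall v, dir (partialx 0 (Lc L)) y v = dir (Lc (fun y => dirR L y (mkX 0 0 1))) y
        v).
    { intros v. apply dir_ext_loc. apply filter_forall. intros y'. apply dir_real. }
    unfold partialx. now rewrite !D. }
  unfold real_spin. rewrite !E. apply partialx_real.
Qed.

Lemma hring_real (L : X5 -> R) (y : X5) (q : quat) : q <> quat0 -> real_spin (hring L y q).
Proof.
  intros Hq.
  assert (N : RtoC (qnorm2 q) <> 0) by (apply RtoC_neq, Rgt_not_eq, qnorm2_pos, Hq).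
  destruct (real_spin_conj _ (h_real L y)) as (A2 & A1 & A0 & B1 & B2).
  assert (E : forall m, (-2 <= m <= 2)%Z -> hring L y q m = Cconj (Cconj (hring L y q m))) by
      (intros; now rewrite Cconj_conj).
  assert (Hn : Cconj (RtoC (qnorm2 q)) = RtoC (qnorm2 q)) by apply RtoC_conj.
  assert (Hi : Cconj (/ RtoC (qnorm2 q) ^ 2) = / RtoC (qnorm2 q) ^ 2).
  { rewrite Cinv_conj by now apply Cpow_nz. now rewrite Cpow_conj, Hn. }
  unfold real_spin. rewrite (E (-2)%Z), (E (-1)%Z), (E 0%Z), !hring_rotate by (easy || lia).
  expand. rewrite A2, A1, A0, B1, B2. unfold Cdiv. push_conj. rewrite Hi. push_conj. rewrite A2,
      A1, A0, B1, B2.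
  repeat split; ring.
Qed.

Section Main.
Variables (Omega : X5 -> Prop) (L : X5 -> R) (V : C2 -> Prop) (x : C2 -> X5).
Hypothesis open_Omega : open Omega.
Hypothesis open_V : open V.
Hypothesis x_solution : legendre_solution Omega L V x.
Variables (G H : Z -> X5 -> C).
Hypothesis LG : forall y, Omega y -> diffX (Lc L) (locally y) (dx_form (fun m => G m y)).
Hypothesis GH : forall y m, Omega y -> (-2 <= m <= 2)%Z ->
   diffX (G m) (locally y) (dx_form (fun m' => H (m + m')%Z y)).

Lemma partial_L (y : X5) (m : Z) : Omega y -> (-2 <= m <= 2)%Z -> partialx m (Lc L) y = G m y.
Proof. intros Hy Hm. apply (partialx_dx_form (Lc L) y (fun m => G m y)); auto. Qed.

Lemma hess_L (y : X5) (m : Z) : Omega y -> (-2 <= m <= 2)%Z -> H m y = Cconj (h L y m).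
Proof.
  intros Hy Hm. unfold h. rewrite Cconj_conj. symmetry.
  apply (partialx_dx_form (partialx 0 (Lc L)) y (fun m => H m y)); auto.
  apply (filterdiff_ext_locally (K := R_AbsRing) (U := X5) (V := C_R_NormedModule) (G 0%Z)).
  - generalize (open_Omega y Hy). apply filter_imp. intros y' Hy'. symmetry. apply partial_L; auto;
      lia.
  - intros. apply (GH y 0%Z); auto; lia.
Qed.

Lemma G_conj (y : X5) : Omega y -> G (-1)%Z y = - Cconj (G 1%Z y) /\ G (-2)%Z y = Cconj (G 2%Z y).
Proof.
  intros Hy. rewrite <- !partial_L by (auto; lia).
  destruct (partialx_real L y) as (P2 & P1 & _). split.
  - apply (f_equal Cconj) in P1. rewrite Copp_conj, !Cconj_conj in P1. exact P1.
  - apply (f_equal Cconj) in P2. rewrite !Cconj_conj in P2. exact P2.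
Qed.

Lemma G_legendre (p : C2) : V p ->
  G 1%Z (x p) = - Ci * snd p /\ G 0%Z (x p) = 0 /\ G (-1)%Z (x p) = - Ci * Cconj (snd p).
Proof.
  intros Hp. destruct (x_solution p Hp) as (Hy & _ & _ & E1 & E0).
  rewrite partial_L in E1, E0 by (auto; lia). split; [|split]; auto.
  rewrite (proj1 (G_conj _ Hy)), E1. push_conj. rewrite Ci_conj. ring.
Qed.

Section Point.
Variables (p : C2) (lx : C2 -> X5).
Hypothesis Vp : V p.
Hypothesis Dx : @filterdiff R_AbsRing C2 X5 x (locally p) lx.

Let y := x p.
Let Hk (k : Z) := H k y.
Definition dx (xi : C2) (m : Z) : C := xcoord (lx xi) m.

Lemma Omega_y : Omega y.
Proof. apply (x_solution p Vp). Qed.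

Lemma x_jet (m : Z) (xi : C2) : jet (fun t : R => xcoord (x (plus p (scal t xi))) m) (xcoord y m)
    (dx xi m).
Proof.
  apply (jet_filterdiff (X := C2) (fun p => xcoord (x p) m) p xi (fun xi => dx xi m)).
  apply (filterdiff_comp' (V := X5) (W := C_R_NormedModule) x (fun v => xcoord v m) p lx (fun v =>
      xcoord v m)); auto.
  apply filterdiff_linear, is_linear_xcoord.
Qed.

Lemma G_jet (m : Z) (xi : C2) : (-2 <= m <= 2)%Z ->
  jet (fun t : R => G m (x (plus p (scal t xi)))) (G m y) (contract Hk m (dx xi)).
Proof.
  intros Hm.
  apply (jet_filterdiff (X := C2) (fun p => G m (x p)) p xi (fun xi => contract Hk m (dx xi))).
  apply (filterdiff_comp' (V := X5) (W := C_R_NormedModule) x (G m) p lx (dx_form (fun m' => H (m +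
      m')%Z y))); auto.
  apply GH; auto. apply Omega_y.
Qed.

Lemma L_jet (xi : C2) :
  jet (fun t : R => Lc L (x (plus p (scal t xi)))) (Lc L y) (dx_form (fun m => G m y) (lx xi)).
Proof.
  apply (jet_filterdiff (X := C2) (fun p => Lc L (x p)) p xi (fun xi => dx_form (fun m => G m y)
      (lx xi))).
  apply (filterdiff_comp' (V := X5) (W := C_R_NormedModule) x (Lc L) p lx (dx_form (fun m => G m
      y))); auto.
  apply LG, Omega_y.
Qed.

Lemma coord_jet (xi : C2) :
  jet (fun t : R => fst (plus p (scal t xi))) (fst p) (fst xi) /\
  jet (fun t : R => snd (plus p (scal t xi))) (snd p) (snd xi).
Proof.
  split.
  - apply (jet_filterdiff (X := C2) fst p xi fst). apply filterdiff_linear, is_linear_fst.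
  - apply (jet_filterdiff (X := C2) snd p xi snd). apply filterdiff_linear, is_linear_snd.
Qed.

Lemma V_line (xi : C2) : locally 0%R (fun t : R => V (plus p (scal t xi))).
Proof. now apply line_locally, open_V. Qed.

Lemma dx_real (xi : C2) : real_spin (dx xi).
Proof.
  unfold real_spin, dx, xcoord. split; [|split]; auto. now rewrite RtoC_conj.
Qed.

Lemma dx_2 (xi : C2) : dx xi 2%Z = fst xi.
Proof.
  eapply jet_unique; [apply (x_jet 2%Z xi)|]. apply (jet_ext_loc (fun t : R => fst (plus p (scal t
      xi))) _ (fst p)).
  - generalize (V_line xi). apply filter_imp. intros t Ht. symmetry. apply (x_solution _ Ht).
  - apply coord_jet.
Qed.

Lemma contract_eqs (xi : C2) :
  contract Hk 1 (dx xi) = - Ci * snd xi /\ contract Hk 0 (dx xi) = 0 /\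
  contract Hk (-1) (dx xi) = - Ci * Cconj (snd xi).
Proof.
  destruct (coord_jet xi) as [_ Ju].
  assert (T : forall m (f : R -> C) a l, (-2 <= m <= 2)%Z -> (forall t, V (plus p (scal t xi)) -> f
      t = G m (x (plus p (scal t xi)))) ->
    jet f a l -> contract Hk m (dx xi) = l).
  { intros m f a l Hm E J. apply (jet_unique _ _ _ _ _ (G_jet m xi Hm) (jet_ext_loc f _ a l
      (filter_imp _ _ E (V_line xi)) J)). }
  split; [|split].
  - eapply eq_trans; [eapply (T 1%Z (fun t : R => - Ci * snd (plus p (scal t xi)))); [lia|
      |jet]|ring].
    intros t Ht. symmetry. apply (G_legendre _ Ht).
  - apply (T 0%Z (fun _ => RtoC 0) (RtoC 0) (RtoC 0)); [lia| |jet].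
    intros t Ht. symmetry. apply (G_legendre _ Ht).
  - eapply eq_trans; [eapply (T (-1)%Z (fun t : R => - Ci * Cconj (snd (plus p (scal t xi)))));
      [lia| |jet]|ring].
    intros t Ht. symmetry. apply (G_legendre _ Ht).
Qed.

(** The envelope principle: the terms in dx_1, dx_0 and dx_{-1} cancel because kappa is extremal in
    these variables. *)
Lemma kappa_dir (xi : C2) : dir (kappa L x) p xi =
  G 2%Z y * fst xi + G (-2)%Z y * Cconj (fst xi)
  + Ci * xcoord y 1 * snd xi - Ci * Cconj (xcoord y 1) * Cconj (snd xi).
Proof.
  destruct (coord_jet xi) as [_ Ju]. pose proof (x_jet 1%Z xi) as J1. pose proof (L_jet xi) as JL.
  eapply eq_trans.
  - eapply (dir_jet (kappa L x) p xi). unfold kappa. jet.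
  - destruct (G_legendre p Vp) as (E1 & E0 & E1'). fold y in E1, E0, E1'.
    unfold dx_form. rewrite sum_sym2, E1, E0, E1'. fold (dx xi).
    change (xcoord (lx xi) 2) with (dx xi 2). change (xcoord (lx xi) (-2)) with (dx xi (-2)).
    change (xcoord (lx xi) (-1)) with (dx xi (-1)). change (xcoord (lx xi) 1) with (dx xi 1).
    change (xcoord (lx xi) 0) with (dx xi 0).
    destruct (dx_real xi) as (R2 & R1 & _). rewrite R2, R1, dx_2. push_conj. ring.
Qed.
End Point.

Lemma kappa_dbar (p : C2) : V p ->
  d_wbar 0 (kappa L x) p = G (-2)%Z (x p) /\
  d_wbar 1 (kappa L x) p = - Ci * Cconj (xcoord (x p) 1).
Proof.
  intros Hp. destruct (x_solution p Hp) as (_ & [lx Dx] & _).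
  unfold d_wbar. rewrite !(kappa_dir p lx Hp Dx). unfold unitw; simpl fst; simpl snd.
  rewrite !Ci_conj, !RtoC_conj.
  split; field [Ci_sqr]; cbv beta; apply RtoC_neq; lra.
Qed.

(* The differentials of the components L_{x_{-2}} and -i conj x_1 of (d kappa)^{0,1}. *)
Definition dkappa_bar (lx : C2 -> X5) (p : C2) (b : nat) : covector :=
  fun xi => match b with
    | O => contract (fun k => H k (x p)) (-2) (dx lx xi)
    | _ => Ci * dx lx xi (-1)
  end.

Lemma kappa_hess_eq (p : C2) (lx : C2 -> X5) (a b : nat) : V p -> (b < 2)%nat ->
  @filterdiff R_AbsRing C2 X5 x (locally p) lx ->
  kappa_hess L x p a b = wirtinger_hess (dkappa_bar lx p) a b.
Proof.
  intros Hp Hb Dx. unfold kappa_hess, d_w, wirtinger_hess.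
  assert (E : forall xi, dir (d_wbar b (kappa L x)) p xi = dkappa_bar lx p b xi).
  { intros xi. destruct b as [|[|]]; [| |lia].
    - rewrite (dir_ext_loc _ (fun p => G (-2)%Z (x p))).
      + apply (dir_jet (fun p => G (-2)%Z (x p)) p xi _ _ (G_jet p lx Hp Dx (-2)%Z xi ltac:(lia))).
      + generalize (open_V p Hp). apply filter_imp. intros p' Hp'. apply (kappa_dbar p' Hp').
    - rewrite (dir_ext_loc _ (fun p => - Ci * Cconj (xcoord (x p) 1))).
      + pose proof (x_jet p lx Dx 1%Z xi) as J1. eapply eq_trans.
        * eapply (dir_jet (fun p => - Ci * Cconj (xcoord (x p) 1)) p xi). jet.
        * unfold dkappa_bar. destruct (dx_real lx xi) as (_ & R1 & _). rewrite R1. ring.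
      + generalize (open_V p Hp). apply filter_imp. intros p' Hp'. apply (kappa_dbar p' Hp'). }
  now rewrite !E.
Qed.

Lemma dx_linear (lx : C2 -> X5) (m : Z) : @is_linear R_AbsRing C2 X5 lx -> real_linear (fun xi =>
    dx lx xi m).
Proof.
  intros [L1 L2 _]. destruct (is_linear_xcoord m) as [X1 X2 _]. unfold dx. split.
  - intros xi eta. rewrite L1. apply X1.
  - intros r xi. rewrite L2, X2. apply injective_projections; simpl; unfold scal; simpl; unfold
      mult; simpl; ring.
Qed.

Lemma dkappa_bar_linear (lx : C2 -> X5) (p : C2) (b : nat) : @is_linear R_AbsRing C2 X5 lx ->
  real_linear (dkappa_bar lx p b).
Proof.
  intros Hl. pose proof (fun m => dx_linear lx m Hl) as D. unfold dkappa_bar. destruct b.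
  - unfold contract. split; intros; rewrite !sum_sym2.
    + rewrite !(proj1 (D _)). ring.
    + rewrite !(proj2 (D _)). ring.
  - split; intros; [rewrite (proj1 (D _))|rewrite (proj2 (D _))]; ring.
Qed.

(** On the constraint dL_{x_0} vanishes, so only the terms of [cov] with coefficient 4 survive. For
    m = 1 they give 4 (-i du) /\ dz. For m = 0 they give dL_{x_{-2}} /\ conj dz and dL_{x_{-1}} /\
    dx_{-1} = (i dx_{-1}) /\ conj du, the two terms of the differential of (d kappa)^{0,1}. *)
Lemma omega_cov (p : C2) (lx : C2 -> X5) (xi eta : C2) : V p ->
  @filterdiff R_AbsRing C2 X5 x (locally p) lx ->
  wedge (dw 1) (dw 0) xi eta = Ci / 4 * cov (fun k => H k (x p)) (dx lx xi) (dx lx eta) 1 /\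
  sum_lt 2 (fun b => wedge (dkappa_bar lx p b) (bar (dw b)) xi eta) =
    - (/ 4 * cov (fun k => H k (x p)) (dx lx xi) (dx lx eta) 0) /\
  - Cconj (wedge (dw 1) (dw 0) xi eta) = Ci / 4 * cov (fun k => H k (x p)) (dx lx xi) (dx lx eta)
      (-1).
Proof.
  intros Hp Dx.
  destruct (contract_eqs p lx Hp Dx xi) as (X1 & X0 & X1'). destruct (contract_eqs p lx Hp Dx eta)
      as (Y1 & Y0 & Y1').
  destruct (dx_real lx xi) as (R2 & _). destruct (dx_real lx eta) as (S2 & _).
  pose proof (dx_2 p lx Hp Dx xi) as E2. pose proof (dx_2 p lx Hp Dx eta) as F2.
  unfold cov, alt. rewrite X1, X0, X1', Y1, Y0, Y1', R2, S2, E2, F2.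
  unfold sum_lt; simpl. unfold wedge, bar, dw, dkappa_bar; simpl.
  rewrite Cminus_conj, !Cmult_conj.
  repeat split; field [Ci_sqr]; cbv beta; apply RtoC_neq; lra.
Qed.
End Main.

(** * Passage to the principal-axes frame *)

(** Counting powers of n: X and Y bring n^4 on the left; on the right H' brings n^2 and [cov_rotate]
    one more n, so 1/n remains. *)
Lemma cov_rotate_normalized (v w vb wb n : C) (H H' X Y X' Y' : Z -> C) (m : Z) :
  (-1 <= m <= 1)%Z -> n = v * vb + w * wb -> n <> 0 ->
  (forall k, (-2 <= k <= 2)%Z -> H' k = sum_sym 2 (fun m => H m * rot2 v w vb wb m k) / n ^ 2) ->
  (forall k, (-2 <= k <= 2)%Z -> n ^ 2 * X k = rotate2 v w vb wb X' k) ->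
  (forall k, (-2 <= k <= 2)%Z -> n ^ 2 * Y k = rotate2 v w vb wb Y' k) ->
  cov H X Y m = / n * sum_sym 1 (fun k => rot1 v w vb wb m k * cov H' X' Y' k).
Proof.
  intros Hm Hn Hn0 HH HX HY.
  assert (E1 : n ^ 4 * cov H X Y m = cov H (rotate2 v w vb wb X') (rotate2 v w vb wb Y') m).
  { spin1 m; unfold cov, contract, alt; rewrite !sum_sym2, <- !HX, <- !HY by lia; ring. }
  set (H2 := fun k => n ^ 2 * H' k).
  assert (E2 : forall k, cov H2 X' Y' k = n ^ 2 * cov H' X' Y' k).
  { intros k. unfold cov, contract, alt, H2. rewrite !sum_sym2. destruct k as [|[]|[]]; ring. }
  rewrite (cov_rotate v w vb wb H H2) in E1; auto.
  - rewrite !sum_sym1, !E2, <- Hn in E1.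
    transitivity (n ^ 4 * cov H X Y m / n ^ 4); [field; auto|]. rewrite E1, sum_sym1. field. auto.
  - intros k Hk. unfold H2. rewrite HH by easy. field. auto.
Qed.

(** H and X transform contragrediently, so their pairing, the constraint dL_{x_0} = 0, has the same
    form in the rotated frame. *)
Lemma contract_rotate (v w vb wb n : C) (H H' X X' : Z -> C) : n <> 0 ->
  (forall k, (-2 <= k <= 2)%Z -> H' k = sum_sym 2 (fun m => H m * rot2 v w vb wb m k) / n ^ 2) ->
  (forall k, (-2 <= k <= 2)%Z -> n ^ 2 * X k = rotate2 v w vb wb X' k) ->
  contract H' 0 X' = contract H 0 X.
Proof.
  intros Hn HH HX. unfold contract. rewrite !sum_sym2. cbn [Z.add]. rewrite !HH by lia.
  transitivity ((H (-2)%Z * (n ^ 2 * X (-2)%Z) + H (-1)%Z * (n ^ 2 * X (-1)%Z) + H 0%Z * (n ^ 2 * X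
      0%Z)
    + H 1%Z * (n ^ 2 * X 1%Z) + H 2%Z * (n ^ 2 * X 2%Z)) / n ^ 2); [|field; auto].
  rewrite !HX by lia. unfold rotate2. rewrite !sum_sym2. field. auto.
Qed.

Lemma dxring_real (e2 r de2 dr : R) (s : quat) : real_spin (dxring e2 r de2 dr s).
Proof.
  unfold real_spin, dxring.
  assert (I4 : Cconj (/ 4) = / 4) by (rewrite Cinv_conj by (apply RtoC_neq; lra); now rewrite
      RtoC_conj).
  assert (I2 : Cconj (/ 2) = / 2) by (rewrite Cinv_conj by (apply RtoC_neq; lra); now rewrite
      RtoC_conj).
  unfold Cdiv. push_conj. rewrite I4, I2, Ci_conj. repeat split; ring.
Qed.

(** The value [de2] is arbitrary because it enters only component 0, which is not among the chi. *)
Lemma chi_dxring (q : C2 -> quat) (e1 e2 e3 : C2 -> R) (p xi : C2) (de2 : R) :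
  let X := dxring (e2 p) (rho e1 e3 p) de2 (dirR (rho e1 e3) p xi) (sigma q p xi) in
  chi q e1 e2 e3 p xi 0 = X 2%Z /\ chi q e1 e2 e3 p xi 1 = X 1%Z /\
  chi q e1 e2 e3 p xi 2 = X (-1)%Z /\ chi q e1 e2 e3 p xi 3 = X (-2)%Z.
Proof.
  unfold chi, mulmv, sum_lt, chi_mx, mx, frame0, dxring. simpl.
  repeat split; ring.
Qed.

(* If h_0 vanished, the constraint would be a linear relation between d rho and the sigma_i,
   nontrivial in sigma_1, sigma_2 since H0' <> 0 forces h_1 <> 0. *)
Lemma hring_0_neq0 (V : C2 -> Prop) (x : C2 -> X5) (q : C2 -> quat) (e1 e2 e3 : C2 -> R) (k H : Z
    -> C) (p : C2)
    (x_param : quaternionic_param V x q e1 e2 e3) (frame : rho_sigma_frame V q e1 e3) :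
  V p -> real_spin k -> H0' k <> 0 ->
  (forall m, (-2 <= m <= 2)%Z -> H m = Cconj (k m)) ->
  (forall xi, contract H 0 (dxring (e2 p) (rho e1 e3 p) (dirR e2 p xi) (dirR (rho e1 e3) p xi)
      (sigma q p xi)) = 0) ->
  k 0%Z <> 0.
Proof.
  intros Hp Hk H0 HH HX K0.
  destruct (x_param p Hp) as (_ & (D0 & D1 & D2 & D3) & (E1 & E2 & E3) & (O32 & O21) & Hc & _).
  assert (S : (e1 p + e2 p + e3 p = 0)%R).
  { apply (cubic_roots_sum (x p)); auto; apply Hc; auto. }
  destruct (sigma_linear q p D0 D1 D2 D3) as (S1 & S2 & S3).
  assert (Sr : R_linear (dirR (rho e1 e3) p)).
  { apply dirR_linear. destruct E1 as [l1 E1], E3 as [l3 E3]. eexists.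
    apply (filterdiff_minus_fct (K := R_AbsRing) (V := R_NormedModule) e1 e3 l1 l3 E1 E3). }
  set (r := rho e1 e3 p) in *.
  (* As the roots sum to zero, 3 e_2 + rho = 2 (e_2 - e_3) and 3 e_2 - rho = 2 (e_2 - e_1), nonzero
     by the ordering of the roots. *)
  assert (N1 : (3 * e2 p + r <> 0)%R) by (unfold r, rho; lra).
  assert (N2 : (3 * e2 p - r <> 0)%R) by (unfold r, rho; lra).
  set (a := Re (k 1%Z)). set (b := Im (k 1%Z)). set (c := Re (k 2%Z)). set (d := Im (k 2%Z)).
  assert (Rel : forall xi, (c * dirR (rho e1 e3) p xi / 2 - 2 * d * r * q3 (sigma q p xi)
     + 2 * a * (3 * e2 p + r) * q2 (sigma q p xi) + 2 * b * (3 * e2 p - r) * q1 (sigma q p xi) =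
         0)%R).
  { intros xi. specialize (HX xi). unfold contract in HX. rewrite sum_sym2 in HX. cbn [Z.add] in HX.
    rewrite !HH in HX by lia. rewrite K0 in HX.
    destruct (real_spin_conj k Hk) as (A2 & A1 & A0 & B1 & B2).
    rewrite A2, A1, B1, B2 in HX.
    destruct Hk as (R2 & R1 & _). rewrite R2, R1 in HX.
    assert (F1 : k 1%Z = RtoC a + Ci * RtoC b) by (unfold a, b, RtoC, Ci; destruct (k 1%Z); simpl;
        apply injective_projections; simpl; ring).
    assert (F2 : k 2%Z = RtoC c + Ci * RtoC d) by (unfold c, d, RtoC, Ci; destruct (k 2%Z); simpl;
        apply injective_projections; simpl; ring).
    rewrite F1, F2 in HX. revert HX. unfold dxring. push_conj. rewrite Ci_conj. intros HX.
    match type of HX with ?u = _ => assert (E : u = RtoC (c * dirR (rho e1 e3) p xi / 2 - 2 * d * r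
        * q3 (sigma q p xi)
     + 2 * a * (3 * e2 p + r) * q2 (sigma q p xi) + 2 * b * (3 * e2 p - r) * q1 (sigma q p xi)))
         end.
    { unfold Rdiv. rewrite !RtoC_plus, !RtoC_minus, !RtoC_mult, !RtoC_plus, !RtoC_minus,
        !RtoC_mult, RtoC_inv by lra.
      field [Ci_sqr]. repeat split; cbv beta; apply RtoC_neq; lra. }
    rewrite E in HX. now injection HX. }
  assert (AB : a <> 0%R \/ b <> 0%R).
  { destruct (Req_dec a 0) as [Ha|Ha]; [right|auto]. intros Hb. apply H0.
    rewrite H0'_eq, K0 by easy.
    replace (k 1%Z) with (RtoC 0) by (apply injective_projections; symmetry; [exact Ha|exact Hb]).
        ring. }
  (* Three real forms on a four-dimensional space have a common zero xi <> 0. If a <> 0, let d rho,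
     sigma_1 and sigma_3 vanish on xi; the relation forces sigma_2 to vanish too, against the
     independence of the frame. If b <> 0, sigma_1 and sigma_2 exchange roles. *)
  destruct AB as [Ha|Hb].
  - destruct (three_forms_kernel _ _ _ Sr S1 S3) as (xi & Hxi & Z0 & Z1 & Z3). cbv beta in Z1, Z3.
    apply Hxi. apply (frame p xi Hp Z0 Z1); auto.
    specialize (Rel xi). rewrite Z0, Z1, Z3 in Rel.
    apply (Rmult_eq_reg_l (a * (3 * e2 p + r))); [lra|]. now apply
        Rmult_integral_contrapositive_currified.
  - destruct (three_forms_kernel _ _ _ Sr S2 S3) as (xi & Hxi & Z0 & Z2 & Z3). cbv beta in Z2, Z3.
    apply Hxi. apply (frame p xi Hp Z0); auto.
    specialize (Rel xi). rewrite Z0, Z2, Z3 in Rel.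
    apply (Rmult_eq_reg_l (b * (3 * e2 p - r))); [lra|]. now apply
        Rmult_integral_contrapositive_currified.
Qed.

Theorem proposition2
    (Omega : X5 -> Prop) (L : X5 -> R)
    (V : C2 -> Prop) (x : C2 -> X5)
    (q : C2 -> quat) (e1 e2 e3 : C2 -> R)
    (open_Omega : open Omega)
    (open_V : open V)
    (L_contour : contour_potential Omega L)
    (x_solution : legendre_solution Omega L V x)
    (x_param : quaternionic_param V x q e1 e2 e3)
    (frame : rho_sigma_frame V q e1 e3) :
  forall p : C2, V p ->
  let hr := hring L (x p) (q p) in
  let lam := lambda hr in
  det 4 (theta_mx hr) <> 0 ->
  forall theta : Z -> covector,
  (forall (xi : C2) (i : nat), (i < 4)%nat ->
     chi q e1 e2 e3 p xi i = mulmv 4 (theta_mx hr) (theta_col theta xi) i) ->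
  (forall xi eta : C2,
     metric L x p xi eta = lam * (abs2 (theta 1%Z) xi eta + abs2 (theta 2%Z) xi eta)) /\
  (forall (m : Z) (xi eta : C2), (-1 <= m <= 1)%Z ->
     cc 1 m * omega L x p m xi eta =
     sum_sym 1 (fun m' => wigner 1 m m' (q p) * (cc 1 m' * omega_ring lam theta m' xi eta))).
Proof.
  intros p Hp hr lam Hdet theta Htheta.
  destruct (hankel_potential Omega L open_Omega L_contour) as (G & H & HGH).
  assert (LG : forall y, Omega y -> diffX (Lc L) (locally y) (dx_form (fun m => G m y))) by (intros
      y Hy; apply (HGH y Hy)).
  assert (GH : forall y m, Omega y -> (-2 <= m <= 2)%Z -> diffX (G m) (locally y) (dx_form (fun m'
      => H (m + m')%Z y)))
    by (intros y m Hy; apply (HGH y Hy)).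
  destruct (x_solution p Hp) as (Hy & [lx Dx] & _).
  destruct (x_param p Hp) as (Hq & _).
  set (v := qv (q p)) in *. set (w := qw (q p)) in *. set (n := RtoC (qnorm2 (q p))).
  assert (Hn : n = v * Cconj v + w * Cconj w) by apply qnorm2_mult.
  assert (Hn0 : n <> 0) by (apply RtoC_neq, Rgt_not_eq, qnorm2_pos, Hq).
  set (Hk := fun k => H k (x p)).
  set (Hr := fun k => sum_sym 2 (fun m => Hk m * rot2 v w (Cconj v) (Cconj w) m k) / n ^ 2).
  set (X := fun xi => dxring (e2 p) (rho e1 e3 p) (dirR e2 p xi) (dirR (rho e1 e3) p xi) (sigma q p
      xi)).
  assert (HX : forall xi k, (-2 <= k <= 2)%Z -> n ^ 2 * dx lx xi k = rotate2 v w (Cconj v) (Cconj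
      w) (X xi) k).
  { intros xi k Hk2. apply (param_tangent V x q e1 e2 e3 open_V x_param p xi k); auto. now apply
      x_jet. }
  assert (Hreal : real_spin hr) by now apply hring_real.
  assert (HHr : forall k, (-2 <= k <= 2)%Z -> Hr k = Cconj (hr k)).
  { intros k Hk2. unfold hr. rewrite hring_rotate by easy. fold v w n. unfold Hr. rewrite
      !sum_sym2. unfold Hk.
    rewrite !(hess_L Omega L open_Omega G H LG GH) by (auto; lia). easy. }
  assert (Ccon : forall xi, contract Hr 0 (X xi) = 0).
  { intros xi. rewrite (contract_rotate v w (Cconj v) (Cconj w) n Hk Hr (dx lx xi) (X xi)); auto.
    apply (contract_eqs Omega L V x open_V x_solution G H LG GH p lx Hp Dx xi). }
  assert (Hdet' := Hdet). rewrite theta_mx_det in Hdet'.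
  assert (N0 : H0' hr <> 0) by (intros E; apply Hdet'; rewrite E; ring).
  assert (K0 : hr 0%Z <> 0) by (apply (hring_0_neq0 V x q e1 e2 e3 hr Hr p); auto).
  set (t := fun xi m => theta m xi : C).
  assert (Teq : forall xi, theta_eqs hr (X xi) (t xi)).
  { intros xi. destruct (chi_dxring q e1 e2 e3 p xi (dirR e2 p xi)) as (C2' & C1' & C1m & C2m).
    destruct (theta_mx_mulmv hr (t xi)) as (M0 & M1 & M2 & M3).
    unfold theta_eqs. fold (X xi) in C2', C1', C1m, C2m.
    rewrite <- C2', <- C1', <- C1m, <- C2m, !Htheta by lia. auto. }
  assert (Tr : forall xi, t xi (-2)%Z = Cconj (t xi 2%Z) /\ t xi (-1)%Z = - Cconj (t xi 1%Z)).
  { intros xi. apply (theta_eqs_real hr (X xi)); auto. apply dxring_real. }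
  (* The factor 4 lambda of [cov_theta] times i/4 is i lambda; reality of theta replaces theta_{-1}
     by -conj theta_1 and theta_{-2} by conj theta_2. *)
  assert (Cr : forall xi eta m, (-1 <= m <= 1)%Z -> Ci / 4 * cov Hr (X xi) (X eta) m = omega_ring
      lam theta m xi eta).
  { intros xi eta m Hm. rewrite (cov_theta hr Hr (X xi) (X eta) (t xi) (t eta) m); auto.
    destruct (Tr xi) as [T2 T1], (Tr eta) as [U2 U1]. rewrite T2, T1, U2, U1.
    unfold omega_ring, wedge, bar, t. fold lam. spin1 m; field; apply RtoC_neq; lra. }
  assert (Cov : forall xi eta m, (-1 <= m <= 1)%Z -> Ci / 4 * cov Hk (dx lx xi) (dx lx eta) m =
     / n * sum_sym 1 (fun k => rot1 v w (Cconj v) (Cconj w) m k * omega_ring lam theta k xi eta)).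
  { intros xi eta m Hm. rewrite (cov_rotate_normalized v w (Cconj v) (Cconj w) n Hk Hr _ _ (X xi)
      (X eta) m); auto.
    rewrite !sum_sym1, <- !Cr by lia. field. split; auto. apply RtoC_neq; lra. }
  pose proof (fun xi eta => omega_cov Omega L V x open_V x_solution G H LG GH p lx xi eta Hp Dx) as
      Om.
  fold Hk in Om.
  (* Row m = 1 of [rot1] makes omega_{+1} a quadratic form in v and conj w with 2-form coefficients,
     and it factors as -(i lambda / n) A /\ B. The matrix taking (theta_2, theta_1) to (A, conj B)
     has rows (v, conj w) and (-w, conj v), so it is unitary up to the factor n; hence |A|^2 + |B|^2
     = n (|theta_1|^2 + |theta_2|^2). *)
  set (A := fun xi => v * t xi 2%Z + Cconj w * t xi 1%Z : C).
  set (B := fun xi => v * Cconj (t xi 1%Z) - Cconj w * Cconj (t xi 2%Z) : C).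
  destruct (holomorphic_factors (- (lam * Ci / n)) A B) as [HA HB].
  { intros xi eta. destruct (Om xi eta) as (O1 & _). rewrite O1, Cov by lia. rewrite sum_sym1.
      expand.
    unfold omega_ring, wedge, bar, A, B, t. field. auto. }
  (* Row m = 0 of [rot1], written in the same A and B. As these are complex linear, the right-hand
     side is visibly of type (1,1), as [hermitian_form] requires. *)
  assert (W : forall xi eta, sum_lt 2 (fun b => wedge (dkappa_bar x H lx p b) (bar (dw b)) xi eta) =
     lam / n * (wedge A (bar A) xi eta + wedge B (bar B) xi eta)).
  { intros xi eta. destruct (Om xi eta) as (_ & O0 & _). rewrite O0.
    transitivity (Ci * (Ci / 4 * cov Hk (dx lx xi) (dx lx eta) 0)); [field [Ci_sqr]; apply
        RtoC_neq; lra|].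
    rewrite Cov by lia. rewrite sum_sym1. expand.
    unfold omega_ring, wedge, bar, A, B, t. push_conj. field [Ci_sqr]. auto. }
  assert (Lin : forall b, real_linear (dkappa_bar x H lx p b)).
  { intros b. apply dkappa_bar_linear. apply Dx. }
  pose proof (hermitian_form (dkappa_bar x H lx p) (lam / n) A B Lin HA HB W) as HF.
  assert (KH : forall a b, (b < 2)%nat -> kappa_hess L x p a b = wirtinger_hess (dkappa_bar x H lx
      p) a b).
  { intros a b Hb. now apply (kappa_hess_eq Omega L V x open_V x_solution G H LG GH). }
  assert (Sum : forall F : nat -> nat -> C,
     sum_lt 2 (fun a => sum_lt 2 (fun b => kappa_hess L x p a b * F a b)) =
     sum_lt 2 (fun a => sum_lt 2 (fun b => wirtinger_hess (dkappa_bar x H lx p) a b * F a b))).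
  { intros F. unfold sum_lt; simpl. now rewrite !KH by lia. }
  split.
  - intros xi eta. unfold metric. rewrite Sum, (proj1 (HF xi eta)).
    unfold abs2, symprod, bar, A, B, t. push_conj. rewrite Hn. field. split; [apply RtoC_neq;
        lra|]. now rewrite <- Hn.
  - intros m xi eta Hm.
    assert (O : omega L x p m xi eta = Ci / 4 * cov Hk (dx lx xi) (dx lx eta) m).
    { destruct (Om xi eta) as (O1 & O0 & Om1). spin1 m; unfold omega.
      - exact Om1.
      - rewrite Sum, (proj2 (HF xi eta)), <- W, O0. field. apply RtoC_neq; lra.
      - exact O1. }
    rewrite O, Cov, !sum_sym1, !wigner1 by (auto; lia). fold v w n.
    pose proof (cc_neq0 1) as Hcc. field. repeat split; auto.
Qed.
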